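(* Let $\Gamma \subset \mathbb{C}$ be a piecewise smooth, simple, closed, positively oriented curve with interior component $\Omega^-$, containing $0$, and exterior component $\Omega^+$. Let $f^-$ be the interior Riemann map of $\Gamma$, extended continuously to $\Gamma$. Let $m > 0$ be an integer and let $q_m$ be the $m$th Faber-Laurent polynomial. Then for all $z \in \Omega^+$, $$\overline{q_m(z)} = -\frac{1}{\pi} \int_\Gamma \left(f^-(y)\right)^m \, \hat{n}\cdot\nabla_y \log|y - z| \, ds(y),$$ where the overline denotes complex conjugation.
   Context: $\mathbb{C}$ is identified with $\mathbb{R}^2$. $\Omega^-$ and $\Omega^+$ denote the bounded (inner) and unbounded (outer) components of $\mathbb{C}\setminus\Gamma$. It is a standing assumption that $0 \in \Omega^-$. Interior Riemann map: $f^-$ is the complex analytic bijection of $\Omega^-$ onto $\{z : |z|<1\}$ with $f^-(0)=0$ and $(f^-)'(0)$ a positive real number. By Carathéodory's theorem it extends continuously to $\Gamma$, giving a one-to-one correspondence between $\Gamma$ and the unit circle; the values of $f^-$ on $\Gamma$ are those of this extension. Faber-Laurent polynomials: the function $g^-(w) = 1/f^-(w)$ has a pole of order $1$ at $w=0$, and for small enough $r>0$ has a Laurent expansion $g^-(w) = \beta_{-1}w^{-1} + \beta_0 + \beta_1 w + \beta_2 w^2 + \cdots$ for $0<|w|<r$. The $m$th Faber-Laurent polynomial $q_m$ is the sum of the terms of negative power of $w$ in the Laurent series of $g^-(w)^m$ about $0$; it is a polynomial in $1/w$ without constant term, with a single pole, of order $m$, at $0$. $\hat{n}\cdot\nabla_y$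 denotes the derivative with respect to $y$ along the outward-facing unit normal $\hat n$ to $\Gamma$ at $y$ (outward with respect to $\Omega^-$, defined at all but finitely many points of $\Gamma$), and $ds$ is arc length. *)

(* Defs.v *)
From Stdlib Require Import Reals List.
From Coquelicot Require Import Coquelicot.

Open Scope R_scope.

(** Topology of the plane *)

Definition connected_set (E : C -> Prop) : Prop :=
  ~ exists U V : C -> Prop,
      open U /\ open V /\
      (forall z, E z -> U z \/ V z) /\
      (exists z, E z /\ U z) /\ (exists z, E z /\ V z) /\
      (forall z, E z -> U z -> V z -> False).

Definition is_component (E D : C -> Prop) : Prop :=
  (exists z, D z) /\
  (forall z, D z -> E z) /\
  connected_set D /\
  (forall D' : C -> Prop,
      connected_set D' -> (forall z, D' z -> E z) ->
      (forall z, D z -> D' z) -> forall z, D' z -> D z).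

Definition bounded_set (E : C -> Prop) : Prop :=
  exists M : R, forall z, E z -> Cmod z <= M.

(** Curves, parametrised by [gamma] on the interval [a, b] *)

Definition trace (gamma : R -> C) (a b : R) (y : C) : Prop :=
  exists t, a <= t <= b /\ y = gamma t.

Definition inner_component (gamma : R -> C) (a b : R) (Omega : C -> Prop) : Prop :=
  is_component (fun y => ~ trace gamma a b y) Omega /\ bounded_set Omega.

Definition outer_component (gamma : R -> C) (a b : R) (Omega : C -> Prop) : Prop :=
  is_component (fun y => ~ trace gamma a b y) Omega /\ ~ bounded_set Omega.

(** On each closed piece the curve is regular and C^1 up to the endpoints: its
    derivative on the open piece extends to a continuous non-vanishing function
    [v] on the closed one. *)
Definition piecewise_smooth (gamma : R -> C) (a b : R) : Prop :=
  continuous_on (fun t => a <= t <= b) gamma /\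
  exists (N : nat) (s : nat -> R),
    s 0%nat = a /\ s N = b /\
    forall i : nat, (i < N)%nat ->
      s i < s (S i) /\
      exists v : R -> C,
        continuous_on (fun t => s i <= t <= s (S i)) v /\
        (forall t, s i <= t <= s (S i) -> v t <> RtoC 0) /\
        (forall t, s i < t < s (S i) ->
           is_derive (V := C_R_NormedModule) gamma t (v t)).

Definition simple_closed (gamma : R -> C) (a b : R) : Prop :=
  a < b /\ gamma a = gamma b /\
  forall s t, a <= s < b -> a <= t < b -> gamma s = gamma t -> s = t.

(** Total function; its values at the finitely many corner parameters are
    irrelevant to the integrals below. *)
Definition velocity (gamma : R -> C) (t : R) : C :=
  (Derive (fun u => Re (gamma u)) t, Derive (fun u => Im (gamma u)) t).

(** Winding number 1 about every point of the interior:
    the integral of dy / (y - z) along the curve is 2 pi i. *)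
Definition positively_oriented
    (gamma : R -> C) (a b : R) (Omega_in : C -> Prop) : Prop :=
  forall z, Omega_in z ->
    is_RInt (V := C_R_NormedModule)
      (fun t => (velocity gamma t / (gamma t - z))%C) a b (2 * PI * Ci)%C.

(** [n] is the unit vector orthogonal to the tangent at [gamma t] that points
    from the interior into the exterior. *)
Definition is_outward_unit_normal
    (gamma : R -> C) (Omega_in Omega_out : C -> Prop) (t : R) (n : C) : Prop :=
  Cmod n = 1 /\
  Re n * Re (velocity gamma t) + Im n * Im (velocity gamma t) = 0 /\
  exists delta, 0 < delta /\
    forall eps : R, 0 < eps < delta ->
      Omega_in (gamma t - eps * n)%C /\ Omega_out (gamma t + eps * n)%C.

Definition is_outward_normal_field
    (gamma : R -> C) (a b : R) (Omega_in Omega_out : C -> Prop) (n : C -> C) : Prop :=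
  exists corners : list C,
    forall t, a <= t <= b -> ~ In (gamma t) corners ->
      is_outward_unit_normal gamma Omega_in Omega_out t (n (gamma t)).

Definition directional_derivative (u : C -> R) (y n : C) : R :=
  Derive (fun h : R => u (y + h * n)%C) 0.

(** Integrals with respect to arc length: ds = |gamma'(t)| dt *)

Definition arc_integrand (gamma : R -> C) (F : C -> C) (t : R) : C :=
  (F (gamma t) * Cmod (velocity gamma t))%C.

Definition ex_arc_integral (gamma : R -> C) (a b : R) (F : C -> C) : Prop :=
  ex_RInt (V := C_R_NormedModule) (arc_integrand gamma F) a b.

Definition arc_integral (gamma : R -> C) (a b : R) (F : C -> C) : C :=
  RInt (V := C_R_CompleteNormedModule) (arc_integrand gamma F) a b.

(** Interior Riemann map, extended continuously to the curve [Gamma] *)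

Record interior_riemann_map (Omega_in Gamma : C -> Prop) (f : C -> C) : Prop := {
  riemann_holomorphic :
    forall z, Omega_in z -> ex_derive (K := C_AbsRing) (V := C_NormedModule) f z;
  riemann_maps_to_disk : forall z, Omega_in z -> Cmod (f z) < 1;
  riemann_injective :
    forall z w, Omega_in z -> Omega_in w -> f z = f w -> z = w;
  riemann_surjective :
    forall u, Cmod u < 1 -> exists z, Omega_in z /\ f z = u;
  riemann_at_0 : f (RtoC 0) = RtoC 0;
  riemann_derivative_at_0 :
    exists r : R, 0 < r /\
      is_derive (K := C_AbsRing) (V := C_NormedModule) f (RtoC 0) (RtoC r);
  riemann_boundary :
    continuous_on (fun z => Omega_in z \/ Gamma z) f
}.

(** [p] is the sum of the terms of negative power in the Laurent series about 0
    of [h], which has at most a pole at 0: [p] is a polynomial in 1/w without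
    constant term, and [h - p] is the sum of a power series for 0 < |w| < r. *)
Definition is_principal_part_at_0 (h p : C -> C) : Prop :=
  exists (N : nat) (c d : nat -> C) (r : R),
    0 < r /\
    (forall w : C, w <> RtoC 0 ->
       p w = sum_n_m (G := C_AbelianMonoid) (fun k => (c k / w ^ k)%C) 1 N) /\
    (forall w : C, 0 < Cmod w < r ->
       is_series (V := C_NormedModule) (fun k => (d k * w ^ k)%C) (h w - p w)%C).

Definition is_faber_laurent (f : C -> C) (m : nat) (q : C -> C) : Prop :=
  is_principal_part_at_0 (fun w => ((/ f w) ^ m)%C) q.

(* Main.v *)
(* On the curve [n ds = - i dy], so [n . grad log|y - z| ds = Im (dy / (y - z))], and [|f| = 1] gives
   [conj (f^m) = f^(-m)]. Hence the integral is [(I1 - conj I2) / 2i] with [I1] the integral of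
   [f^m dy / (y - z)] and [I2] that of [f^(-m) dy / (y - z)]. Cauchy's theorem up to the boundary gives
   [I1 = 0]; as [f^(-m) - q] is holomorphic inside, [I2] is the integral of [q dy / (y - z)], which is
   [- 2 pi i q(z)] by partial fractions and the winding numbers 1 about 0 and 0 about [z].

   Cauchy's theorem up to the boundary: the integrand [g] has a primitive [G] inside, because the
   region is the conformal image of a disk. [G] is Lipschitz near the curve, so it has boundary values
   [H] along inward normals, and [H' = g(gamma) gamma'] on each smooth piece. At a corner the two sides
   are joined inside by arcs of arbitrarily small circles, so [H] does not jump, and the integral of
   [H'] around the closed curve vanishes. That the inward normal is the left one follows from the jump
   of the winding number across the curve. *)

Require Import Defs.
From Stdlib Require Import Reals Lra Lia Psatz List Classical ClassicalEpsilon.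
From Coquelicot Require Import Coquelicot.
Open Scope R_scope.

(** [f] is only continuous up to the curve, so nothing is known about its derivative there. A
    primitive gets round this: as soon as the integrand is bounded near a boundary point, the
    primitive is Lipschitz there. That the region has no holes is drawn from [f] alone, whose
    inverse enters only as a continuous map; its continuity comes from the open mapping theorem,
    which is reduced to Goursat through the maximum principle. The curve is merely C^1 on each
    piece, so its unit normal need not be differentiable and shifting each point along its own
    normal gives no usable path. The curve is shifted by a fixed vector instead, and approach to the
    curve is allowed in all directions within [/ 4] of the left normal, a cone that still contains
    the normals at nearby parameters. At a corner the cones of the two sides may be disjoint, and
    the angle may even be 0. Circular arcs work for every angle, because a small circle about the
    corner meets each side exactly once. That [f] has modulus 1 on the curve is derived from
    bijectivity and continuity up to the boundary. *)

Lemma Cmod_split (a b c : C) : a = (b + c)%C -> Cmod a <= Cmod b + Cmod c.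
Proof. intros ->. apply Cmod_triangle. Qed.

Lemma Cmod_split3 (a b c d : C) :
  a = (b + c + d)%C -> Cmod a <= Cmod b + Cmod c + Cmod d.
Proof.
  intros ->. eapply Rle_trans; [apply Cmod_triangle|].
  apply Rplus_le_compat_r, Cmod_triangle.
Qed.

Ltac le_trans := match goal with |- _ <= _ => eapply Rle_trans | |- _ < _ => eapply Rle_lt_trans end.
Tactic Notation "triangle" constr(b) constr(c) :=
  le_trans; [apply (Cmod_split _ b c); ring|].
Tactic Notation "triangle3" constr(b) constr(c) constr(d) :=
  le_trans; [apply (Cmod_split3 _ b c d); ring|].

(* Closes [Rmin (Rmin x y) z <= y] and the like. *)
Ltac min_le := first [apply Rmin_l | apply Rmin_r |
  eapply Rle_trans; [apply Rmin_l|min_le] | eapply Rle_trans; [apply Rmin_r|min_le]].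

Lemma RtoC_neq_0 (r : R) : 0 < r -> RtoC r <> 0%C.
Proof. intros h E. apply RtoC_inj in E. lra. Qed.

Lemma Cmod_sym (a b : C) : Cmod (a - b) = Cmod (b - a).
Proof. rewrite <- Cmod_opp. f_equal. ring. Qed.

Lemma Cmod_scal (r : R) (c : C) : Cmod (r * c) = Rabs r * Cmod c.
Proof. now rewrite Cmod_mult, Cmod_R. Qed.

Lemma Cmod_scal_pos (r : R) (c : C) : 0 <= r -> Cmod (r * c) = r * Cmod c.
Proof. intros H. rewrite Cmod_scal, Rabs_pos_eq; auto. Qed.

Lemma Cmod_le_Re_Im (c : C) : Cmod c <= Rabs (Re c) + Rabs (Im c).
Proof.
  replace c with (RtoC (Re c) + Im c * Ci)%C at 1.
  - eapply Rle_trans; [apply Cmod_triangle|].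
    rewrite Cmod_R, Cmod_scal, Cmod_Ci. lra.
  - destruct c; unfold Re, Im, Cplus, Cmult, RtoC, Ci; simpl; f_equal; ring.
Qed.

Lemma im_le_Cmod (c : C) : Rabs (Im c) <= Cmod c.
Proof. eapply Rle_trans; [|apply Rmax_Cmod]. apply Rmax_r. Qed.

Lemma re_minus (a b : C) : Re (a - b) = Re a - Re b.
Proof. reflexivity. Qed.

Lemma im_minus (a b : C) : Im (a - b) = Im a - Im b.
Proof. reflexivity. Qed.

Lemma Cmod_0_eq (c : C) : (forall e, 0 < e -> Cmod c <= e) -> c = 0%C.
Proof.
  intros H. apply Cmod_eq_0. destruct (Cmod_ge_0 c) as [h|h]; [|auto].
  specialize (H (Cmod c / 2)). lra.
Qed.

Lemma Rabs_between (x e : R) : - e < x < e -> Rabs x < e.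
Proof. intros H. apply Rabs_def1; lra. Qed.

(** * Intervals *)

(** The supremum of the parameters up to which [P] holds is reached by the closing hypothesis and,
    unless it is [y], passed by the opening one. This principle supplies compactness, connectedness
    and the intermediate value property below. *)
Lemma real_induction (P : R -> Prop) (x y : R) :
  x <= y -> P x ->
  (forall t, x <= t < y -> P t -> exists d, 0 < d /\ forall s, t < s < t + d -> s <= y -> P s) ->
  (forall t, x < t <= y -> (forall s, x <= s < t -> P s) -> P t) ->
  forall t, x <= t <= y -> P t.
Proof.
  intros xy Px Hop Hcl.
  set (E := fun t => x <= t <= y /\ forall s, x <= s <= t -> P s).
  assert (Ex : E x).
  { split; [lra|]. intros s Hs. replace s with x by lra. exact Px. }
  destruct (completeness E) as [m [Hub Hlub]].
  { exists y. intros t [Ht _]. lra. }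
  { now exists x. }
  assert (xm : x <= m) by (apply Hub, Ex).
  assert (my : m <= y) by (apply Hlub; intros t [Ht _]; lra).
  assert (Hlt : forall s, x <= s < m -> P s).
  { intros s Hs. destruct (classic (exists t, E t /\ s < t)) as [(t & [Ht HP] & st)|N].
    - apply HP. lra.
    - exfalso. assert (m <= s); [|lra]. apply Hlub. intros t Et.
      destruct (Rle_dec t s); auto. exfalso. apply N. exists t. split; auto. lra. }
  assert (Pm : P m).
  { destruct (Req_dec x m) as [<-|n]; auto. apply Hcl; [lra|auto]. }
  destruct (Rlt_dec m y) as [h|h].
  - destruct (Hop m) as (d & dp & Hd); [lra|auto|].
    exfalso. set (m' := Rmin y (m + d / 2)).
    assert (m < m' <= y /\ m' < m + d).
    { unfold m', Rmin. destruct Rle_dec; lra. }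
    assert (E m').
    { split; [lra|]. intros s Hs. destruct (Rle_dec s m) as [k|k].
      - destruct (Req_dec s m) as [->|k']; auto. apply Hlt. lra.
      - apply Hd; lra. }
    specialize (Hub m' H0). lra.
  - intros t Ht. destruct (Req_dec t m) as [->|k]; auto. apply Hlt. lra.
Qed.

(** Heine-Borel for a quantitative property: [d] is a tolerance that may always be decreased.
    Instead of a finite subcover, real induction takes the minimum of two tolerances at each
    step. *)
Lemma compact_interval (Q : R -> R -> Prop) (x y : R) :
  x <= y ->
  (forall d d' s, 0 < d' <= d -> Q d s -> Q d' s) ->
  (forall t, x <= t <= y -> exists e d, 0 < e /\ 0 < d /\
     forall s, x <= s <= y -> Rabs (s - t) < e -> Q d s) ->
  exists d, 0 < d /\ forall s, x <= s <= y -> Q d s.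
Proof.
  intros xy Hmon Hloc.
  cut (forall t, x <= t <= y -> exists d, 0 < d /\ forall s, x <= s <= t -> Q d s).
  { intros H. apply H. lra. }
  (* Glues a tolerance valid on [[x, s]] to one valid around [t], provided that [s] already lies in
     this neighbourhood. *)
  assert (join : forall t s d e d', x <= t <= y -> s <= t -> 0 < d -> 0 < d' ->
    (forall r, x <= r <= s -> Q d r) ->
    (forall r, x <= r <= y -> Rabs (r - t) < e -> Q d' r) -> Rabs (s - t) < e ->
    forall u, s <= u <= y -> Rabs (u - t) < e ->
    exists d, 0 < d /\ forall r, x <= r <= u -> Q d r).
  { intros t s d e d' Ht Hs dp dp' H1 H2 H3 u Hu Hut.
    exists (Rmin d d'). split; [apply Rmin_glb_lt; auto|].
    intros r Hr. destruct (Rle_dec r s).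
    - apply Hmon with d; [|apply H1; lra]. split; [apply Rmin_glb_lt; auto|apply Rmin_l].
    - apply Hmon with d'; [|apply H2; [lra|]].
      + split; [apply Rmin_glb_lt; auto|apply Rmin_r].
      + apply Rabs_def2 in H3. apply Rabs_def2 in Hut. apply Rabs_between. lra. }
  apply real_induction.
  - lra.
  - destruct (Hloc x) as (e & d & ep & dp & H); [lra|].
    exists d. split; auto. intros s Hs. replace s with x by lra. apply H; [lra|].
    rewrite Rminus_eq_0, Rabs_R0. auto.
  - intros t Ht (d & dp & Hd). destruct (Hloc t) as (e & d' & ep & dp' & H); [lra|].
    exists e. split; auto. intros s Hs sy.
    apply (join t t d e d'); auto; try lra.
    + rewrite Rminus_eq_0, Rabs_R0. auto.
    + apply Rabs_between. lra.
  - intros t Ht IH. destruct (Hloc t) as (e & d' & ep & dp' & H); [lra|].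
    set (s := Rmax x (t - e / 2)).
    assert (x <= s < t /\ t - e < s) by (unfold s, Rmax; destruct Rle_dec; lra).
    destruct (IH s) as (d & dp & Hd); [lra|].
    apply (join t s d e d'); auto; try lra.
    + apply Rabs_between. lra.
    + rewrite Rminus_eq_0, Rabs_R0. auto.
Qed.

(** Connectedness of [[x, y]], in the form that keeps a path on one side of a separating pair of
    open sets. *)
Lemma locally_constant_interval (P : R -> Prop) (x y : R) :
  x <= y -> P x ->
  (forall t, x <= t <= y -> exists e, 0 < e /\
     forall s, x <= s <= y -> Rabs (s - t) < e -> (P s <-> P t)) ->
  forall t, x <= t <= y -> P t.
Proof.
  intros xy Px H. apply real_induction; auto.
  - intros t Ht Pt. destruct (H t) as (e & ep & He); [lra|].
    exists e. split; auto. intros s Hs sy. apply He; auto; [lra|]. apply Rabs_between; lra.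
  - intros t Ht IH. destruct (H t) as (e & ep & He); [lra|].
    set (s := Rmax x (t - e / 2)).
    assert (x <= s < t /\ t - e < s) by (unfold s, Rmax; destruct Rle_dec; lra).
    apply (He s); [lra| |apply IH; lra]. apply Rabs_between; lra.
Qed.

(** * Continuity and differentiability with explicit epsilons *)

(** [E] need not be a neighbourhood of [z]: with [E] the interior together with the curve this
    expresses continuity up to the boundary. *)
Definition ccont (E : C -> Prop) (f : C -> C) (z : C) : Prop :=
  forall e, 0 < e -> exists d, 0 < d /\
    forall w, E w -> Cmod (w - z) < d -> Cmod (f w - f z) < e.

(** The error is bounded by a multiple of the increment instead of being divided by it, so [w = z]
    needs no exclusion and estimates chain directly. *)
Definition cdiff (f : C -> C) (z l : C) : Prop :=
  forall e, 0 < e -> exists d, 0 < d /\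
    forall w, Cmod (w - z) < d -> Cmod (f w - f z - l * (w - z)) <= e * Cmod (w - z).

Definition pcont (E : R -> Prop) (p : R -> C) (t : R) : Prop :=
  forall e, 0 < e -> exists d, 0 < d /\
    forall s, E s -> Rabs (s - t) < d -> Cmod (p s - p t) < e.

Definition pdiff (p : R -> C) (t : R) (l : C) : Prop :=
  forall e, 0 < e -> exists d, 0 < d /\
    forall s, Rabs (s - t) < d -> Cmod (p s - p t - (s - t)%R * l) <= e * Rabs (s - t).

Lemma ball_Cmod (z w : C) (d : posreal) :
  Cmod (w - z) < d -> ball (M := C_UniformSpace) z d w.
Proof. intros H. now apply C_NormedModule_mixin_compat1. Qed.

Lemma Cmod_ball (z w : C) (e : R) :
  0 < e -> exists d : posreal, forall w, ball (M := C_UniformSpace) z d w -> Cmod (w - z) < e.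
Proof.
  intros ep. assert (h : 0 < e / sqrt 2).
  { apply Rdiv_lt_0_compat; auto. apply sqrt_lt_R0; lra. }
  exists (mkposreal _ h). intros w' Hw.
  apply C_NormedModule_mixin_compat2 in Hw. simpl in Hw.
  replace (sqrt 2 * (e / sqrt 2)) with e in Hw; [exact Hw|].
  field. apply Rgt_not_eq, sqrt_lt_R0; lra.
Qed.

Lemma cdiff_of_is_derive (f : C -> C) (z l : C) :
  is_derive (K := C_AbsRing) (V := C_NormedModule) f z l -> cdiff f z l.
Proof.
  intros [_ H] e ep.
  specialize (H z (fun P HP => HP) (mkposreal e ep)).
  destruct H as [d Hd]. exists d. split; [apply cond_pos|].
  intros w Hw. specialize (Hd w Hw).
  change (Cmod (f w - f z - (w - z) * l) <= e * Cmod (w - z)) in Hd.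
  replace (l * (w - z))%C with ((w - z) * l)%C by ring. exact Hd.
Qed.

Lemma continuous_on_ccont (E : C -> Prop) (f : C -> C) :
  continuous_on (T := C_UniformSpace) (U := C_UniformSpace) E f ->
  forall z, E z -> ccont E f z.
Proof.
  intros H z Ez e ep. destruct (Cmod_ball (f z) z e ep) as [d Hd].
  destruct (H z Ez (fun w => Cmod (w - f z) < e)) as [d' Hd'].
  { exists d. auto. }
  exists d'. split; [apply cond_pos|]. intros w Ew Hw. apply Hd'; auto.
  now apply ball_Cmod.
Qed.

Lemma continuous_on_pcont (E : R -> Prop) (p : R -> C) :
  continuous_on (T := R_UniformSpace) (U := C_UniformSpace) E p ->
  forall t, E t -> pcont E p t.
Proof.
  intros H t Et e ep. destruct (Cmod_ball (p t) (p t) e ep) as [d Hd].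
  destruct (H t Et (fun w => Cmod (w - p t) < e)) as [d' Hd'].
  { exists d. auto. }
  exists d'. split; [apply cond_pos|]. intros s Es Hs. apply Hd'; auto.
Qed.

Lemma continuous_of_pcont (p : R -> C) (t : R) :
  pcont (fun _ => True) p t -> continuous (T := R_UniformSpace) (U := C_R_NormedModule) p t.
Proof.
  intros H P [d Hd]. destruct (H d (cond_pos d)) as (d' & dp & Hd').
  exists (mkposreal d' dp). intros s Hs. apply Hd, ball_Cmod, Hd'; auto.
Qed.

Lemma C_R_norm (c : C) : norm (V := C_R_NormedModule) c = Cmod c.
Proof.
  unfold norm; simpl. unfold prod_norm, Cmod. f_equal.
  change (norm (fst c)) with (Rabs (fst c)). change (norm (snd c)) with (Rabs (snd c)).
  rewrite !pow2_abs. reflexivity.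
Qed.

Lemma pdiff_of_is_derive (p : R -> C) (t : R) (l : C) :
  is_derive (V := C_R_NormedModule) p t l -> pdiff p t l.
Proof.
  intros [_ H] e ep.
  specialize (H t (fun P HP => HP) (mkposreal e ep)).
  destruct H as [d Hd]. exists d. split; [apply cond_pos|].
  intros s Hs. specialize (Hd s Hs).
  rewrite C_R_norm in Hd. rewrite <- scal_R_Cmult. exact Hd.
Qed.

Lemma is_derive_of_pdiff (p : R -> C) (t : R) (l : C) :
  pdiff p t l -> is_derive (V := C_R_NormedModule) p t l.
Proof.
  intros H. split; [apply is_linear_scal_l|].
  intros x Hx e.
  pose proof (is_filter_lim_locally_unique (V := R_NormedModule) t x Hx). subst x.
  destruct (H e (cond_pos e)) as (d & dp & Hd).
  exists (mkposreal d dp). intros s Hs. specialize (Hd s Hs).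
  rewrite C_R_norm. rewrite <- scal_R_Cmult in Hd. exact Hd.
Qed.

Lemma pdiff_Re (p : R -> C) (t : R) (l : C) :
  pdiff p t l -> is_derive (fun s => Re (p s)) t (Re l).
Proof.
  intros H. apply is_derive_Reals. intros e ep.
  destruct (H (e / 2)) as (d & dp & Hd); [lra|].
  exists (mkposreal d dp). intros h h0 hd. simpl in hd.
  specialize (Hd (t + h)). replace (t + h - t) with h in Hd by ring.
  specialize (Hd hd).
  replace ((Re (p (t + h)%R) - Re (p t)) / h - Re l)
    with (Re (p (t + h)%R - p t - h * l)%C / h).
  2: { rewrite !re_minus, re_scal_l. field. auto. }
  rewrite Rabs_div; auto.
  apply Rmult_lt_reg_r with (Rabs h); [apply Rabs_pos_lt; auto|].
  unfold Rdiv. rewrite Rmult_assoc, Rinv_l, Rmult_1_r; [|apply Rabs_no_R0; auto].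
  eapply Rle_lt_trans; [apply re_le_Cmod|]. eapply Rle_lt_trans; [apply Hd|].
  apply Rmult_lt_compat_r; [apply Rabs_pos_lt; auto|lra].
Qed.

Lemma pdiff_cmult (c : C) (p : R -> C) (t : R) (l : C) :
  pdiff p t l -> pdiff (fun s => c * p s)%C t (c * l)%C.
Proof.
  intros H e ep. pose proof (Cmod_ge_0 c) as hc.
  destruct (H (e / (Cmod c + 1))) as (d & dp & Hd).
  { apply Rdiv_lt_0_compat; lra. }
  exists d. split; auto. intros s Hs. specialize (Hd s Hs).
  replace (c * p s - c * p t - (s - t)%R * (c * l))%C
    with (c * (p s - p t - (s - t)%R * l))%C by ring.
  rewrite Cmod_mult.
  eapply Rle_trans; [apply Rmult_le_compat_l; [auto|apply Hd]|].
  rewrite <- Rmult_assoc. apply Rmult_le_compat_r; [apply Rabs_pos|].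
  apply Rmult_le_reg_r with (Cmod c + 1); [lra|]. field_simplify; nra.
Qed.

Lemma pdiff_Im (p : R -> C) (t : R) (l : C) :
  pdiff p t l -> is_derive (fun s => Im (p s)) t (Im l).
Proof.
  intros H. apply (pdiff_cmult (- Ci)%C) in H. apply pdiff_Re in H.
  assert (E : forall c : C, Re (- Ci * c) = Im c).
  { intros c. rewrite re_mult. unfold Ci, Copp, Re, Im; simpl. ring. }
  rewrite E in H. eapply is_derive_ext; [|exact H]. intros s. apply E.
Qed.

Lemma pdiff_plus (p q : R -> C) (t : R) (l k : C) :
  pdiff p t l -> pdiff q t k -> pdiff (fun s => p s + q s)%C t (l + k)%C.
Proof.
  intros H1 H2 e ep.
  destruct (H1 (e / 2)) as (d1 & dp1 & Hd1); [lra|].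
  destruct (H2 (e / 2)) as (d2 & dp2 & Hd2); [lra|].
  exists (Rmin d1 d2). split; [apply Rmin_glb_lt; auto|]. intros s Hs.
  specialize (Hd1 s (Rlt_le_trans _ _ _ Hs (Rmin_l _ _))).
  specialize (Hd2 s (Rlt_le_trans _ _ _ Hs (Rmin_r _ _))).
  triangle (p s - p t - (s - t)%R * l)%C (q s - q t - (s - t)%R * k)%C. lra.
Qed.

Lemma pdiff_linear (c k : C) (t : R) : pdiff (fun s => k + s * c)%C t c.
Proof.
  intros e ep. exists 1. split; [lra|]. intros s _.
  replace (k + s * c - (k + t * c) - (s - t)%R * c)%C with (0 : C).
  - rewrite Cmod_0. pose proof (Rabs_pos (s - t)). nra.
  - rewrite RtoC_minus. ring.
Qed.

Lemma pdiff_ext_loc (p q : R -> C) (t : R) (l : C) (e : R) :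
  0 < e -> (forall s, Rabs (s - t) < e -> p s = q s) -> pdiff p t l -> pdiff q t l.
Proof.
  intros ep Heq H k kp. destruct (H k kp) as (d & dp & Hd).
  exists (Rmin d e). split; [apply Rmin_glb_lt; auto|]. intros s Hs.
  rewrite <- Heq, <- Heq.
  - apply Hd. eapply Rlt_le_trans; [apply Hs|apply Rmin_l].
  - rewrite Rminus_eq_0, Rabs_R0. auto.
  - eapply Rlt_le_trans; [apply Hs|apply Rmin_r].
Qed.

Lemma pdiff_lipschitz (p : R -> C) (t : R) (l : C) :
  pdiff p t l -> exists d, 0 < d /\
    forall s, Rabs (s - t) < d -> Cmod (p s - p t) <= (Cmod l + 1) * Rabs (s - t).
Proof.
  intros H. destruct (H 1 Rlt_0_1) as (d & dp & Hd). exists d. split; auto.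
  intros s Hs. specialize (Hd s Hs).
  triangle (p s - p t - (s - t)%R * l)%C ((s - t)%R * l)%C.
  rewrite Cmod_scal. lra.
Qed.

Lemma pdiff_pcont (p : R -> C) (t : R) (l : C) (E : R -> Prop) : pdiff p t l -> pcont E p t.
Proof.
  intros H e ep. destruct (pdiff_lipschitz _ _ _ H) as (d & dp & Hd).
  pose proof (Cmod_ge_0 l).
  assert (0 < e / (Cmod l + 1)) by (apply Rdiv_lt_0_compat; lra).
  exists (Rmin d (e / (Cmod l + 1))). split; [apply Rmin_glb_lt; auto|].
  intros s _ Hs. eapply Rle_lt_trans; [apply Hd|].
  - eapply Rlt_le_trans; [apply Hs|apply Rmin_l].
  - assert (Rabs (s - t) < e / (Cmod l + 1)).
    { eapply Rlt_le_trans; [apply Hs|apply Rmin_r]. }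
    apply Rmult_lt_compat_l with (r := Cmod l + 1) in H2; [|lra].
    replace ((Cmod l + 1) * (e / (Cmod l + 1))) with e in H2; [lra|field; lra].
Qed.

Lemma pdiff_comp (G : C -> C) (p : R -> C) (t : R) (l k : C) :
  pdiff p t l -> cdiff G (p t) k -> pdiff (fun s => G (p s)) t (k * l)%C.
Proof.
  intros H1 H2 e ep.
  pose proof (Cmod_ge_0 l). pose proof (Cmod_ge_0 k).
  destruct (pdiff_lipschitz _ _ _ H1) as (d0 & dp0 & Hd0).
  destruct (H2 (e / 2 / (Cmod l + 1))) as (d1 & dp1 & Hd1).
  { apply Rdiv_lt_0_compat; lra. }
  destruct (H1 (e / 2 / (Cmod k + 1))) as (d2 & dp2 & Hd2).
  { apply Rdiv_lt_0_compat; lra. }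
  destruct (pdiff_pcont _ _ _ (fun _ => True) H1 d1 dp1) as (d3 & dp3 & Hd3).
  exists (Rmin d0 (Rmin d2 d3)). split; [repeat apply Rmin_glb_lt; auto|].
  intros s Hs.
  assert (Rabs (s - t) < d0) by (eapply Rlt_le_trans; [apply Hs|apply Rmin_l]).
  assert (Rabs (s - t) < d2).
  { eapply Rlt_le_trans; [apply Hs|min_le]. }
  assert (Rabs (s - t) < d3).
  { eapply Rlt_le_trans; [apply Hs|min_le]. }
  specialize (Hd0 s H3). specialize (Hd2 s H4). specialize (Hd3 s I H5).
  specialize (Hd1 _ Hd3).
  pose proof (Rabs_pos (s - t)).
  triangle (G (p s) - G (p t) - k * (p s - p t))%C (k * (p s - p t - (s - t)%R * l))%C.
  rewrite Cmod_mult.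
  assert (A : Cmod (G (p s) - G (p t) - k * (p s - p t)) <= e / 2 * Rabs (s - t)).
  { eapply Rle_trans; [apply Hd1|].
    eapply Rle_trans; [apply Rmult_le_compat_l; [|apply Hd0]|].
    - left. apply Rdiv_lt_0_compat; lra.
    - right. field. lra. }
  assert (B : Cmod k * Cmod (p s - p t - (s - t)%R * l) <= e / 2 * Rabs (s - t)).
  { eapply Rle_trans; [apply Rmult_le_compat_l; [auto|apply Hd2]|].
    rewrite <- Rmult_assoc. apply Rmult_le_compat_r; auto.
    apply Rmult_le_reg_r with (Cmod k + 1); [lra|].
    replace (Cmod k * (e / 2 / (Cmod k + 1)) * (Cmod k + 1)) with (Cmod k * (e / 2))
      by (field; lra). nra. }
  lra.
Qed.

(** Precomposing with this 1-Lipschitz retraction turns continuity relative to [[x, y]] into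
    continuity on the whole line, as the integration and mean value theorems require. *)
Definition clamp (x y t : R) : R := Rmax x (Rmin y t).

Lemma clamp_in (x y t : R) : x <= y -> x <= clamp x y t <= y.
Proof. intros. unfold clamp, Rmax, Rmin. repeat destruct Rle_dec; lra. Qed.

Lemma clamp_id (x y t : R) : x <= t <= y -> clamp x y t = t.
Proof. intros. unfold clamp, Rmax, Rmin. repeat destruct Rle_dec; lra. Qed.

Lemma clamp_lip (x y s t : R) : Rabs (clamp x y s - clamp x y t) <= Rabs (s - t).
Proof.
  unfold clamp, Rmax, Rmin. repeat destruct Rle_dec;
  unfold Rabs; repeat destruct Rcase_abs; lra.
Qed.

Lemma pcont_clamp (p : R -> C) (x y : R) :
  x <= y -> (forall t, x <= t <= y -> pcont (fun s => x <= s <= y) p t) ->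
  forall t, pcont (fun _ => True) (fun s => p (clamp x y s)) t.
Proof.
  intros xy H t e ep. destruct (H (clamp x y t) (clamp_in _ _ _ xy) e ep) as (d & dp & Hd).
  exists d. split; auto. intros s _ Hs. apply Hd; [now apply clamp_in|].
  eapply Rle_lt_trans; [apply clamp_lip|auto].
Qed.

(** A complex-valued function satisfies no mean value equality, so the real theorem is applied to
    the component along the total increment: with [c] the conjugate of [p y - p x], the increment of
    [Re (c * p)] is the square of the modulus to be bounded. *)
Lemma mvt_bound (p dp : R -> C) (x y M : R) :
  x <= y ->
  (forall t, x <= t <= y -> pcont (fun s => x <= s <= y) p t) ->
  (forall t, x < t < y -> pdiff p t (dp t)) ->
  (forall t, x < t < y -> Cmod (dp t) <= M) ->
  Cmod (p y - p x) <= M * (y - x).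
Proof.
  intros [xy|xy] Hc Hd HM.
  2: { subst y. replace (p x - p x)%C with (0 : C) by ring. rewrite Cmod_0. lra. }
  set (c := Cconj (p y - p x)%C).
  set (q := fun t => (c * p (clamp x y t))%C).
  (* The mean value point may be an endpoint, where no derivative is given; the value 0 there is
     harmless since [0 <= M]. *)
  set (dq := fun t => if excluded_middle_informative (x < t < y) then (c * dp t)%C else 0%C).
  assert (M0 : 0 <= M).
  { eapply Rle_trans; [apply Cmod_ge_0|apply (HM ((x + y) / 2)); lra]. }
  destruct (MVT_gen (fun t => Re (q t)) x y (fun t => Re (dq t))) as (t & Ht & E).
  - rewrite Rmin_left, Rmax_right by lra. intros t Ht.
    apply pdiff_Re. unfold dq. destruct excluded_middle_informative; [|tauto].
    apply pdiff_cmult. apply (pdiff_ext_loc p) with (e := Rmin (t - x) (y - t)); auto.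
    + apply Rmin_glb_lt; lra.
    + intros s Hs. rewrite clamp_id; auto.
      pose proof (Rmin_l (t - x) (y - t)). pose proof (Rmin_r (t - x) (y - t)).
      apply Rabs_def2 in Hs. lra.
  - intros t _ e ep.
    destruct (pcont_clamp p x y (Rlt_le _ _ xy) Hc t (e / (Cmod c + 1))) as (d & dpos & Hdd).
    { apply Rdiv_lt_0_compat; auto. pose proof (Cmod_ge_0 c). lra. }
    exists d. split; auto. intros s [_ Hs].
    change (Rabs (Re (q s) - Re (q t)) < e). change (Rabs (s - t) < d) in Hs.
    specialize (Hdd s I Hs).
    rewrite <- re_minus. eapply Rle_lt_trans; [apply re_le_Cmod|].
    unfold q.
    replace (c * p (clamp x y s) - c * p (clamp x y t))%C
      with (c * (p (clamp x y s) - p (clamp x y t)))%C by ring.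
    rewrite Cmod_mult. pose proof (Cmod_ge_0 c).
    apply Rle_lt_trans with ((Cmod c) * (e / (Cmod c + 1))).
    + apply Rmult_le_compat_l; lra.
    + apply Rmult_lt_reg_r with (Cmod c + 1); [lra|].
      replace (Cmod c * (e / (Cmod c + 1)) * (Cmod c + 1)) with (Cmod c * e) by (field; lra).
      nra.
  - cbv beta in E. rewrite <- re_minus in E. unfold q in E.
    rewrite !clamp_id in E by lra.
    replace (c * p y - c * p x)%C with ((p y - p x) * Cconj (p y - p x))%C in E
      by (unfold c; ring).
    rewrite <- Cmod2_conj in E. rewrite re_RtoC in E.
    assert (K : Re (dq t) <= Cmod (p y - p x) * M).
    { eapply Rle_trans; [apply Rle_abs|]. eapply Rle_trans; [apply re_le_Cmod|].
      unfold dq. destruct excluded_middle_informative.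
      - rewrite Cmod_mult. unfold c. rewrite Cmod_conj.
        apply Rmult_le_compat_l; [apply Cmod_ge_0|auto].
      - rewrite Cmod_0. apply Rmult_le_pos; auto. apply Cmod_ge_0. }
    destruct (Cmod_ge_0 (p y - p x)) as [h|h]; [|rewrite <- h; apply Rmult_le_pos; lra].
    apply Rmult_le_reg_l with (Cmod (p y - p x)); auto.
    replace (Cmod (p y - p x) * Cmod (p y - p x)) with (Cmod (p y - p x) ^ 2) by ring.
    rewrite E. rewrite <- Rmult_assoc. apply Rmult_le_compat_r; lra.
Qed.

Lemma pdiff_zero_const (p : R -> C) (x y : R) :
  x <= y -> (forall t, x <= t <= y -> pdiff p t 0) -> p y = p x.
Proof.
  intros xy H. apply Ceq_minus, Cmod_0_eq. intros e ep.
  eapply Rle_trans; [apply (mvt_bound p (fun _ => 0%C) x y 0); auto|].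
  - intros t Ht. apply pdiff_pcont with (RtoC 0). auto.
  - intros t Ht. apply H. lra.
  - intros. rewrite Cmod_0. lra.
  - lra.
Qed.

(** * Complex differentiability *)

Lemma cdiff_lipschitz (f : C -> C) (z l : C) :
  cdiff f z l -> exists d, 0 < d /\
    forall w, Cmod (w - z) < d -> Cmod (f w - f z) <= (Cmod l + 1) * Cmod (w - z).
Proof.
  intros H. destruct (H 1 Rlt_0_1) as (d & dp & Hd). exists d. split; auto.
  intros s Hs. specialize (Hd s Hs).
  triangle (f s - f z - l * (s - z))%C (l * (s - z))%C.
  rewrite Cmod_mult. lra.
Qed.

Lemma cdiff_ccont (f : C -> C) (z l : C) (E : C -> Prop) : cdiff f z l -> ccont E f z.
Proof.
  intros H e ep. destruct (cdiff_lipschitz _ _ _ H) as (d & dp & Hd).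
  pose proof (Cmod_ge_0 l).
  assert (0 < e / (Cmod l + 1)) by (apply Rdiv_lt_0_compat; lra).
  exists (Rmin d (e / (Cmod l + 1))). split; [apply Rmin_glb_lt; auto|].
  intros s _ Hs. eapply Rle_lt_trans; [apply Hd|].
  - eapply Rlt_le_trans; [apply Hs|apply Rmin_l].
  - assert (Cmod (s - z) < e / (Cmod l + 1)).
    { eapply Rlt_le_trans; [apply Hs|apply Rmin_r]. }
    apply Rmult_lt_compat_l with (r := Cmod l + 1) in H2; [|lra].
    replace ((Cmod l + 1) * (e / (Cmod l + 1))) with e in H2; [lra|field; lra].
Qed.

Lemma cdiff_ext_loc (f g : C -> C) (z l : C) (e : R) :
  0 < e -> (forall w, Cmod (w - z) < e -> f w = g w) -> cdiff f z l -> cdiff g z l.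
Proof.
  intros ep Heq H k kp. destruct (H k kp) as (d & dp & Hd).
  exists (Rmin d e). split; [apply Rmin_glb_lt; auto|]. intros s Hs.
  rewrite <- Heq, <- Heq.
  - apply Hd. eapply Rlt_le_trans; [apply Hs|apply Rmin_l].
  - replace (z - z)%C with (0 : C) by ring. now rewrite Cmod_0.
  - eapply Rlt_le_trans; [apply Hs|apply Rmin_r].
Qed.

Lemma cdiff_const (c z : C) : cdiff (fun _ => c) z 0.
Proof.
  intros e ep. exists 1. split; [lra|]. intros w _.
  replace (c - c - 0 * (w - z))%C with (0 : C) by ring. rewrite Cmod_0.
  pose proof (Cmod_ge_0 (w - z)). nra.
Qed.

Lemma cdiff_id (z : C) : cdiff (fun w => w) z 1.
Proof.
  intros e ep. exists 1. split; [lra|]. intros w _.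
  replace (w - z - 1 * (w - z))%C with (0 : C) by ring. rewrite Cmod_0.
  pose proof (Cmod_ge_0 (w - z)). nra.
Qed.

Lemma cdiff_plus (f g : C -> C) (z l k : C) :
  cdiff f z l -> cdiff g z k -> cdiff (fun w => f w + g w)%C z (l + k)%C.
Proof.
  intros H1 H2 e ep.
  destruct (H1 (e / 2)) as (d1 & dp1 & Hd1); [lra|].
  destruct (H2 (e / 2)) as (d2 & dp2 & Hd2); [lra|].
  exists (Rmin d1 d2). split; [apply Rmin_glb_lt; auto|]. intros s Hs.
  specialize (Hd1 s (Rlt_le_trans _ _ _ Hs (Rmin_l _ _))).
  specialize (Hd2 s (Rlt_le_trans _ _ _ Hs (Rmin_r _ _))).
  triangle (f s - f z - l * (s - z))%C (g s - g z - k * (s - z))%C. lra.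
Qed.

Lemma mult_div_succ_le (a e : R) : 0 <= a -> 0 < e -> a * (e / (a + 1)) <= e.
Proof.
  intros ha ep. apply Rmult_le_reg_r with (a + 1); [lra|].
  replace (a * (e / (a + 1)) * (a + 1)) with (a * e) by (field; lra). nra.
Qed.

Lemma cdiff_mult (f g : C -> C) (z l k : C) :
  cdiff f z l -> cdiff g z k -> cdiff (fun w => f w * g w)%C z (l * g z + f z * k)%C.
Proof.
  intros H1 H2 e ep.
  pose proof (Cmod_ge_0 l) as hl. pose proof (Cmod_ge_0 (g z)) as hg.
  pose proof (Cmod_ge_0 (f z)) as hf.
  destruct (H1 (e / 3 / (Cmod (g z) + 1))) as (d1 & dp1 & Hd1).
  { apply Rdiv_lt_0_compat; lra. }
  destruct (H2 (e / 3 / (Cmod (f z) + 1))) as (d2 & dp2 & Hd2).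
  { apply Rdiv_lt_0_compat; lra. }
  destruct (cdiff_ccont _ _ _ (fun _ => True) H2 (Rmin 1 (e / 3 / (Cmod l + 1))))
    as (d3 & dp3 & Hd3).
  { apply Rmin_glb_lt; [lra|]. apply Rdiv_lt_0_compat; lra. }
  exists (Rmin d1 (Rmin d2 d3)). split; [repeat apply Rmin_glb_lt; auto|].
  intros w Hw.
  assert (K1 : Cmod (w - z) < d1) by (eapply Rlt_le_trans; [apply Hw|apply Rmin_l]).
  assert (K2 : Cmod (w - z) < d2).
  { eapply Rlt_le_trans; [apply Hw|min_le]. }
  assert (K3 : Cmod (w - z) < d3).
  { eapply Rlt_le_trans; [apply Hw|min_le]. }
  specialize (Hd1 w K1). specialize (Hd2 w K2). specialize (Hd3 w I K3).
  pose proof (Cmod_ge_0 (w - z)) as hw.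
  triangle3 ((f w - f z - l * (w - z)) * g w)%C (l * (g w - g z) * (w - z))%C (f z * (g w - g z - k * (w - z)))%C.
  rewrite !Cmod_mult.
  pose proof (Rlt_le_trans _ _ _ Hd3 (Rmin_l _ _)) as G1.
  pose proof (Rlt_le_trans _ _ _ Hd3 (Rmin_r _ _)) as G2.
  assert (G3 : Cmod (g w) <= Cmod (g z) + 1).
  { triangle (g z) (g w - g z)%C. lra. }
  assert (A : Cmod (f w - f z - l * (w - z)) * Cmod (g w) <= e / 3 * Cmod (w - z)).
  { eapply Rle_trans; [apply Rmult_le_compat; [apply Cmod_ge_0|apply Cmod_ge_0|apply Hd1|apply G3]|].
    right. field. lra. }
  assert (B : Cmod l * Cmod (g w - g z) * Cmod (w - z) <= e / 3 * Cmod (w - z)).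
  { apply Rmult_le_compat_r; auto.
    eapply Rle_trans; [apply Rmult_le_compat_l; [auto|left; apply G2]|].
    apply mult_div_succ_le; lra. }
  assert (D : Cmod (f z) * Cmod (g w - g z - k * (w - z)) <= e / 3 * Cmod (w - z)).
  { eapply Rle_trans; [apply Rmult_le_compat_l; [auto|apply Hd2]|].
    rewrite <- Rmult_assoc. apply Rmult_le_compat_r; auto. apply mult_div_succ_le; lra. }
  lra.
Qed.

Lemma cdiff_cmult_id (c z : C) : cdiff (fun w => c * w)%C z c.
Proof.
  assert (H := cdiff_mult _ _ _ _ _ (cdiff_const c z) (cdiff_id z)).
  cbv beta in H. replace (0 * z + c * 1)%C with c in H by ring. exact H.
Qed.

Lemma cdiff_comp (G p : C -> C) (t l k : C) :
  cdiff p t l -> cdiff G (p t) k -> cdiff (fun s => G (p s)) t (k * l)%C.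
Proof.
  intros H1 H2 e ep.
  pose proof (Cmod_ge_0 l). pose proof (Cmod_ge_0 k).
  destruct (cdiff_lipschitz _ _ _ H1) as (d0 & dp0 & Hd0).
  destruct (H2 (e / 2 / (Cmod l + 1))) as (d1 & dp1 & Hd1).
  { apply Rdiv_lt_0_compat; lra. }
  destruct (H1 (e / 2 / (Cmod k + 1))) as (d2 & dp2 & Hd2).
  { apply Rdiv_lt_0_compat; lra. }
  destruct (cdiff_ccont _ _ _ (fun _ => True) H1 d1 dp1) as (d3 & dp3 & Hd3).
  exists (Rmin d0 (Rmin d2 d3)). split; [repeat apply Rmin_glb_lt; auto|].
  intros s Hs.
  assert (Cmod (s - t) < d0) by (eapply Rlt_le_trans; [apply Hs|apply Rmin_l]).
  assert (Cmod (s - t) < d2).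
  { eapply Rlt_le_trans; [apply Hs|min_le]. }
  assert (Cmod (s - t) < d3).
  { eapply Rlt_le_trans; [apply Hs|min_le]. }
  specialize (Hd0 s H3). specialize (Hd2 s H4). specialize (Hd3 s I H5).
  specialize (Hd1 _ Hd3).
  pose proof (Cmod_ge_0 (s - t)).
  triangle (G (p s) - G (p t) - k * (p s - p t))%C (k * (p s - p t - l * (s - t)))%C.
  rewrite Cmod_mult.
  assert (A : Cmod (G (p s) - G (p t) - k * (p s - p t)) <= e / 2 * Cmod (s - t)).
  { eapply Rle_trans; [apply Hd1|].
    eapply Rle_trans; [apply Rmult_le_compat_l; [|apply Hd0]|].
    - left. apply Rdiv_lt_0_compat; lra.
    - right. field. lra. }
  assert (B : Cmod k * Cmod (p s - p t - l * (s - t)) <= e / 2 * Cmod (s - t)).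
  { eapply Rle_trans; [apply Rmult_le_compat_l; [auto|apply Hd2]|].
    rewrite <- Rmult_assoc. apply Rmult_le_compat_r; auto. apply mult_div_succ_le; lra. }
  lra.
Qed.

Lemma cdiff_inv (z : C) : z <> 0%C -> cdiff Cinv z (- / (z * z))%C.
Proof.
  intros hz e ep. pose proof (proj1 (Cmod_gt_0 z) hz) as mz.
  set (m := Cmod z) in *.
  assert (m3 : 0 < m * m * m / 2) by (pose proof (Rmult_lt_0_compat _ _ mz mz); nra).
  exists (Rmin (m / 2) (e * (m * m * m / 2))). split; [apply Rmin_glb_lt; nra|].
  intros w Hw.
  pose proof (Rlt_le_trans _ _ _ Hw (Rmin_l _ _)) as H1.
  pose proof (Rlt_le_trans _ _ _ Hw (Rmin_r _ _)) as H2.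
  assert (mw : m / 2 <= Cmod w).
  { assert (m <= Cmod w + Cmod (z - w)) by (apply Cmod_split; ring).
    rewrite Cmod_sym in H. lra. }
  assert (hw : w <> 0%C) by (apply Cmod_gt_0; lra).
  replace (/ w - / z - - / (z * z) * (w - z))%C
    with ((w - z) * (w - z) * / (z * z * w))%C by (field; auto).
  rewrite !Cmod_mult, Cmod_inv, !Cmod_mult.
  2: { repeat apply Cmult_neq_0; auto. }
  fold m. rewrite (Rmult_assoc (Cmod (w - z))). rewrite (Rmult_comm (Cmod (w - z))).
  apply Rmult_le_compat_r; [apply Cmod_ge_0|].
  apply Rmult_le_reg_r with (m * m * Cmod w); [nra|].
  rewrite Rmult_assoc, Rinv_l, Rmult_1_r; [|nra].
  apply Rle_trans with (e * (m * m * m / 2)); [lra|].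
  apply Rmult_le_compat_l; [lra|]. nra.
Qed.

Lemma cdiff_inv_fun (f : C -> C) (z l : C) :
  f z <> 0%C -> cdiff f z l -> exists k, cdiff (fun w => / f w)%C z k.
Proof. intros h H. eexists. exact (cdiff_comp _ _ _ _ _ H (cdiff_inv _ h)). Qed.

Lemma cdiff_pow (f : C -> C) (z l : C) (n : nat) :
  cdiff f z l -> exists k, cdiff (fun w => f w ^ n)%C z k.
Proof.
  intros H. induction n as [|n [k IH]].
  - exists (RtoC 0). apply (cdiff_const (RtoC 1)).
  - eexists. exact (cdiff_mult _ _ _ _ _ H IH).
Qed.

Lemma cdiff_affine_prim (c l z : C) :
  cdiff (fun w => c * w + l * (w * w) / 2)%C z (c + l * z)%C.
Proof.
  replace (c + l * z)%C with
    ((0 * z + c * 1) + (0 * (z * z / 2) + l * ((1 * z + z * 1) * / 2 + (z * z) * 0)))%C.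
  2: { field. }
  apply cdiff_plus.
  - apply (cdiff_mult (fun _ => c) (fun w => w)); [apply cdiff_const|apply cdiff_id].
  - apply cdiff_ext_loc with (f := fun w => (l * (w * w / 2))%C) (e := 1); [lra| |].
    { intros. unfold Cdiv. ring. }
    apply (cdiff_mult (fun _ => l) (fun w => w * w / 2)%C); [apply cdiff_const|].
    apply (cdiff_mult (fun w => w * w)%C (fun w => / 2)%C); [|apply cdiff_const].
    apply (cdiff_mult (fun w => w) (fun w => w)); apply cdiff_id.
Qed.

(** * Integrals of complex-valued functions *)

(* Coquelicot's lemmas state equalities in the carrier of a structure; [ring] needs the type [C]. *)
Ltac eqC := match goal with |- @eq _ ?a ?b => change (@eq C a b) end.

Notation is_RIntC := (is_RInt (V := C_R_NormedModule)).
Notation RIntC := (RInt (V := C_R_CompleteNormedModule)).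

Lemma is_RIntC_bound (f : R -> C) (a b M : R) (l : C) :
  a <= b -> (forall t, a <= t <= b -> Cmod (f t) <= M) -> is_RIntC f a b l ->
  Cmod l <= M * (b - a).
Proof.
  intros ab H HI. rewrite <- C_R_norm.
  apply (norm_RInt_le f (fun _ => M) a b l); auto.
  - intros x Hx. rewrite C_R_norm. auto.
  - replace (M * (b - a)) with (scal (b - a) M) by (unfold scal; simpl; unfold mult; simpl; ring).
    apply (is_RInt_const a b M).
Qed.

Lemma is_RIntC_minus (f g : R -> C) (a b : R) (l k : C) :
  is_RIntC f a b l -> is_RIntC g a b k -> is_RIntC (fun t => f t - g t)%C a b (l - k)%C.
Proof. exact (is_RInt_minus f g a b l k). Qed.

Lemma is_RIntC_plus (f g : R -> C) (a b : R) (l k : C) :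
  is_RIntC f a b l -> is_RIntC g a b k -> is_RIntC (fun t => f t + g t)%C a b (l + k)%C.
Proof. exact (is_RInt_plus f g a b l k). Qed.

Lemma is_RIntC_continuous (f : R -> C) (a b : R) :
  a <= b -> (forall t, a <= t <= b -> pcont (fun _ => True) f t) ->
  is_RIntC f a b (RIntC f a b).
Proof.
  intros ab H. apply (RInt_correct (V := C_R_CompleteNormedModule)).
  apply ex_RInt_continuous. rewrite Rmin_left, Rmax_right by auto.
  intros t Ht. apply continuous_of_pcont. auto.
Qed.

Definition seg (g : C -> C) (a b : C) : C :=
  RIntC (fun t : R => (b - a) * g (a + t * (b - a)))%C 0 1.

Definition seg_cont (g : C -> C) (a b : C) : Prop :=
  forall t : R, 0 <= t <= 1 -> ccont (fun _ => True) g (a + t * (b - a))%C.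

Lemma pcont_seg (g : C -> C) (a b : C) (t : R) :
  ccont (fun _ => True) g (a + t * (b - a))%C ->
  pcont (fun _ => True) (fun t : R => (b - a) * g (a + t * (b - a)))%C t.
Proof.
  intros H e ep. pose proof (Cmod_ge_0 (b - a)) as h.
  destruct (H (e / (Cmod (b - a) + 1))) as (d & dp & Hd).
  { apply Rdiv_lt_0_compat; lra. }
  exists (d / (Cmod (b - a) + 1)). split; [apply Rdiv_lt_0_compat; lra|].
  intros s _ Hs.
  assert (K : Cmod (a + s * (b - a) - (a + t * (b - a))) < d).
  { replace (a + s * (b - a) - (a + t * (b - a)))%C with ((s - t)%R * (b - a))%C
      by (rewrite RtoC_minus; ring).
    rewrite Cmod_scal. apply Rle_lt_trans with (Rabs (s - t) * (Cmod (b - a) + 1)).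
    - pose proof (Rabs_pos (s - t)). nra.
    - apply Rmult_lt_reg_r with (/ (Cmod (b - a) + 1)); [apply Rinv_0_lt_compat; lra|].
      rewrite Rmult_assoc, Rinv_r, Rmult_1_r by lra. exact Hs. }
  specialize (Hd _ I K).
  replace ((b - a) * g (a + s * (b - a)) - (b - a) * g (a + t * (b - a)))%C
    with ((b - a) * (g (a + s * (b - a)) - g (a + t * (b - a))))%C by ring.
  rewrite Cmod_mult.
  apply Rle_lt_trans with (Cmod (b - a) * (e / (Cmod (b - a) + 1))).
  - apply Rmult_le_compat_l; lra.
  - apply Rmult_lt_reg_r with (Cmod (b - a) + 1); [lra|].
    replace (Cmod (b - a) * (e / (Cmod (b - a) + 1)) * (Cmod (b - a) + 1))
      with (Cmod (b - a) * e) by (field; lra). nra.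
Qed.

Lemma is_RInt_seg (g : C -> C) (a b : C) :
  seg_cont g a b ->
  is_RIntC (fun t : R => (b - a) * g (a + t * (b - a)))%C 0 1 (seg g a b).
Proof.
  intros H. apply is_RIntC_continuous; [lra|]. intros t Ht. apply pcont_seg. auto.
Qed.

Lemma seg_eq (g : C -> C) (a b l : C) :
  is_RIntC (fun t : R => (b - a) * g (a + t * (b - a)))%C 0 1 l -> seg g a b = l.
Proof. intros H. apply (is_RInt_unique (V := C_R_CompleteNormedModule)). exact H. Qed.

Lemma seg_rev (g : C -> C) (a b : C) : seg_cont g a b -> seg g b a = (- seg g a b)%C.
Proof.
  intros H. apply seg_eq.
  apply is_RInt_ext with (fun t : R => scal (V := C_R_NormedModule) (-1)
     ((b - a) * g (a + (-1 * t + 1)%R * (b - a)))%C).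
  - intros t _. eqC; rewrite scal_R_Cmult. replace (-1 * t + 1) with (1 - t) by ring.
    replace (RtoC (-1)) with (- RtoC 1)%C by (rewrite <- RtoC_opp; f_equal; ring).
    rewrite RtoC_minus.
    replace (a + (1 - t) * (b - a))%C with (b + t * (a - b))%C by ring. ring.
  - apply (is_RInt_comp_lin (V := C_R_NormedModule)
      (fun t : R => (b - a) * g (a + t * (b - a)))%C (-1) 1 0 1).
    replace (-1 * 0 + 1) with 1 by ring. replace (-1 * 1 + 1) with 0 by ring.
    apply (is_RInt_swap (V := C_R_NormedModule)). now apply is_RInt_seg.
Qed.

Lemma seg_half (g : C -> C) (a b : C) :
  seg_cont g a b -> seg g a b = (seg g a ((a + b) / 2) + seg g ((a + b) / 2) b)%C.
Proof.
  intros H.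
  assert (two : RtoC 2 <> 0%C) by (apply RtoC_neq_0; lra).
  set (F := fun t : R => ((b - a) * g (a + t * (b - a)))%C).
  assert (HF : forall t, 0 <= t <= 1 -> pcont (fun _ => True) F t).
  { intros t Ht. apply pcont_seg. auto. }
  assert (I1 : is_RIntC F 0 (1 / 2) (RIntC F 0 (1 / 2))).
  { apply is_RIntC_continuous; [lra|]. intros; apply HF; lra. }
  assert (I2 : is_RIntC F (1 / 2) 1 (RIntC F (1 / 2) 1)).
  { apply is_RIntC_continuous; [lra|]. intros; apply HF; lra. }
  rewrite (seg_eq g a b _ (is_RInt_Chasles _ _ _ _ _ _ I1 I2)).
  eqC. symmetry. change plus with Cplus. f_equal; apply seg_eq.
  - apply is_RInt_ext with (fun t : R => scal (V := C_R_NormedModule) (1 / 2) (F (1 / 2 * t + 0))).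
    + intros t _. eqC; rewrite scal_R_Cmult. unfold F.
      rewrite RtoC_plus, RtoC_mult, RtoC_div by lra.
      replace (a + (1 / 2 * t + 0) * (b - a))%C with (a + t * ((a + b) / 2 - a))%C
        by (field; auto).
      field; auto.
    + apply (is_RInt_comp_lin (V := C_R_NormedModule)).
      replace (1 / 2 * 0 + 0) with 0 by field. replace (1 / 2 * 1 + 0) with (1 / 2) by field.
      exact I1.
  - apply is_RInt_ext with
      (fun t : R => scal (V := C_R_NormedModule) (1 / 2) (F (1 / 2 * t + 1 / 2))).
    + intros t _. eqC; rewrite scal_R_Cmult. unfold F.
      rewrite RtoC_plus, RtoC_mult, RtoC_div by lra.
      replace (a + (1 / 2 * t + 1 / 2) * (b - a))%C
        with ((a + b) / 2 + t * (b - (a + b) / 2))%C by (field; auto).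
      field; auto.
    + apply (is_RInt_comp_lin (V := C_R_NormedModule)).
      replace (1 / 2 * 0 + 1 / 2) with (1 / 2) by field.
      replace (1 / 2 * 1 + 1 / 2) with 1 by field.
      exact I2.
Qed.

Lemma is_RIntC_prim (P p : R -> C) (a b : R) :
  a <= b -> (forall t, a <= t <= b -> pdiff P t (p t)) ->
  (forall t, a <= t <= b -> pcont (fun _ => True) p t) ->
  is_RIntC p a b (P b - P a)%C.
Proof.
  intros ab H1 H2.
  apply (is_RInt_derive (V := C_R_CompleteNormedModule)); rewrite Rmin_left, Rmax_right by lra.
  - intros t Ht. apply is_derive_of_pdiff. auto.
  - intros t Ht. apply continuous_of_pcont. auto.
Qed.

Lemma pdiff_segment (a b : C) (t : R) : pdiff (fun t : R => a + t * (b - a))%C t (b - a)%C.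
Proof. apply pdiff_linear. Qed.

Lemma seg_prim (g P : C -> C) (a b : C) :
  seg_cont g a b ->
  (forall t : R, 0 <= t <= 1 -> cdiff P (a + t * (b - a))%C (g (a + t * (b - a))%C)) ->
  seg g a b = (P b - P a)%C.
Proof.
  intros H1 H2. apply seg_eq.
  replace (P b - P a)%C with (P (a + 1 * (b - a)) - P (a + 0 * (b - a)))%C
    by (f_equal; [|f_equal]; f_equal; ring).
  apply (is_RIntC_prim (fun t : R => P (a + t * (b - a))%C)); [lra| |].
  - intros t Ht. rewrite Cmult_comm.
    apply (pdiff_comp P (fun t : R => a + t * (b - a))%C); [apply pdiff_segment|auto].
  - intros t Ht. apply pcont_seg; auto.
Qed.

Lemma seg_approx (g h : C -> C) (a b : C) (e : R) :
  seg_cont g a b -> seg_cont h a b ->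
  (forall t : R, 0 <= t <= 1 ->
     Cmod (g (a + t * (b - a))%C - h (a + t * (b - a))%C) <= e) ->
  Cmod (seg g a b - seg h a b) <= e * Cmod (b - a).
Proof.
  intros H1 H2 H. replace (e * Cmod (b - a)) with (e * Cmod (b - a) * (1 - 0)) by ring.
  eapply is_RIntC_bound; [lra| |apply is_RIntC_minus; apply is_RInt_seg; auto].
  intros t Ht. cbv beta.
  replace ((b - a) * g (a + t * (b - a)) - (b - a) * h (a + t * (b - a)))%C
    with ((b - a) * (g (a + t * (b - a)) - h (a + t * (b - a))))%C by ring.
  rewrite Cmod_mult, Rmult_comm. apply Rmult_le_compat_r; [apply Cmod_ge_0|auto].
Qed.

Lemma seg_const (c a b : C) : seg (fun _ => c) a b = (c * (b - a))%C.
Proof.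
  rewrite (seg_prim _ (fun w => c * w)%C).
  - ring.
  - intros t _. apply cdiff_ccont with (RtoC 0). apply cdiff_const.
  - intros t _. apply cdiff_cmult_id.
Qed.

Lemma seg_approx_const (g : C -> C) (c a b : C) (e : R) :
  seg_cont g a b ->
  (forall t : R, 0 <= t <= 1 -> Cmod (g (a + t * (b - a))%C - c) <= e) ->
  Cmod (seg g a b - c * (b - a)) <= e * Cmod (b - a).
Proof.
  intros H1 H. rewrite <- seg_const. apply seg_approx; auto.
  intros t _. apply cdiff_ccont with (RtoC 0). apply cdiff_const.
Qed.

(** * Goursat's lemma *)

(** The limit exists componentwise and inherits the geometric rate. Both uses need this rate: the
    nested triangles of Goursat and the values of a primitive along a normal. *)
Lemma C_complete (u : nat -> C) (K : R) :
  (forall n m, (n <= m)%nat -> Cmod (u m - u n) <= K / 2 ^ n) ->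
  exists p, forall n, Cmod (p - u n) <= K / 2 ^ n.
Proof.
  intros H.
  assert (K0 : 0 <= K).
  { specialize (H 0%nat 0%nat (le_n _)). simpl in H. pose proof (Cmod_ge_0 (u 0%nat - u 0%nat)).
    lra. }
  assert (small : forall e, 0 < e -> exists N, forall n, (N <= n)%nat -> K / 2 ^ n < e).
  { intros e ep.
    assert (hK : Rabs (/ 2) < 1) by (rewrite Rabs_pos_eq; lra).
    destruct (pow_lt_1_zero (/ 2) hK (e / (K + 1))) as [N HN].
    { apply Rdiv_lt_0_compat; lra. }
    exists N. intros n Hn. specialize (HN n Hn).
    rewrite Rabs_pos_eq in HN by (apply pow_le; lra).
    rewrite pow_inv in HN.
    apply Rle_lt_trans with ((K + 1) * / 2 ^ n).
    - apply Rmult_le_compat_r; [|lra]. left. apply Rinv_0_lt_compat, pow_lt. lra.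
    - apply Rmult_lt_compat_l with (r := K + 1) in HN; [|lra].
      replace ((K + 1) * (e / (K + 1))) with e in HN by (field; lra). exact HN. }
  assert (cauchy : forall e, 0 < e -> exists N, forall n m, (N <= n)%nat -> (N <= m)%nat ->
    Cmod (u n - u m) < e).
  { intros e ep. destruct (small e ep) as [N HN]. exists N. intros n m Hn Hm.
    destruct (Nat.le_ge_cases n m) as [h|h].
    - rewrite Cmod_sym. eapply Rle_lt_trans; [apply H; auto|auto].
    - eapply Rle_lt_trans; [apply H; auto|auto]. }
  destruct (Rcomplete.R_complete (fun n => Re (u n))) as [x Hx].
  { intros e ep. destruct (cauchy e ep) as [N HN]. exists N. intros n m Hn Hm.
    unfold Rdist. rewrite <- re_minus. eapply Rle_lt_trans; [apply re_le_Cmod|auto]. }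
  destruct (Rcomplete.R_complete (fun n => Im (u n))) as [y Hy].
  { intros e ep. destruct (cauchy e ep) as [N HN]. exists N. intros n m Hn Hm.
    unfold Rdist. rewrite <- im_minus. eapply Rle_lt_trans; [apply im_le_Cmod|auto]. }
  exists (x, y). intros n. apply le_epsilon. intros e ep.
  destruct (Hx (e / 2)) as [N1 H1]; [lra|]. destruct (Hy (e / 2)) as [N2 H2]; [lra|].
  set (m := (n + N1 + N2)%nat).
  specialize (H1 m ltac:(unfold m; lia)). specialize (H2 m ltac:(unfold m; lia)).
  specialize (H n m ltac:(unfold m; lia)).
  triangle (u m - u n)%C ((x, y) - u m)%C.
  assert (Cmod ((x, y) - u m) <= e); [|lra].
  eapply Rle_trans; [apply Cmod_le_Re_Im|].
  rewrite re_minus, im_minus, (Rabs_minus_sym (Re _)), (Rabs_minus_sym (Im _)).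
  unfold Rdist in *. unfold Re at 2, Im at 2. simpl fst. simpl snd. lra.
Qed.

(** The second clause is topological closedness: the nested triangles of Goursat shrink to a point
    that must stay in [D]. *)
Definition convex_closed (D : C -> Prop) : Prop :=
  (forall a b, D a -> D b -> forall t : R, 0 <= t <= 1 -> D (a + t * (b - a))%C) /\
  (forall z, (forall e, 0 < e -> exists w, D w /\ Cmod (w - z) < e) -> D z).

Definition tri (g : C -> C) (a b c : C) : C := (seg g a b + seg g b c + seg g c a)%C.

Lemma tri_subdivide (D : C -> Prop) (g : C -> C) (a b c : C) :
  convex_closed D -> (forall w, D w -> ccont (fun _ => True) g w) -> D a -> D b -> D c ->
  tri g a b c =
   (tri g a ((a + b) / 2) ((c + a) / 2) + tri g ((a + b) / 2) b ((b + c) / 2) +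
    tri g ((c + a) / 2) ((b + c) / 2) c +
    tri g ((b + c) / 2) ((c + a) / 2) ((a + b) / 2))%C.
Proof.
  intros [cv _] Hg Da Db Dc.
  assert (mid : forall x y, D x -> D y -> D ((x + y) / 2)%C).
  { intros x y Dx Dy. replace ((x + y) / 2)%C with (x + (1 / 2)%R * (y - x))%C.
    - apply cv; auto. lra.
    - rewrite RtoC_div by lra. field. }
  assert (sc : forall x y, D x -> D y -> seg_cont g x y).
  { intros x y Dx Dy t Ht. apply Hg, cv; auto. }
  unfold tri.
  rewrite (seg_half g a b), (seg_half g b c), (seg_half g c a) by auto.
  rewrite (seg_rev g ((a + b) / 2) ((c + a) / 2)) by auto.
  rewrite (seg_rev g ((c + a) / 2) ((b + c) / 2)) by auto.
  rewrite (seg_rev g ((a + b) / 2) ((b + c) / 2)) by auto.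
  ring.
Qed.

(** An affine function has a quadratic primitive, whose increments cancel around the triangle. *)
Lemma tri_affine (c0 l a b c : C) : tri (fun w => c0 + l * w)%C a b c = 0%C.
Proof.
  assert (ct : forall x y, seg_cont (fun w => c0 + l * w)%C x y).
  { intros x y t _. eapply cdiff_ccont. apply cdiff_plus; [apply cdiff_const|].
    apply (cdiff_mult (fun _ => l) (fun w => w)); [apply cdiff_const|apply cdiff_id]. }
  unfold tri. rewrite !(seg_prim _ (fun w => c0 * w + l * (w * w) / 2)%C); auto.
  - ring.
  - intros; apply cdiff_affine_prim.
  - intros; apply cdiff_affine_prim.
  - intros; apply cdiff_affine_prim.
Qed.

Lemma half_close (x y z : C) (d : R) :
  Cmod (x - z) <= d -> Cmod (y - z) <= d -> Cmod ((x + y) / 2 - z) <= d.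
Proof.
  intros H1 H2.
  assert (two : RtoC 2 <> 0%C) by (apply RtoC_neq_0; lra).
  eapply Rle_trans; [apply Cmod_split with (b := ((1 / 2)%R * (x - z))%C)
    (c := ((1 / 2)%R * (y - z))%C); rewrite RtoC_div by lra; field; auto|].
  rewrite !Cmod_scal_pos by lra. lra.
Qed.

Lemma half_diff (x y z : C) (d : R) :
  Cmod (x - y) <= d -> Cmod ((x + z) / 2 - (y + z) / 2) <= d / 2.
Proof.
  intros H.
  assert (two : RtoC 2 <> 0%C) by (apply RtoC_neq_0; lra).
  replace ((x + z) / 2 - (y + z) / 2)%C with ((1 / 2)%R * (x - y))%C
    by (rewrite RtoC_div by lra; field; auto).
  rewrite Cmod_scal_pos by lra. lra.
Qed.

Definition small_triangle (d : R) (T : C * C * C) : Prop :=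
  let '(a, b, c) := T in Cmod (b - a) <= d /\ Cmod (c - b) <= d /\ Cmod (a - c) <= d.

(** Among the four triangles of the subdivision one carries at least a quarter of the integral,
    while all sides are halved. The distance between the first vertices is recorded because these
    vertices form the Cauchy sequence of the limit argument. *)
Lemma tri_step (D : C -> Prop) (g : C -> C) (a b c : C) (d : R) :
  convex_closed D -> (forall w, D w -> ccont (fun _ => True) g w) -> D a -> D b -> D c ->
  small_triangle d (a, b, c) ->
  exists a' b' c', D a' /\ D b' /\ D c' /\ small_triangle (d / 2) (a', b', c') /\
    Cmod (a' - a) <= d /\ Cmod (tri g a b c) / 4 <= Cmod (tri g a' b' c').
Proof.
  intros cc Hg Da Db Dc (H1 & H2 & H3).
  pose proof (tri_subdivide D g a b c cc Hg Da Db Dc) as E.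
  destruct cc as [cv _].
  assert (mid : forall x y, D x -> D y -> D ((x + y) / 2)%C).
  { intros x y Dx Dy. replace ((x + y) / 2)%C with (x + (1 / 2)%R * (y - x))%C.
    - apply cv; auto. lra.
    - rewrite RtoC_div by lra. field. }
  assert (two : RtoC 2 <> 0%C) by (apply RtoC_neq_0; lra).
  assert (d0 : 0 <= d) by (eapply Rle_trans; [apply Cmod_ge_0|apply H1]).
  assert (aa : forall x : C, ((x + x) / 2)%C = x) by (intros; field; auto).
  assert (sm : forall x y z, Cmod (x - y) <= d -> Cmod ((x + z) / 2 - (y + z) / 2) <= d / 2)
    by (intros; now apply half_diff).
  assert (H1' := H1). rewrite Cmod_sym in H1'. assert (H2' := H2). rewrite Cmod_sym in H2'.
  assert (H3' := H3). rewrite Cmod_sym in H3'.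
  assert (z0 : Cmod (a - a) <= d) by (replace (a - a)%C with (0 : C) by ring; rewrite Cmod_0; auto).
  set (T1 := tri g a ((a + b) / 2) ((c + a) / 2)) in *.
  set (T2 := tri g ((a + b) / 2) b ((b + c) / 2)) in *.
  set (T3 := tri g ((c + a) / 2) ((b + c) / 2) c) in *.
  set (T4 := tri g ((b + c) / 2) ((c + a) / 2) ((a + b) / 2)) in *.
  assert (Q : Cmod (tri g a b c) <= Cmod T1 + Cmod T2 + Cmod T3 + Cmod T4).
  { rewrite E. eapply Rle_trans; [apply Cmod_triangle|].
    apply Rplus_le_compat_r. eapply Rle_trans; [apply Cmod_triangle|].
    apply Rplus_le_compat_r, Cmod_triangle. }
  assert (Q' : Cmod (tri g a b c) / 4 <= Cmod T1 \/ Cmod (tri g a b c) / 4 <= Cmod T2 \/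
    Cmod (tri g a b c) / 4 <= Cmod T3 \/ Cmod (tri g a b c) / 4 <= Cmod T4) by lra.
  assert (com : forall x y : C, (x + y)%C = (y + x)%C) by (intros; ring).
  destruct Q' as [q|[q|[q|q]]].
  - exists a, ((a + b) / 2)%C, ((c + a) / 2)%C. repeat split; auto.
    + pose proof (sm b a a H1) as h. rewrite aa, (com b a) in h. exact h.
    + rewrite (com c a), (com a c), (com a b). apply sm. rewrite Cmod_sym. auto.
    + pose proof (sm a c a H3) as h. rewrite aa in h. exact h.
  - exists ((a + b) / 2)%C, b, ((b + c) / 2)%C. repeat split; auto.
    + pose proof (sm b a b H1) as h. rewrite aa in h. exact h.
    + pose proof (sm c b b H2) as h. rewrite aa, (com c b) in h. exact h.
    + rewrite (com b c). apply sm. auto.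
    + apply half_close; auto.
  - exists ((c + a) / 2)%C, ((b + c) / 2)%C, c. repeat split; auto.
    + rewrite (com c a). apply sm. auto.
    + pose proof (sm c b c H2) as h. rewrite aa in h. exact h.
    + pose proof (sm a c c H3) as h. rewrite aa, (com a c) in h. exact h.
    + apply half_close; auto.
  - exists ((b + c) / 2)%C, ((c + a) / 2)%C, ((a + b) / 2)%C. repeat split; auto.
    + rewrite (com c a). apply sm. auto.
    + rewrite (com c a), (com a c), (com a b). rewrite (com b a). rewrite (com a b).
      replace ((a + c) / 2)%C with ((c + a) / 2)%C by (f_equal; ring).
      replace ((a + b) / 2)%C with ((b + a) / 2)%C by (f_equal; ring).
      apply sm. auto.
    + rewrite (com b c). apply sm. auto.
    + apply half_close; auto.
Qed.

Lemma goursat (D : C -> Prop) (g : C -> C) (a b c : C) :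
  convex_closed D -> (forall w, D w -> exists l, cdiff g w l) -> D a -> D b -> D c ->
  tri g a b c = 0%C.
Proof.
  intros cc Hg Da Db Dc.
  assert (Hc : forall w, D w -> ccont (fun _ => True) g w).
  { intros w Dw. destruct (Hg w Dw) as [l Hl]. now apply cdiff_ccont with l. }
  set (d := Cmod (b - a) + Cmod (c - b) + Cmod (a - c)).
  set (I0 := Cmod (tri g a b c)).
  pose proof (Cmod_ge_0 (b - a)). pose proof (Cmod_ge_0 (c - b)). pose proof (Cmod_ge_0 (a - c)).
  assert (d0 : 0 <= d) by (unfold d; lra).
  set (vtx := fun T : C * C * C => fst (fst T)).
  set (area := fun T : C * C * C => tri g (fst (fst T)) (snd (fst T)) (snd T)).
  set (inD := fun T : C * C * C => D (fst (fst T)) /\ D (snd (fst T)) /\ D (snd T)).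
  set (good := fun n T => inD T /\ small_triangle (d / 2 ^ n) T /\ I0 / 4 ^ n <= Cmod (area T)).
  set (next := fun n T T' => good (S n) T' /\ Cmod (vtx T' - vtx T) <= d / 2 ^ n).
  (* One subtriangle is chosen at each stage; [tri_step] guarantees that a suitable one exists, so
     the default triangle never matters. *)
  set (u := fix u n := match n with O => (a, b, c) | S n =>
    epsilon (inhabits (a, b, c)) (next n (u n)) end).
  assert (Hu : forall n, good n (u n) /\ next n (u n) (u (S n))).
  { assert (st : forall n, good n (u n) -> next n (u n) (u (S n))).
    { intros n Hn. simpl. apply epsilon_spec.
      destruct (u n) as [[x y] z]. destruct Hn as ((Dx & Dy & Dz) & Hs & Ha). simpl in *.
      destruct (tri_step D g x y z (d / 2 ^ n) cc Hc Dx Dy Dz Hs)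
        as (x' & y' & z' & Dx' & Dy' & Dz' & Hs' & Hv & Ha').
      exists (x', y', z'). split; [split; [|split]|].
      - repeat split; auto.
      - replace (d / 2 ^ S n) with (d / 2 ^ n / 2); auto. simpl. field. apply pow_nonzero. lra.
      - unfold area in *. simpl fst in *. simpl snd in *.
        eapply Rle_trans; [|apply Ha'].
        replace (I0 / 4 ^ S n) with (I0 / 4 ^ n / 4); [lra|]. simpl. field. apply pow_nonzero. lra.
      - exact Hv. }
    induction n as [|n [_ IH]].
    - assert (good 0%nat (u 0%nat)).
      { split; [repeat split; auto|]. split.
        - unfold small_triangle. simpl. rewrite Rdiv_1_r. unfold d. lra.
        - simpl. rewrite Rdiv_1_r. apply Rle_refl. }
      auto.
    - destruct IH as [IH _]. auto. }
  destruct (C_complete (fun n => vtx (u n)) (2 * d)) as [p Hp].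
  { assert (A : forall n k, Cmod (vtx (u (n + k)%nat) - vtx (u n)) <= 2 * d / 2 ^ n - 2 * d / 2 ^ (n + k)).
    { intros n k. induction k as [|k IH].
      - rewrite Nat.add_0_r. replace (vtx (u n) - vtx (u n))%C with (0 : C) by ring.
        rewrite Cmod_0. lra.
      - rewrite Nat.add_succ_r.
        destruct (Hu (n + k)%nat) as [_ [_ Hv]].
        eapply Rle_trans; [apply Cmod_split with (b := (vtx (u (n + k)%nat) - vtx (u n))%C)
          (c := (vtx (u (S (n + k))) - vtx (u (n + k)%nat))%C); ring|].
        replace (2 * d / 2 ^ S (n + k)) with (d / 2 ^ (n + k)).
        + replace (2 * d / 2 ^ (n + k)) with (d / 2 ^ (n + k) + d / 2 ^ (n + k)) in IH;
          [lra|field; apply pow_nonzero; lra].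
        + simpl. field. apply pow_nonzero; lra. }
    intros n m nm. replace m with (n + (m - n))%nat by lia.
    eapply Rle_trans; [apply A|].
    assert (0 <= 2 * d / 2 ^ (n + (m - n))); [|lra].
    apply Rmult_le_pos; [lra|]. left. apply Rinv_0_lt_compat, pow_lt. lra. }
  assert (Dp : D p).
  { apply (proj2 cc). intros e ep.
    destruct (pow_lt_1_zero (/ 2) ltac:(rewrite Rabs_pos_eq; lra) (e / (2 * d + 1))) as [N HN].
    { apply Rdiv_lt_0_compat; lra. }
    exists (vtx (u N)). destruct (Hu N) as [[[Dv _] _] _]. split; auto.
    rewrite Cmod_sym. eapply Rle_lt_trans; [apply Hp|].
    specialize (HN N (le_n _)). rewrite Rabs_pos_eq, pow_inv in HN by (apply pow_le; lra).
    assert (0 < / 2 ^ N) by (apply Rinv_0_lt_compat, pow_lt; lra).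
    apply Rmult_lt_compat_l with (r := 2 * d + 1) in HN; [|lra].
    replace ((2 * d + 1) * (e / (2 * d + 1))) with e in HN by (field; lra). unfold Rdiv. nra. }
  destruct (Hg p Dp) as [l Hl].
  apply Cmod_0_eq. intros e ep.
  (* The constant 9: the first vertex is within [2 * s] of the limit point, hence the whole triangle
     within [3 * s], and the affine approximation errs by at most [k * (3 * s)] along each of three
     sides of length at most [s]. *)
  set (k := e / (9 * d * d + 1)).
  assert (kp : 0 < k) by (apply Rdiv_lt_0_compat; nra).
  destruct (Hl k kp) as (r & rp & Hr).
  destruct (pow_lt_1_zero (/ 2) ltac:(rewrite Rabs_pos_eq; lra) (r / (3 * d + 1))) as [N HN].
  { apply Rdiv_lt_0_compat; lra. }
  specialize (HN N (le_n _)). rewrite Rabs_pos_eq, pow_inv in HN by (apply pow_le; lra).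
  assert (i2 : 0 < / 2 ^ N) by (apply Rinv_0_lt_compat, pow_lt; lra).
  assert (small : 3 * d / 2 ^ N < r).
  { apply Rmult_lt_compat_l with (r := 3 * d + 1) in HN; [|lra].
    replace ((3 * d + 1) * (r / (3 * d + 1))) with r in HN by (field; lra). unfold Rdiv. nra. }
  specialize (Hp N). destruct (Hu N) as [[HD [Hs Ha]] _].
  destruct (u N) as [[x y] z]. unfold vtx, area, inD in *. simpl fst in *. simpl snd in *.
  destruct HD as (Dx & Dy & Dz). destruct Hs as (S1 & S2 & S3).
  set (s := d / 2 ^ N) in *.
  assert (s0 : 0 <= s) by (apply Rmult_le_pos; lra).
  replace (2 * d / 2 ^ N) with (2 * s) in Hp by (unfold s; field; apply pow_nonzero; lra).
  replace (3 * d / 2 ^ N) with (3 * s) in small by (unfold s; field; apply pow_nonzero; lra).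
  rewrite Cmod_sym in Hp.
  assert (near : forall v w (t : R), Cmod (v - p) <= 3 * s -> Cmod (w - p) <= 3 * s -> 0 <= t <= 1 ->
    Cmod (v + t * (w - v) - p) <= 3 * s).
  { intros v w t Hv Hw Ht.
    eapply Rle_trans; [apply Cmod_split with (b := ((1 - t)%R * (v - p))%C) (c := (t * (w - p))%C);
      rewrite RtoC_minus; ring|].
    rewrite !Cmod_scal_pos by lra. nra. }
  assert (Nx : Cmod (x - p) <= 3 * s) by lra.
  assert (Ny : Cmod (y - p) <= 3 * s).
  { eapply Rle_trans; [apply Cmod_split with (b := (y - x)%C) (c := (x - p)%C); ring|]. lra. }
  assert (Nz : Cmod (z - p) <= 3 * s).
  { triangle (z - x)%C (x - p)%C.
    rewrite Cmod_sym in S3. lra. }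
  set (A := fun w : C => ((g p - l * p) + l * w)%C).
  assert (sc : forall x y, D x -> D y -> seg_cont g x y).
  { intros x' y' Dx' Dy' t Ht. apply Hc, (proj1 cc); auto. }
  assert (scA : forall x y, seg_cont A x y).
  { intros x' y' t _. unfold A. eapply cdiff_ccont. apply cdiff_plus; [apply cdiff_const|].
    apply (cdiff_mult (fun _ => l) (fun w => w)); [apply cdiff_const|apply cdiff_id]. }
  assert (B : forall v w, D v -> D w -> Cmod (v - p) <= 3 * s -> Cmod (w - p) <= 3 * s ->
    Cmod (w - v) <= s -> Cmod (seg g v w - seg A v w) <= k * (3 * s) * s).
  { intros v w Dv Dw Hv Hw Hvw.
    eapply Rle_trans; [apply seg_approx with (e := k * (3 * s)); auto|].
    - intros t Ht. unfold A. specialize (near v w t Hv Hw Ht).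
      specialize (Hr (v + t * (w - v))%C ltac:(lra)).
      eapply Rle_trans; [|eapply Rle_trans; [apply Hr|]].
      + right. f_equal. ring.
      + apply Rmult_le_compat_l; lra.
    - apply Rmult_le_compat_l; [nra|auto]. }
  assert (F : Cmod (tri g x y z) <= 9 * k * s * s).
  { replace (tri g x y z) with (tri g x y z - tri A x y z)%C
      by (unfold A; rewrite tri_affine; ring).
    unfold tri.
    triangle3 (seg g x y - seg A x y)%C (seg g y z - seg A y z)%C (seg g z x - seg A z x)%C.
    pose proof (B x y Dx Dy Nx Ny S1). pose proof (B y z Dy Dz Ny Nz S2).
    pose proof (B z x Dz Dx Nz Nx S3). lra. }
  fold I0.
  assert (p4 : 4 ^ N = 2 ^ N * 2 ^ N) by (rewrite <- Rpow_mult_distr; f_equal; lra).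
  assert (h2 : 0 < 2 ^ N) by (apply pow_lt; lra).
  assert (I0 / 4 ^ N <= 9 * k * s * s) by lra.
  apply Rle_trans with (9 * d * d * k).
  - apply Rmult_le_reg_r with (/ 4 ^ N); [apply Rinv_0_lt_compat, pow_lt; lra|].
    eapply Rle_trans; [apply H2|]. unfold s. rewrite p4. right. field. lra.
  - unfold k. apply mult_div_succ_le; nra.
Qed.

(** * The complex exponential *)

Definition cexp (z : C) : C := (exp (Re z) * cos (Im z), exp (Re z) * sin (Im z)).

Lemma cexp_plus (z w : C) : cexp (z + w) = (cexp z * cexp w)%C.
Proof.
  unfold cexp. rewrite re_plus, im_plus, exp_plus, cos_plus, sin_plus.
  unfold Cmult; simpl. f_equal; ring.
Qed.

Lemma Cmod_cexp (z : C) : Cmod (cexp z) = exp (Re z).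
Proof.
  unfold Cmod, cexp; simpl.
  replace (_ + _) with (exp (Re z) * exp (Re z) * (Rsqr (sin (Im z)) + Rsqr (cos (Im z))))
    by (unfold Rsqr; ring).
  rewrite sin2_cos2, Rmult_1_r. apply sqrt_square. left. apply exp_pos.
Qed.

Lemma cexp_0 : cexp 0 = 1%C.
Proof. unfold cexp, Re, Im; simpl. rewrite exp_0, cos_0, sin_0. unfold RtoC. f_equal; ring. Qed.

Lemma cexp_2PI (z : C) : cexp (z + 2 * PI * Ci) = cexp z.
Proof.
  rewrite cexp_plus. replace (cexp (2 * PI * Ci)) with (1 : C); [ring|].
  unfold cexp, Re, Im, Cmult, Ci, RtoC; simpl.
  replace ((2 * PI - 0 * 0) * 0 - (2 * 0 + 0 * PI) * 1) with 0 by ring.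
  replace ((2 * PI - 0 * 0) * 1 + (2 * 0 + 0 * PI) * 0) with (2 * PI) by ring.
  rewrite exp_0, cos_2PI, sin_2PI. f_equal; ring.
Qed.

Lemma derivable_at_0 (f : R -> R) (l : R) :
  derivable_pt_lim f 0 l -> forall e, 0 < e -> exists d, 0 < d /\
    forall x, Rabs x < d -> Rabs (f x - f 0 - l * x) <= e * Rabs x.
Proof.
  intros H e ep. destruct (H e ep) as [d Hd]. exists d. split; [apply cond_pos|].
  intros x Hx. destruct (Req_dec x 0) as [->|n].
  - replace (f 0 - f 0 - l * 0) with 0 by ring. rewrite Rabs_R0. lra.
  - specialize (Hd x n Hx). rewrite Rplus_0_l in Hd.
    replace (f x - f 0 - l * x) with (((f x - f 0) / x - l) * x) by (field; auto).
    rewrite Rabs_mult. apply Rmult_le_compat_r; [apply Rabs_pos|lra].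
Qed.

Lemma cdiff_cexp_0 : cdiff cexp 0 1.
Proof.
  intros e ep.
  assert (e8 : 0 < Rmin 1 (e / 8)) by (apply Rmin_glb_lt; lra).
  set (k := Rmin 1 (e / 8)) in *.
  assert (k1 : k <= 1) by min_le. assert (k2 : k <= e / 8) by min_le.
  pose proof (derivable_pt_lim_exp 0) as Hexp. rewrite exp_0 in Hexp.
  pose proof (derivable_pt_lim_cos 0) as Hcos. rewrite sin_0, Ropp_0 in Hcos.
  pose proof (derivable_pt_lim_sin 0) as Hsin. rewrite cos_0 in Hsin.
  destruct (derivable_at_0 _ _ Hexp k e8) as (d1 & p1 & H1).
  destruct (derivable_at_0 _ _ Hcos k e8) as (d2 & p2 & H2).
  destruct (derivable_at_0 _ _ Hsin k e8) as (d3 & p3 & H3).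
  exists (Rmin (Rmin d1 (k / 2)) (Rmin d2 d3)). split; [repeat apply Rmin_glb_lt; lra|].
  intros w Hw. replace (w - 0)%C with w in * by ring.
  set (x := Re w). set (y := Im w).
  assert (hx : Rabs x <= Cmod w) by apply re_le_Cmod.
  assert (hy : Rabs y <= Cmod w) by apply im_le_Cmod.
  pose proof (Rmin_l (Rmin d1 (k / 2)) (Rmin d2 d3)). pose proof (Rmin_r (Rmin d1 (k / 2)) (Rmin d2 d3)).
  pose proof (Rmin_l d1 (k / 2)). pose proof (Rmin_r d1 (k / 2)).
  pose proof (Rmin_l d2 d3). pose proof (Rmin_r d2 d3).
  specialize (H1 x ltac:(lra)). specialize (H2 y ltac:(lra)). specialize (H3 y ltac:(lra)).
  rewrite exp_0 in H1. rewrite cos_0 in H2. rewrite sin_0 in H3.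
  assert (hx0 := Rabs_pos x). assert (hy0 := Rabs_pos y). assert (hw0 := Cmod_ge_0 w).
  assert (Hw' : Cmod w < k / 2) by lra.
  assert (Eb : Rabs (exp x - 1) <= k).
  { replace (exp x - 1) with ((exp x - 1 - 1 * x) + x) by ring.
    eapply Rle_trans; [apply Rabs_triang|]. nra. }
  assert (E2 : 0 <= exp x <= 2).
  { split; [left; apply exp_pos|]. apply Rabs_le_between in Eb. lra. }
  eapply Rle_trans; [apply Cmod_le_Re_Im|].
  rewrite cexp_0. replace (Re (cexp w - 1 - 1 * w)) with (exp x * (cos y - 1 - 0 * y) + (exp x - 1 - 1 * x)).
  2: { unfold cexp, x, y, Re, Im, Cminus, Cplus, Copp, Cmult, RtoC; simpl. ring. }
  replace (Im (cexp w - 1 - 1 * w)) with (exp x * (sin y - 0 - 1 * y) + (exp x - 1) * y).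
  2: { unfold cexp, x, y, Re, Im, Cminus, Cplus, Copp, Cmult, RtoC; simpl. ring. }
  assert (A1 : Rabs (exp x * (cos y - 1 - 0 * y)) <= 2 * (k * Rabs y)).
  { rewrite Rabs_mult, (Rabs_pos_eq (exp x)) by lra. apply Rmult_le_compat; try lra. apply Rabs_pos. }
  assert (A2 : Rabs (exp x * (sin y - 0 - 1 * y)) <= 2 * (k * Rabs y)).
  { rewrite Rabs_mult, (Rabs_pos_eq (exp x)) by lra. apply Rmult_le_compat; try lra. apply Rabs_pos. }
  assert (A3 : Rabs ((exp x - 1) * y) <= k * Rabs y).
  { rewrite Rabs_mult. apply Rmult_le_compat_r; lra. }
  pose proof (Rabs_triang (exp x * (cos y - 1 - 0 * y)) (exp x - 1 - 1 * x)).
  pose proof (Rabs_triang (exp x * (sin y - 0 - 1 * y)) ((exp x - 1) * y)).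
  nra.
Qed.

Lemma cdiff_cexp (z : C) : cdiff cexp z (cexp z).
Proof.
  assert (A : cdiff (fun w => w - z)%C z 1).
  { replace (RtoC 1) with (1 + 0)%C by ring.
    apply cdiff_plus; [apply cdiff_id|apply cdiff_const]. }
  assert (B : cdiff cexp (z - z)%C 1).
  { replace (z - z)%C with (RtoC 0) by ring. apply cdiff_cexp_0. }
  assert (D := cdiff_mult _ _ _ _ _ (cdiff_const (cexp z) z) (cdiff_comp _ _ _ _ _ A B)).
  cbv beta in D. replace (cexp z) with (0 * cexp (z - z) + cexp z * (1 * 1))%C by ring.
  apply cdiff_ext_loc with (f := fun w => (cexp z * cexp (w - z))%C) (e := 1); [lra| |exact D].
  intros w _. rewrite <- cexp_plus. f_equal. ring.
Qed.

(** [acos] fixes the angle up to its sign, which is the sign of [y]. *)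
Lemma polar_unit (u : C) :
  Cmod u = 1 -> exists th : R, - PI <= th <= PI /\ u = cexp (th * Ci).
Proof.
  intros H. destruct u as [x y].
  assert (E : x * x + y * y = 1).
  { unfold Cmod in H. simpl in H. apply (f_equal (fun t => t * t)) in H.
    rewrite sqrt_sqrt in H by nra. lra. }
  assert (hx : -1 <= x <= 1) by nra.
  pose proof (acos_bound x) as hb.
  assert (S : sin (acos x) = Rabs y).
  { rewrite sin_acos by auto. rewrite <- sqrt_Rsqr_abs. f_equal. unfold Rsqr. lra. }
  assert (form : forall th : R, cexp (th * Ci) = (cos th, sin th)).
  { intros th. unfold cexp, Re, Im, Cmult, Ci, RtoC; simpl.
    replace (th * 0 - 0 * 1) with 0 by ring. replace (th * 1 + 0 * 0) with th by ring.
    rewrite exp_0. f_equal; ring. }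
  destruct (Rle_dec 0 y) as [hy|hy].
  - exists (acos x). split; [lra|]. rewrite form, cos_acos, S, Rabs_pos_eq by auto. reflexivity.
  - exists (- acos x). split; [lra|].
    rewrite form, cos_neg, sin_neg, cos_acos, S, Rabs_left by lra. f_equal. ring.
Qed.

(** * Maximum principle and open mapping *)

Lemma convex_half_plane (x : R) : convex_closed (fun z => Re z <= x).
Proof.
  split.
  - intros a b Ha Hb t Ht. rewrite re_plus, re_scal_l, re_minus. nra.
  - intros z Hz. apply le_epsilon. intros e ep. destruct (Hz e ep) as (w & Hw & Hd).
    pose proof (re_le_Cmod (w - z)) as h. rewrite re_minus in h. apply Rabs_le_between in h. lra.
Qed.

(* In the coordinate [w = x + cexp z] a circle centred at [x] is a vertical segment of length
   [2 PI], and Goursat on a rectangle of the half-plane [Re z <= ln r] gives the mean value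
   property: the two horizontal sides cancel by periodicity. *)
Lemma max_principle (h : C -> C) (x : C) (r M : R) :
  0 < r -> (forall w, Cmod (w - x) <= r -> exists l, cdiff h w l) ->
  (forall w, Cmod (w - x) = r -> Cmod (h w) <= M) -> Cmod (h x) <= M.
Proof.
  intros rp Hh HM.
  set (k := fun z => h (x + cexp z)%C). set (P := (2 * PI * Ci)%C).
  set (D := fun z => Re z <= ln r).
  assert (Hk : forall z, D z -> exists l, cdiff k z l).
  { intros z Hz. destruct (Hh (x + cexp z)%C) as [l Hl].
    - replace (x + cexp z - x)%C with (cexp z) by ring. rewrite Cmod_cexp.
      rewrite <- (exp_ln r rp). destruct Hz as [Hz|Hz].
      + left. now apply exp_increasing.
      + right. now rewrite Hz.
    - eexists. apply (cdiff_comp h (fun z => x + cexp z)%C); [|exact Hl].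
      apply cdiff_plus; [apply cdiff_const|apply cdiff_cexp]. }
  assert (cc : convex_closed D) by apply convex_half_plane.
  assert (Hc : forall w, D w -> ccont (fun _ => True) k w).
  { intros w Dw. destruct (Hk w Dw) as [l Hl]. now apply cdiff_ccont with l. }
  assert (sc : forall x y, D x -> D y -> seg_cont k x y).
  { intros x' y' Dx' Dy' t Ht. apply Hc, (proj1 cc); auto. }
  assert (ReP : forall z, Re (z + P) = Re z).
  { intros z. unfold P, Re, Cplus, Cmult, Ci, RtoC; simpl. ring. }
  assert (per : forall z, k (z + P)%C = k z) by (intros z; unfold k, P; now rewrite cexp_2PI).
  assert (CP : Cmod P = 2 * PI).
  { unfold P. rewrite !Cmod_mult, !Cmod_R, Cmod_Ci, !Rabs_pos_eq; pose proof PI_RGT_0; lra. }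
  set (L := RtoC (ln r)).
  assert (DL : D L) by (unfold D, L; rewrite re_RtoC; lra).
  assert (shift : forall xi : R, xi <= ln r -> seg k L (L + P) = seg k xi (xi + P)).
  { intros xi Hxi.
    assert (Dx : D xi) by (unfold D; rewrite re_RtoC; auto).
    assert (DxP : D (xi + P)%C) by (unfold D; rewrite ReP; auto).
    assert (DLP : D (L + P)%C) by (unfold D; rewrite ReP; auto).
    (* The rectangle is cut along the diagonal from [xi] to [L + P], and Goursat is applied to both
       triangles. *)
    pose proof (goursat D k xi L (L + P)%C cc Hk Dx DL DLP) as G1.
    pose proof (goursat D k xi (L + P)%C (xi + P)%C cc Hk Dx DLP DxP) as G2.
    unfold tri in G1, G2.
    rewrite (seg_rev k xi (L + P)%C) in G1 by auto.
    rewrite (seg_rev k (xi + P)%C (L + P)%C) in G2 by auto.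
    rewrite (seg_rev k xi (xi + P)%C) in G2 by auto.
    assert (E : seg k (xi + P) (L + P) = seg k xi L).
    { unfold seg. apply (RInt_ext (V := C_R_CompleteNormedModule)). intros t _. eqC.
      replace (L + P - (xi + P))%C with (L - xi)%C by ring.
      replace (xi + P + t * (L - xi))%C with (xi + t * (L - xi) + P)%C by ring.
      now rewrite per. }
    rewrite E in G2. apply Ceq_minus.
    match type of G1 with ?u = _ => match type of G2 with ?v = _ =>
      replace (seg k L (L + P) - seg k xi (xi + P))%C with (u + v)%C by ring end end.
    rewrite G1, G2. ring. }
  assert (B1 : Cmod (seg k L (L + P)) <= M * (2 * PI)).
  { replace (seg k L (L + P)) with (seg k L (L + P) - 0 * (L + P - L))%C by ring.
    rewrite <- CP. replace P with (L + P - L)%C at 3 by ring.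
    apply seg_approx_const.
    - apply sc; auto. unfold D. now rewrite ReP.
    - intros t Ht. replace (k (L + t * (L + P - L)) - 0)%C with (k (L + t * P)%C)
        by (replace (L + P - L)%C with P by ring; ring).
      apply HM. replace (x + cexp (L + t * P) - x)%C with (cexp (L + t * P)) by ring.
      rewrite Cmod_cexp. replace (Re (L + t * P)) with (ln r); [now apply exp_ln|].
      unfold L, P, Re, Cplus, Cmult, Ci, RtoC; simpl. ring. }
  pose proof PI_RGT_0 as PIp.
  apply le_epsilon. intros e ep.
  destruct (Hh x) as [l Hl].
  { replace (x - x)%C with (0 : C) by ring. rewrite Cmod_0. lra. }
  destruct (cdiff_ccont _ _ _ (fun _ => True) Hl e ep) as (d & dp & Hd).
  (* Radius of a circle on which [h] is within [e] of [h x]. Keeping it at most [r] places the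
     corresponding vertical segment in [D]. *)
  set (m := Rmin (d / 2) r).
  assert (mp : 0 < m) by (apply Rmin_glb_lt; lra).
  assert (m1 : m <= d / 2) by min_le. assert (m2 : m <= r) by min_le.
  set (xi := ln m).
  assert (hxi : xi <= ln r).
  { unfold xi. destruct m2 as [h'|h']; [left; now apply ln_increasing|right; now rewrite h']. }
  assert (B2 : Cmod (seg k xi (xi + P) - h x * (xi + P - xi)) <= e * Cmod (xi + P - xi)).
  { apply seg_approx_const.
    - apply sc; unfold D; [|rewrite ReP]; rewrite re_RtoC; auto.
    - intros t Ht. left. apply Hd; auto.
      replace (x + cexp (xi + t * (xi + P - xi)) - x)%C with (cexp (xi + t * (xi + P - xi))) by ring.
      rewrite Cmod_cexp. replace (Re (xi + t * (xi + P - xi))) with xi.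
      + unfold xi. rewrite exp_ln by auto. lra.
      + unfold P, Re, Cplus, Cminus, Copp, Cmult, Ci, RtoC; simpl. ring. }
  rewrite <- (shift xi hxi) in B2. replace (xi + P - xi)%C with P in B2 by ring.
  rewrite CP in B2.
  assert (B3 : Cmod (h x * P) <= M * (2 * PI) + e * (2 * PI)).
  { triangle (seg k L (L + P)) (- (seg k L (L + P) - h x * P))%C.
    rewrite Cmod_opp. lra. }
  rewrite Cmod_mult, CP in B3. apply Rmult_le_reg_r with (2 * PI); lra.
Qed.

Lemma pcont_comp (E : R -> Prop) (D : C -> Prop) (f : C -> C) (p : R -> C) (t : R) :
  pcont E p t -> ccont D f (p t) -> (forall s, E s -> D (p s)) -> pcont E (fun s => f (p s)) t.
Proof.
  intros H1 H2 HE e ep. destruct (H2 e ep) as (d & dp & Hd).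
  destruct (H1 d dp) as (d' & dp' & Hd'). exists d'. split; auto.
Qed.

(** Compactness: each parameter has a neighbourhood on which half of the distance at that parameter
    is a lower bound. *)
Lemma path_distance (p : R -> C) (c : C) (x y : R) :
  x <= y -> (forall t, x <= t <= y -> pcont (fun s => x <= s <= y) p t) ->
  (forall t, x <= t <= y -> p t <> c) ->
  exists d, 0 < d /\ forall t, x <= t <= y -> d <= Cmod (p t - c).
Proof.
  intros xy Hc Hn.
  apply (compact_interval (fun d t => d <= Cmod (p t - c))); auto.
  - intros d d' s [_ H] H'. lra.
  - intros t Ht.
    assert (m : 0 < Cmod (p t - c)).
    { apply Cmod_gt_0. intros h. apply Ceq_minus in h. now apply (Hn t). }
    destruct (Hc t Ht (Cmod (p t - c) / 2)) as (d & dp & Hd); [lra|].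
    exists d, (Cmod (p t - c) / 2). repeat split; auto; [lra|].
    intros s Hs Hst. specialize (Hd s Hs Hst).
    assert (Cmod (p t - c) <= Cmod (p t - p s) + Cmod (p s - c)) by (apply Cmod_split; ring).
    rewrite (Cmod_sym (p t) (p s)) in H. lra.
Qed.

Lemma pcont_circle (c : C) (r t : R) (E : R -> Prop) :
  pcont E (fun th : R => c + r * cexp (th * Ci))%C t.
Proof.
  assert (H : pdiff (fun th : R => 0 + th * Ci)%C t Ci) by apply pdiff_linear.
  assert (K : cdiff (fun w => c + r * cexp w)%C (0 + t * Ci)%C
    (0 + (0 * cexp (0 + t * Ci) + r * cexp (0 + t * Ci)))%C).
  { apply cdiff_plus; [apply cdiff_const|].
    apply (cdiff_mult (fun _ => RtoC r) cexp); [apply cdiff_const|apply cdiff_cexp]. }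
  apply pdiff_comp with (1 := H) in K.
  apply pdiff_pcont with (E := E) in K. intros e ep.
  destruct (K e ep) as (d & dp & Hd). exists d. split; auto. intros s Es Hs.
  specialize (Hd s Es Hs). rewrite !Cplus_0_l in Hd. exact Hd.
Qed.

Lemma Cmod_circle (c : C) (r th : R) : 0 <= r -> Cmod (c + r * cexp (th * Ci) - c) = r.
Proof.
  intros h. replace (c + r * cexp (th * Ci) - c)%C with (r * cexp (th * Ci))%C by ring.
  rewrite Cmod_scal_pos, Cmod_cexp by auto.
  replace (Re (th * Ci)) with 0; [rewrite exp_0; ring|].
  unfold Re, Cmult, Ci, RtoC; simpl. ring.
Qed.

Lemma circle_point (c w : C) (r : R) :
  0 < r -> Cmod (w - c) = r -> exists th : R, - PI <= th <= PI /\ w = (c + r * cexp (th * Ci))%C.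
Proof.
  intros rp H.
  assert (rn : RtoC r <> 0%C) by (apply RtoC_neq_0; lra).
  destruct (polar_unit ((w - c) / r)%C) as (th & Hth & E).
  - rewrite Cmod_div, H, Cmod_R, Rabs_pos_eq by (auto; lra). field. lra.
  - exists th. split; auto. rewrite <- E. field. auto.
Qed.

(* If [u] close to [f x] were omitted, [1 / (f - u)] would violate the maximum principle. *)
Lemma open_mapping (f : C -> C) (x : C) (r : R) :
  0 < r -> (forall w, Cmod (w - x) <= r -> exists l, cdiff f w l) ->
  (forall w, Cmod (w - x) = r -> f w <> f x) ->
  exists d, 0 < d /\ forall u, Cmod (u - f x) < d -> exists w, Cmod (w - x) <= r /\ f w = u.
Proof.
  intros rp Hf Hn. pose proof PI_RGT_0 as PIp.
  destruct (path_distance (fun th : R => f (x + r * cexp (th * Ci))%C) (f x) (- PI) PI)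
    as (m & mp & Hm).
  - lra.
  - intros t Ht. apply pcont_comp with (fun _ => True).
    + apply pcont_circle.
    + destruct (Hf (x + r * cexp (t * Ci))%C) as [l Hl].
      { rewrite Cmod_circle; lra. }
      now apply cdiff_ccont with l.
    + auto.
  - intros t _. apply Hn. apply Cmod_circle. lra.
  (* On the circle [f] is at distance at least [m] from [f x], hence more than [m / 2] from [u],
     while at the centre [f x] is within [m / 4] of [u]. The reciprocal of [f - u] would then be
     larger at the centre than anywhere on the circle. *)
  - exists (m / 4). split; [lra|]. intros u Hu. apply NNPP. intros N.
    assert (N' : forall w, Cmod (w - x) <= r -> (f w - u)%C <> 0%C).
    { intros w Hw h. apply N. exists w. split; auto. now apply Ceq_minus. }
    assert (K : Cmod (/ (f x - u)) <= / (m / 2)).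
    { apply (max_principle (fun w => / (f w - u))%C x r); auto.
      - intros w Hw. destruct (Hf w Hw) as [l Hl].
        apply cdiff_inv_fun with (f := fun w => (f w - u)%C) (l := (l + 0)%C); auto.
        apply cdiff_plus; auto. apply cdiff_const.
      - intros w Hw. rewrite Cmod_inv by (apply N'; lra).
        apply Rinv_le_contravar; [lra|].
        destruct (circle_point x w r rp Hw) as (th & Hth & ->).
        specialize (Hm th Hth).
        assert (Cmod (f (x + r * cexp (th * Ci))%C - f x) <=
          Cmod (f (x + r * cexp (th * Ci))%C - u) + Cmod (u - f x)) by (apply Cmod_split; ring).
        lra. }
    assert (x0 : (f x - u)%C <> 0%C).
    { apply N'. replace (x - x)%C with (0 : C) by ring. rewrite Cmod_0. lra. }
    rewrite Cmod_inv in K by auto.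
    apply Cmod_gt_0 in x0. rewrite Cmod_sym in Hu.
    assert (/ (m / 2) < / Cmod (f x - u)); [|lra].
    apply Rinv_lt_contravar; nra.
Qed.

(** * Primitives on a conformal image of the disk *)

Definition Copen (U : C -> Prop) : Prop :=
  forall z, U z -> exists r, 0 < r /\ forall w, Cmod (w - z) < r -> U w.

Definition holomorphic_on (U : C -> Prop) (g : C -> C) : Prop :=
  forall z, U z -> exists l, cdiff g z l.

Definition disk_bijection (Om : C -> Prop) (f : C -> C) : Prop :=
  holomorphic_on Om f /\ (forall z, Om z -> Cmod (f z) < 1) /\
  (forall z w, Om z -> Om w -> f z = f w -> z = w) /\
  (forall u, Cmod u < 1 -> exists z, Om z /\ f z = u).

(** Injectivity keeps [f] away from [f x] on a circle about [x], as the open mapping argument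
    requires. That the preimage is found within [e] of [x] is the continuity of the inverse. *)
Lemma disk_bijection_open (Om : C -> Prop) (f : C -> C) (x : C) (e : R) :
  Copen Om -> disk_bijection Om f -> Om x -> 0 < e ->
  exists d, 0 < d /\ forall u, Cmod (u - f x) < d -> exists w, Om w /\ Cmod (w - x) < e /\ f w = u.
Proof.
  intros Ho (Hh & _ & Hi & _) Ox ep.
  destruct (Ho x Ox) as (r & rp & Hr).
  set (s := Rmin r e / 2).
  assert (s0 : 0 < Rmin r e) by (apply Rmin_glb_lt; auto).
  assert (s1 : 0 < s < r /\ s < e).
  { pose proof (Rmin_l r e). pose proof (Rmin_r r e). unfold s. lra. }
  destruct (open_mapping f x s) as (d & dp & Hd); [lra| | |].
  - intros w Hw. apply Hh, Hr. lra.
  - intros w Hw h. apply Hi in h; auto; [|apply Hr; lra]. subst w.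
    replace (x - x)%C with (0 : C) in Hw by ring. rewrite Cmod_0 in Hw. lra.
  - exists d. split; auto. intros u Hu. destruct (Hd u Hu) as (w & Hw & E).
    exists w. split; [apply Hr; lra|]. split; auto. lra.
Qed.

Lemma disk_bijection_inverse (Om : C -> Prop) (f : C -> C) :
  Copen Om -> disk_bijection Om f ->
  exists phi : C -> C,
    (forall z, Om z -> phi (f z) = z) /\
    forall u, Cmod u < 1 -> Om (phi u) /\
      forall e, 0 < e -> exists d, 0 < d /\ forall u', Cmod (u' - u) < d -> Cmod (phi u' - phi u) < e.
Proof.
  intros Ho Hf. assert (Hf' := Hf). destruct Hf' as (_ & Hb & Hi & Hs).
  set (phi := fun u => epsilon (inhabits u) (fun z => Om z /\ f z = u)).
  assert (Hphi : forall u, Cmod u < 1 -> Om (phi u) /\ f (phi u) = u).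
  { intros u Hu. unfold phi. apply epsilon_spec. auto. }
  assert (Hinv : forall z, Om z -> phi (f z) = z).
  { intros z Oz. destruct (Hphi (f z)) as [H1 H2]; auto. }
  exists phi. split; auto. intros u Hu. destruct (Hphi u Hu) as [Ou Eu]. split; auto.
  intros e ep. destruct (disk_bijection_open Om f (phi u) e Ho Hf Ou ep) as (d & dp & Hd).
  exists d. split; auto. intros u' Hu'. rewrite Eu in Hd.
  destruct (Hd u' Hu') as (w & Ow & Hw & <-). rewrite Hinv; auto.
Qed.

Lemma convex_disk (c : C) (r : R) : convex_closed (fun w => Cmod (w - c) <= r).
Proof.
  split.
  - intros a b Ha Hb t Ht.
    eapply Rle_trans; [apply Cmod_split with (b := ((1 - t)%R * (a - c))%C) (c := (t * (b - c))%C);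
      rewrite RtoC_minus; ring|].
    rewrite !Cmod_scal_pos by lra. nra.
  - intros z Hz. apply le_epsilon. intros e ep. destruct (Hz e ep) as (w & Hw & Hd).
    eapply Rle_trans; [apply Cmod_split with (b := (w - c)%C) (c := (z - w)%C); ring|].
    rewrite (Cmod_sym z). lra.
Qed.

Fixpoint csum (F : nat -> C) (n : nat) : C :=
  match n with O => 0%C | S n => (csum F n + F n)%C end.

Lemma csum_ext (F G : nat -> C) (n : nat) :
  (forall i, (i < n)%nat -> F i = G i) -> csum F n = csum G n.
Proof.
  induction n as [|n IH]; simpl; intros H; auto. rewrite IH, H; auto.
Qed.

Lemma csum_add (F : nat -> C) (n m : nat) :
  csum F (n + m) = (csum F n + csum (fun i => F (n + i)%nat) m)%C.
Proof.
  induction m as [|m IH]; simpl.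
  - rewrite Nat.add_0_r. ring.
  - rewrite Nat.add_succ_r. simpl. rewrite IH. ring.
Qed.

Lemma csum_mul (F : nat -> C) (n k : nat) :
  csum F (n * k) = csum (fun j => csum (fun i => F (j * k + i)%nat) k) n.
Proof.
  induction n as [|n IH]; simpl; auto.
  rewrite Nat.add_comm, csum_add, IH. reflexivity.
Qed.

Lemma convex_seg_cont (D : C -> Prop) (g : C -> C) (a b : C) :
  convex_closed D -> holomorphic_on D g -> D a -> D b -> seg_cont g a b.
Proof.
  intros cc Hg Da Db t Ht. destruct (Hg (a + t * (b - a))%C) as [l Hl].
  - apply (proj1 cc); auto.
  - now apply cdiff_ccont with l.
Qed.

Lemma seg_self (D : C -> Prop) (g : C -> C) (a : C) :
  convex_closed D -> holomorphic_on D g -> D a -> seg g a a = 0%C.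
Proof.
  intros cc Hg Da. apply Cmod_0_eq. intros e ep.
  replace (seg g a a) with (seg g a a - g a * (a - a))%C by ring.
  eapply Rle_trans; [apply seg_approx_const with (e := 0)|].
  - now apply (convex_seg_cont D).
  - intros t _. replace (a + t * (a - a))%C with a by ring.
    replace (g a - g a)%C with (0 : C) by ring. rewrite Cmod_0. lra.
  - lra.
Qed.

Lemma seg_add (D : C -> Prop) (g : C -> C) (a b c : C) :
  convex_closed D -> holomorphic_on D g -> D a -> D b -> D c -> (seg g a b + seg g b c)%C = seg g a c.
Proof.
  intros cc Hg Da Db Dc. pose proof (goursat D g a b c cc Hg Da Db Dc) as G. unfold tri in G.
  rewrite (seg_rev g a c) in G by now apply (convex_seg_cont D).
  apply Ceq_minus. rewrite <- G. ring.
Qed.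

Lemma seg_chain (D : C -> Prop) (g : C -> C) (b : nat -> C) (k : nat) :
  convex_closed D -> holomorphic_on D g -> 
  (forall i, (i <= k)%nat -> D (b i)) ->
  csum (fun i => seg g (b i) (b (S i))) k = seg g (b 0%nat) (b k).
Proof.
  intros cc Hg. induction k as [|k IH]; intros H; simpl.
  - symmetry. apply (seg_self D); auto.
  - rewrite IH by auto. apply (seg_add D); auto. apply H. lia.
Qed.

(** Two polygons joined by rungs: each cell lies in a convex set on which [g] is holomorphic, so
    both ways round it agree, and the intermediate rungs cancel. *)
Lemma seg_ladder (g : C -> C) (a b : nat -> C) (n : nat) :
  (forall j, (j < n)%nat -> exists D, convex_closed D /\ holomorphic_on D g /\
     D (a j) /\ D (a (S j)) /\ D (b j) /\ D (b (S j))) ->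
  (csum (fun j => seg g (a j) (a (S j))) n + seg g (a n) (b n) =
   seg g (a 0%nat) (b 0%nat) + csum (fun j => seg g (b j) (b (S j))) n)%C.
Proof.
  induction n as [|n IH]; intros H; simpl; [ring|].
  destruct (H n) as (D & cc & Hg & D1 & D2 & D3 & D4); [lia|].
  assert (Q : (seg g (a n) (a (S n)) + seg g (a (S n)) (b (S n)) =
               seg g (a n) (b n) + seg g (b n) (b (S n)))%C).
  { rewrite !(seg_add D) by auto. reflexivity. }
  rewrite <- Cplus_assoc, Q, Cplus_assoc, IH by auto. ring.
Qed.

(* The primitive at [y] is the integral of [g] along a polygon inscribed in the path
   [phi (s f(y))], [0 <= s <= 1]: it does not depend on the polygon once this is fine enough,
   and moving [y] changes it by [seg g y y']. *)
Lemma holomorphic_primitive (Om : C -> Prop) (f g : C -> C) :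
  Copen Om -> disk_bijection Om f -> holomorphic_on Om g ->
  exists G, forall z, Om z -> cdiff G z (g z).
Proof.
  intros Ho Hf Hg.
  destruct (disk_bijection_inverse Om f Ho Hf) as (phi & Hinv & Hphi).
  destruct Hf as (Hh & Hb & Hi & Hs).
  set (pt := fun (n : nat) (u : C) (j : nat) => phi ((INR j / INR n)%R * u)%C).
  set (Sm := fun n u => csum (fun j => seg g (pt n u j) (pt n u (S j))) n).
  (* A radius that is uniform along the segment from 0 to [u0]: the disk of this radius about any
     [s * u0] is mapped by [phi] into a convex set on which [g] is holomorphic. *)
  assert (good : forall u0, Cmod u0 < 1 -> exists d, 0 < d /\ forall s, 0 <= s <= 1 ->
    exists D, convex_closed D /\ holomorphic_on D g /\
      forall u, Cmod (u - s * u0) < d -> D (phi u)).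
  { intros u0 Hu0.
    apply (compact_interval (fun d s => exists D, convex_closed D /\ holomorphic_on D g /\
      forall u, Cmod (u - s * u0) < d -> D (phi u))); [lra| |].
    - intros d d' s Hd (D & H1 & H2 & H3). exists D. split; auto. split; auto.
      intros u Hu. apply H3. lra.
    - intros t Ht.
      assert (Hu : Cmod (t * u0) < 1).
      { rewrite Cmod_scal_pos by lra. pose proof (Cmod_ge_0 u0). nra. }
      destruct (Hphi _ Hu) as [Ou Hcont].
      destruct (Ho _ Ou) as (r & rp & Hr).
      destruct (Hcont (r / 2)) as (d & dp & Hd); [lra|].
      exists (d / 2), (d / 2). split; [lra|]. split; [lra|]. intros s Hs' Hst.
      exists (fun w => Cmod (w - phi (t * u0)%C) <= r / 2). split; [apply convex_disk|]. split.
      + intros w Hw. apply Hg, Hr. lra.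
      + intros u Hu'. left. apply Hd.
        eapply Rle_lt_trans; [apply Cmod_split with (b := (u - s * u0)%C) (c := ((s - t)%R * u0)%C);
          rewrite RtoC_minus; ring|].
        rewrite Cmod_scal. pose proof (Rabs_pos (s - t)). pose proof (Cmod_ge_0 u0). nra. }
  assert (ratio : forall j n, (j <= n)%nat -> (0 < n)%nat -> 0 <= INR j / INR n <= 1).
  { intros j n Hj Hn. apply le_INR in Hj. apply lt_INR in Hn. simpl in Hn.
    pose proof (pos_INR j). split.
    - apply Rdiv_le_0_compat; lra.
    - apply Rmult_le_reg_r with (INR n); [lra|]. field_simplify; lra. }
  assert (fine : forall d, 0 < d -> exists N, (0 < N)%nat /\ forall n, (N <= n)%nat -> 1 / INR n < d).
  { intros d dp. destruct (archimed_cor1 d dp) as (N & HN & Np). exists N. split; auto.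
    intros n Hn. apply Rle_lt_trans with (/ INR N); auto.
    unfold Rdiv. rewrite Rmult_1_l. apply Rinv_le_contravar; [apply lt_0_INR; lia|now apply le_INR]. }
  (* Each side of a fine polygon and its [k] subdivisions lie in one such convex set, so refinement
     leaves the sum unchanged. Two fine polygons are compared through their common refinement with
     [n * N] sides. *)
  assert (stable : forall u, Cmod u < 1 -> exists N l, forall n, (N <= n)%nat -> Sm n u = l).
  { intros u Hu. destruct (good u Hu) as (d & dp & Hd).
    destruct (fine d dp) as (N & Np & HN).
    assert (refine : forall n k, (N <= n)%nat -> (0 < k)%nat -> Sm (n * k)%nat u = Sm n u).
    { intros n k Hn Hk. unfold Sm. rewrite csum_mul. apply csum_ext. intros j Hj.
      destruct (Hd (INR j / INR n)) as (D & cc & HgD & HD); [apply ratio; lia|].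
      assert (n0 : 0 < INR n) by (apply lt_0_INR; lia).
      assert (k0 : 0 < INR k) by (apply lt_0_INR; lia).
      assert (sub : forall i, (i <= k)%nat ->
        INR (j * k + i) / INR (n * k) - INR j / INR n = INR i / INR k * (1 / INR n)).
      { intros i _. rewrite plus_INR, !mult_INR. field. lra. }
      assert (E : csum (fun i => seg g (pt (n * k)%nat u (j * k + i)%nat)
          (pt (n * k)%nat u (j * k + S i)%nat)) k =
        seg g (pt (n * k)%nat u (j * k + 0)%nat) (pt (n * k)%nat u (j * k + k)%nat)).
      { apply (seg_chain D g (fun i => pt (n * k)%nat u (j * k + i)%nat) k cc HgD).
        intros i Hik. apply HD.
        replace ((INR (j * k + i) / INR (n * k))%R * u - (INR j / INR n)%R * u)%C
          with ((INR i / INR k * (1 / INR n))%R * u)%C.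
        - rewrite Cmod_scal. specialize (HN n Hn). destruct (ratio i k Hik Hk).
          assert (0 <= 1 / INR n) by (apply Rdiv_le_0_compat; lra).
          rewrite Rabs_pos_eq by (apply Rmult_le_pos; auto).
          pose proof (Cmod_ge_0 u).
          assert (INR i / INR k * (1 / INR n) <= 1 / INR n) by nra. nra.
        - rewrite <- (sub i Hik), RtoC_minus. ring. }
      rewrite (csum_ext _ (fun i => seg g (pt (n * k)%nat u (j * k + i)%nat)
          (pt (n * k)%nat u (j * k + S i)%nat))).
      - rewrite E. unfold pt. f_equal; f_equal; f_equal; f_equal.
        + pose proof (sub 0%nat ltac:(lia)) as s0. simpl (INR 0) in s0.
          unfold Rdiv in s0 at 3. rewrite Rmult_0_l, Rmult_0_l in s0. lra.
        + pose proof (sub k (le_n _)) as s0. rewrite S_INR.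
          replace (INR k / INR k) with 1 in s0 by (field; lra).
          replace ((INR j + 1) / INR n) with (INR j / INR n + 1 / INR n) by (field; lra). lra.
      - intros i _. now rewrite Nat.add_succ_r. }
    exists N, (Sm N u). intros n Hn.
    rewrite <- (refine n N), <- (refine N n) by lia. f_equal. apply Nat.mul_comm. }
  set (G := fun y => epsilon (inhabits y) (fun l => exists N, forall n, (N <= n)%nat -> Sm n (f y) = l)).
  assert (HG : forall y, Om y -> exists N, forall n, (N <= n)%nat -> Sm n (f y) = G y).
  { intros y Oy. unfold G. apply epsilon_spec. destruct (stable (f y)) as (N & l & H); auto.
    exists l, N. auto. }
  exists G. intros y0 Oy0 e ep.
  destruct (good (f y0) (Hb y0 Oy0)) as (d & dp & Hd).
  destruct (Hg y0 Oy0) as [lg Hlg].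
  destruct (cdiff_ccont _ _ _ (fun _ => True) Hlg e ep) as (d1 & dp1 & Hd1).
  destruct (Ho y0 Oy0) as (r & rp & Hr).
  destruct (Hh y0 Oy0) as [lf Hlf].
  destruct (cdiff_ccont _ _ _ (fun _ => True) Hlf (d / 2)) as (d2 & dp2 & Hd2); [lra|].
  exists (Rmin d1 (Rmin r d2)). split; [repeat apply Rmin_glb_lt; auto|].
  intros y Hy.
  assert (K1 : Cmod (y - y0) < d1) by (eapply Rlt_le_trans; [apply Hy|apply Rmin_l]).
  assert (K2 : Cmod (y - y0) < r).
  { eapply Rlt_le_trans; [apply Hy|min_le]. }
  assert (K3 : Cmod (y - y0) < d2).
  { eapply Rlt_le_trans; [apply Hy|min_le]. }
  assert (Oy : Om y) by auto. specialize (Hd2 y I K3).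
  assert (E : (G y - G y0)%C = seg g y0 y).
  { destruct (HG y Oy) as [N1 HN1]. destruct (HG y0 Oy0) as [N2 HN2].
    destruct (fine (d / 2)) as (N & Np & HN); [lra|].
    set (n := (N + N1 + N2)%nat).
    rewrite <- (HN1 n), <- (HN2 n) by (unfold n; lia).
    assert (n0 : 0 < INR n) by (apply lt_0_INR; unfold n; lia).
    specialize (HN n ltac:(unfold n; lia)).
    (* Half of [d] pays for moving the endpoint from [f y0] to [u], the other half for passing from
       one vertex to the next; so the four vertices of a cell of the ladder share one convex set. *)
    assert (nearj : forall (s t : R) u, 0 <= s <= 1 -> 0 <= t <= 1 ->
      Cmod (u - f y0) < d / 2 -> Rabs (t - s) <= 1 / INR n ->
      Cmod (t * u - s * f y0) < d).
    { intros s t u Hs0 Ht Hu Hts.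
      eapply Rle_lt_trans; [apply Cmod_split with (b := (t * (u - f y0))%C)
        (c := ((t - s)%R * f y0)%C); rewrite RtoC_minus; ring|].
      rewrite (Cmod_scal_pos t), Cmod_scal by lra.
      pose proof (Hb y0 Oy0). pose proof (Cmod_ge_0 (f y0)). pose proof (Cmod_ge_0 (u - f y0)).
      pose proof (Rabs_pos (t - s)).
      assert (t * Cmod (u - f y0) <= Cmod (u - f y0)) by nra.
      assert (Rabs (t - s) * Cmod (f y0) <= Rabs (t - s)) by nra. lra. }
    assert (L : (Sm n (f y0) + seg g (pt n (f y0) n) (pt n (f y) n) =
       seg g (pt n (f y0) 0%nat) (pt n (f y) 0%nat) + Sm n (f y))%C).
    { apply seg_ladder. intros j Hj.
      assert (R1 : 0 <= INR j / INR n <= 1) by (apply ratio; lia).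
      assert (R2 : 0 <= INR (S j) / INR n <= 1) by (apply ratio; lia).
      destruct (Hd (INR j / INR n) R1) as (D & cc & HgD & HD).
      exists D. split; auto. split; auto.
      assert (z0 : Cmod (f y0 - f y0) < d / 2).
      { replace (f y0 - f y0)%C with (0 : C) by ring. rewrite Cmod_0. lra. }
      assert (p0 : 0 <= 1 / INR n) by (apply Rdiv_le_0_compat; lra).
      assert (D1 : Rabs (INR j / INR n - INR j / INR n) <= 1 / INR n).
      { rewrite Rminus_eq_0, Rabs_R0. auto. }
      assert (D2 : Rabs (INR (S j) / INR n - INR j / INR n) <= 1 / INR n).
      { rewrite S_INR. replace ((INR j + 1) / INR n - INR j / INR n) with (1 / INR n) by (field; lra).
        rewrite Rabs_pos_eq; lra. }
      repeat split; apply HD, nearj; auto. }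
    assert (P1 : forall y, Om y -> pt n (f y) n = y).
    { intros w Ow. unfold pt. replace (INR n / INR n) with 1 by (field; lra).
      rewrite Cmult_1_l. auto. }
    assert (P0 : forall u, pt n u 0%nat = phi 0%C).
    { intros u. unfold pt. simpl INR. unfold Rdiv. rewrite Rmult_0_l. f_equal. ring. }
    rewrite !P1, !P0 in L by auto.
    assert (Z : seg g (phi 0%C) (phi 0%C) = 0%C).
    { destruct (Hd 0) as (D & cc & HgD & HD); [lra|].
      apply (seg_self D g); auto. apply HD.
      replace (0 - 0 * f y0)%C with (0 : C) by ring. rewrite Cmod_0. auto. }
    rewrite Z in L.
    apply Ceq_minus. apply Ceq_minus in L.
    match type of L with ?u = _ =>
      replace (Sm n (f y) - Sm n (f y0) - seg g y0 y)%C with (- u)%C by ring end.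
    rewrite L. ring. }
  rewrite E.
  assert (inr : forall t : R, 0 <= t <= 1 -> Cmod (y0 + t * (y - y0) - y0) <= Cmod (y - y0)).
  { intros t Ht. replace (y0 + t * (y - y0) - y0)%C with (t * (y - y0))%C by ring.
    rewrite Cmod_scal_pos by lra. pose proof (Cmod_ge_0 (y - y0)). nra. }
  apply seg_approx_const.
  - intros t Ht. destruct (Hg (y0 + t * (y - y0))%C) as [l Hl].
    { apply Hr. specialize (inr t Ht). lra. }
    now apply cdiff_ccont with l.
  - intros t Ht. left. apply Hd1; auto. specialize (inr t Ht). lra.
Qed.

(** * Components *)

Lemma open_Copen (U : C -> Prop) : open (T := C_UniformSpace) U <-> Copen U.
Proof.
  split.
  - intros H z Uz. destruct (H z Uz) as [d Hd]. exists d. split; [apply cond_pos|].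
    intros w Hw. apply Hd. now apply ball_Cmod.
  - intros H z Uz. destruct (H z Uz) as (r & rp & Hr).
    destruct (Cmod_ball z z r rp) as [d Hd]. exists d. auto.
Qed.

(** Membership in either open set of a separating pair is locally constant along the path, so the
    whole path lies on the side of [p t0], a point that it shares with [D]. *)
Lemma connected_add_path (D : C -> Prop) (p : R -> C) (x y t0 : R) :
  connected_set D -> x <= t0 <= y ->
  (forall t, x <= t <= y -> pcont (fun s => x <= s <= y) p t) -> D (p t0) ->
  connected_set (fun z => D z \/ exists t, x <= t <= y /\ z = p t).
Proof.
  intros HD Ht0 Hp D0 (U & V & oU & oV & Hcov & (u & Hu & Uu) & (v & Hv & Vv) & Hdis).
  set (D' := fun z => D z \/ exists t, x <= t <= y /\ z = p t) in *.
  assert (main : forall U V, open U -> open V -> (forall z, D' z -> U z \/ V z) ->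
    (forall z, D' z -> U z -> V z -> False) -> U (p t0) -> (exists v, D' v /\ V v) -> False).
  { clear u v Hu Uu Hv Vv Hdis Hcov oU oV U V.
    intros U V oU oV Hcov Hdis U0 (v & [Dv|(t & Ht & ->)] & Vv).
    - apply HD. exists U, V. split; [|split; [|split; [|split; [|split]]]]; auto.
      + intros z Dz. apply Hcov. now left.
      + exists (p t0). auto.
      + exists v. auto.
      + intros z Dz. apply Hdis. now left.
    - assert (Dp : forall s, x <= s <= y -> D' (p s)) by (intros s Hs; right; eauto).
      assert (lc : forall s, x <= s <= y -> (U (p s) <-> U (p x))).
      { apply locally_constant_interval; [lra|tauto|]. intros s Hs.
        destruct (Hcov (p s) (Dp s Hs)) as [H|H].
        - destruct (proj1 (open_Copen U) oU _ H) as (r & rp & Hr).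
          destruct (Hp s Hs r rp) as (d & dp & Hd). exists d. split; auto.
          intros s' Hs' Hss. assert (U (p s')) by (apply Hr, Hd; auto). tauto.
        - destruct (proj1 (open_Copen V) oV _ H) as (r & rp & Hr).
          destruct (Hp s Hs r rp) as (d & dp & Hd). exists d. split; auto.
          intros s' Hs' Hss. assert (V (p s')) by (apply Hr, Hd; auto).
          pose proof (Hdis (p s) (Dp s Hs)). pose proof (Hdis (p s') (Dp s' Hs')). tauto. }
      pose proof (lc t0 Ht0). pose proof (lc t Ht). pose proof (Hdis (p t) (Dp t Ht)). tauto. }
  destruct (Hcov (p t0) (or_introl D0)) as [H|H].
  - apply (main U V); eauto.
  - apply (main V U); eauto.
    + intros z Dz. destruct (Hcov z Dz); auto.
Qed.

(** Adjoining the path to [D] keeps it connected and inside [E], so the maximality of the component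
    forces the path into [D]. *)
Lemma component_path (E D : C -> Prop) (p : R -> C) (x y t0 : R) :
  is_component E D -> x <= t0 <= y ->
  (forall t, x <= t <= y -> pcont (fun s => x <= s <= y) p t) ->
  (forall t, x <= t <= y -> E (p t)) -> D (p t0) -> forall t, x <= t <= y -> D (p t).
Proof.
  intros (_ & HE & Hc & Hmax) Ht0 Hp HpE D0 t Ht.
  apply (Hmax (fun z => D z \/ exists t, x <= t <= y /\ z = p t)).
  - now apply connected_add_path with t0.
  - intros z [Dz|(s & Hs & ->)]; auto.
  - auto.
  - right. eauto.
Qed.

Lemma component_segment (E D : C -> Prop) (a b : C) :
  is_component E D -> (forall t : R, 0 <= t <= 1 -> E (a + t * (b - a))%C) -> D a -> D b.
Proof.
  intros H HE Da. replace b with (a + 1 * (b - a))%C by ring.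
  apply (component_path E D (fun t : R => a + t * (b - a))%C 0 1 0 H); auto; try lra.
  - intros t Ht. apply pdiff_pcont with (b - a)%C. apply pdiff_segment.
  - replace (a + 0 * (b - a))%C with a by ring. auto.
Qed.

Lemma component_open (E D : C -> Prop) : Copen E -> is_component E D -> Copen D.
Proof.
  intros HE H z Dz. destruct (HE z) as (r & rp & Hr); [now apply H|].
  exists r. split; auto. intros w Hw. apply (component_segment E D z w H); auto.
  intros t Ht. apply Hr. replace (z + t * (w - z) - z)%C with (t * (w - z))%C by ring.
  rewrite Cmod_scal_pos by lra. pose proof (Cmod_ge_0 (w - z)). nra.
Qed.

(** * Local geometry of the curve *)

Lemma pcont_mono (E F : R -> Prop) (p : R -> C) (t : R) :
  (forall s, F s -> E s) -> pcont E p t -> pcont F p t.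
Proof.
  intros H Hp e ep. destruct (Hp e ep) as (d & dp & Hd). exists d. split; auto.
Qed.

Lemma trace_complement_open (gamma : R -> C) (a b : R) :
  a < b -> (forall t, a <= t <= b -> pcont (fun s => a <= s <= b) gamma t) ->
  Copen (fun y => ~ trace gamma a b y).
Proof.
  intros ab Hg z Hz.
  destruct (path_distance gamma z a b) as (d & dp & Hd); auto; [lra| |].
  - intros t Ht h. apply Hz. exists t. auto.
  - exists d. split; auto. intros w Hw (t & Ht & ->). specialize (Hd t Ht). lra.
Qed.

(** Differentiability is asked for on the open piece only; the continuous [v] supplies the one-sided
    tangents at the ends, through [smooth_piece_secant]. *)
Definition smooth_piece (gamma : R -> C) (x y : R) (v : R -> C) : Prop :=
  x < y /\ (forall t, x <= t <= y -> pcont (fun s => x <= s <= y) gamma t) /\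
  (forall t, x <= t <= y -> pcont (fun s => x <= s <= y) v t) /\
  (forall t, x <= t <= y -> v t <> 0%C) /\
  (forall t, x < t < y -> pdiff gamma t (v t)).

Lemma pdiff_velocity (gamma : R -> C) (t : R) (l : C) : pdiff gamma t l -> velocity gamma t = l.
Proof.
  intros H. unfold velocity. apply injective_projections; simpl; apply is_derive_unique.
  - now apply pdiff_Re.
  - now apply pdiff_Im.
Qed.

(** Strict differentiability, uniform in both parameters and valid at the ends of the piece:
    subtracting the linear path of velocity [v t0] leaves a path whose derivative is smaller than
    [k]. *)
Lemma smooth_piece_secant (gamma v : R -> C) (x y t0 k : R) :
  smooth_piece gamma x y v -> x <= t0 <= y -> 0 < k ->
  exists d, 0 < d /\ forall s t, x <= s <= y -> x <= t <= y ->
    Rabs (s - t0) < d -> Rabs (t - t0) < d ->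
    Cmod (gamma s - gamma t - (s - t)%R * v t0) <= k * Rabs (s - t) /\ Cmod (v t - v t0) < k.
Proof.
  intros (xy & Hg & Hv & _ & Hd) Ht0 kp.
  destruct (Hv t0 Ht0 k kp) as (d & dp & Hdv).
  assert (A : forall s t, x <= t -> t <= s -> s <= y -> Rabs (s - t0) < d -> Rabs (t - t0) < d ->
    Cmod (gamma s - gamma t - (s - t)%R * v t0) <= k * (s - t)).
  { intros s t H1 H2 H3 Hs Ht.
    replace (gamma s - gamma t - (s - t)%R * v t0)%C
      with ((gamma s + (0 + s * - v t0)) - (gamma t + (0 + t * - v t0)))%C
      by (rewrite RtoC_minus; ring).
    apply Rabs_def2 in Hs. apply Rabs_def2 in Ht.
    apply (mvt_bound (fun u : R => gamma u + (0 + u * - v t0))%C (fun u => (v u + - v t0)%C)); auto.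
    - intros u Hu e ep.
      destruct (pcont_mono (fun s' => x <= s' <= y) (fun s' => t <= s' <= s) gamma u
          ltac:(intros; lra) (Hg u ltac:(lra)) (e / 2))
        as (d1 & dp1 & Hd1); [lra|].
      destruct (pdiff_pcont _ _ _ (fun s' => t <= s' <= s) (pdiff_linear (- v t0) 0 u) (e / 2))
        as (d2 & dp2 & Hd2); [lra|].
      exists (Rmin d1 d2). split; [apply Rmin_glb_lt; auto|]. intros w Hw Hwu.
      specialize (Hd1 w Hw (Rlt_le_trans _ _ _ Hwu (Rmin_l _ _))).
      specialize (Hd2 w Hw (Rlt_le_trans _ _ _ Hwu (Rmin_r _ _))).
      eapply Rle_lt_trans; [apply Cmod_split with (b := (gamma w - gamma u)%C)
        (c := ((0 + w * - v t0) - (0 + u * - v t0))%C); ring|]. lra.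
    - intros u Hu. apply pdiff_plus; [apply Hd; lra|apply pdiff_linear].
    - intros u Hu. left. apply Hdv; [lra|]. apply Rabs_between. lra. }
  exists d. split; auto. intros s t Hs Ht Hsd Htd. split; [|auto].
  destruct (Rle_dec t s) as [h|h].
  - rewrite (Rabs_pos_eq (s - t)) by lra. apply A; lra.
  - rewrite Rabs_minus_sym, (Rabs_pos_eq (t - s)) by lra.
    replace (gamma s - gamma t - (s - t)%R * v t0)%C
      with (- (gamma t - gamma s - (t - s)%R * v t0))%C by (rewrite !RtoC_minus; ring).
    rewrite Cmod_opp. apply A; lra.
Qed.

(** By injectivity only [t0] itself is mapped to [gamma t0], and compactness of the two remaining
    parameter intervals yields a positive distance. The parameter [b] is handled through
    [gamma a = gamma b]. *)
Lemma curve_separation (gamma : R -> C) (a b t0 d : R) :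
  simple_closed gamma a b ->
  (forall t, a <= t <= b -> pcont (fun s => a <= s <= b) gamma t) -> a < t0 < b -> 0 < d ->
  exists r, 0 < r /\ forall s, a <= s <= b -> d <= Rabs (s - t0) -> r <= Cmod (gamma s - gamma t0).
Proof.
  intros (ab & Hclosed & Hinj) Hg Ht0 dp.
  assert (ne : forall s, a <= s <= b -> s <> t0 -> gamma s <> gamma t0).
  { intros s Hs hs h. destruct (Req_dec s b) as [->|hb].
    - rewrite <- Hclosed in h. apply Hinj in h; lra.
    - apply Hinj in h; lra. }
  assert (L : forall x y, a <= x -> y <= b -> (forall s, x <= s <= y -> s <> t0) ->
    exists r, 0 < r /\ forall s, x <= s <= y -> r <= Cmod (gamma s - gamma t0)).
  { intros x y hx hy hs. destruct (Rle_dec x y) as [xy|xy].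
    - apply path_distance; auto.
      + intros t Ht. apply pcont_mono with (E := fun s => a <= s <= b); [intros; lra|apply Hg; lra].
      + intros t Ht. apply ne; [lra|auto].
    - exists 1. split; [lra|]. intros s Hs. lra. }
  destruct (L a (t0 - d)) as (r1 & p1 & H1); [lra|lra|intros; lra|].
  destruct (L (t0 + d) b) as (r2 & p2 & H2); [lra|lra|intros; lra|].
  exists (Rmin r1 r2). split; [apply Rmin_glb_lt; auto|]. intros s Hs Hd.
  destruct (Rle_dec s t0) as [h|h].
  - eapply Rle_trans; [apply Rmin_l|]. apply H1. rewrite Rabs_left1 in Hd; lra.
  - eapply Rle_trans; [apply Rmin_r|]. apply H2. rewrite Rabs_pos_eq in Hd; lra.
Qed.

Definition left_normal (l : C) : C := (Ci * l / Cmod l)%C.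

Lemma Cmod_left_normal (l : C) : l <> 0%C -> Cmod (left_normal l) = 1.
Proof.
  intros h. apply Cmod_gt_0 in h. unfold left_normal.
  rewrite Cmod_div by (apply RtoC_neq_0; lra).
  rewrite Cmod_mult, Cmod_Ci, Cmod_R, Rabs_pos_eq by lra. field. lra.
Qed.

(* Near [t0] a chord of the curve is almost parallel to the tangent, so it cannot be a vector
   close to the normal direction. *)
Lemma curve_sides (gamma v : R -> C) (a b x y t0 : R) :
  simple_closed gamma a b ->
  (forall t, a <= t <= b -> pcont (fun s => a <= s <= b) gamma t) ->
  smooth_piece gamma x y v -> a <= x -> y <= b -> x < t0 < y ->
  exists r, 0 < r /\ forall t e nu, Rabs (t - t0) < r -> 0 < Rabs e < r ->
    Cmod (nu - left_normal (v t0)) < / 4 -> ~ trace gamma a b (gamma t + e * nu)%C.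
Proof.
  intros Hs Hg Hp ax yb Ht0.
  assert (v0 : v t0 <> 0%C) by (apply Hp; lra).
  assert (m0 := proj1 (Cmod_gt_0 _) v0). set (m := Cmod (v t0)) in *.
  destruct (smooth_piece_secant gamma v x y t0 (m / 8) Hp) as (d & dp & Hd); [lra|lra|].
  set (d1 := Rmin d (Rmin (t0 - x) (y - t0))).
  assert (dp1 : 0 < d1) by (repeat apply Rmin_glb_lt; lra).
  assert (d1d : d1 <= d) by min_le.
  assert (d1x : d1 <= t0 - x) by min_le.
  assert (d1y : d1 <= y - t0) by min_le.
  destruct (curve_separation gamma a b t0 d1 Hs Hg) as (q & qp & Hq); [lra|auto|].
  (* A point of the curve with parameter outside the [d1]-neighbourhood is at distance at least [q]
     from [gamma t0], whereas [gamma t + e * nu] is closer than [4 * (m + 1) * r]. *)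
  set (r := Rmin d1 (q / (4 * (m + 1)))).
  assert (rq : 0 < q / (4 * (m + 1))) by (apply Rdiv_lt_0_compat; lra).
  exists r. split; [apply Rmin_glb_lt; auto|].
  intros t e nu Ht He Hnu (s & Hsab & E).
  assert (r1 : r <= d1) by min_le.
  assert (r2 : r <= q / (4 * (m + 1))) by min_le.
  assert (Rt := Ht). apply Rabs_def2 in Rt.
  assert (Lnu : Cmod nu <= 5 / 4).
  { triangle (nu - left_normal (v t0))%C (left_normal (v t0)).
    rewrite Cmod_left_normal by auto. lra. }
  assert (near : forall u w, Rabs (u - t0) < d1 -> Rabs (w - t0) < d1 ->
    Cmod (gamma u - gamma w - (u - w)%R * v t0) <= m / 8 * Rabs (u - w)).
  { intros u w Hu Hw. assert (Hu' := Hu). assert (Hw' := Hw).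
    apply Rabs_def2 in Hu'. apply Rabs_def2 in Hw'. apply Hd; lra. }
  destruct (Rlt_dec (Rabs (s - t0)) d1) as [h|h].
  - pose proof (near s t h ltac:(lra)) as K.
    assert (mC : RtoC m <> 0%C) by (apply RtoC_neq_0; lra).
    set (T := (v t0 / m)%C).
    assert (CT : Cmod T = 1).
    { unfold T. rewrite Cmod_div, Cmod_R, Rabs_pos_eq by (auto; lra). fold m. field. lra. }
    set (X := (s - t) * m).
    assert (F : ((X - e * Ci) * T)%C =
      (e * (nu - left_normal (v t0)) - (gamma s - gamma t - (s - t)%R * v t0))%C).
    { rewrite <- E. unfold X, T, left_normal. fold m. rewrite RtoC_mult. field. auto. }
    apply (f_equal Cmod) in F. rewrite Cmod_mult, CT, Rmult_1_r in F.
    assert (F1 : Cmod (X - e * Ci) <= Rabs e / 4 + Rabs X / 8).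
    { rewrite F. eapply Rle_trans; [apply Cmod_triangle|]. rewrite Cmod_opp, Cmod_scal.
      unfold X. rewrite Rabs_mult, (Rabs_pos_eq m) by lra.
      pose proof (Rabs_pos e). nra. }
    (* The tangential part [X] and the normal part [e] are both at most the modulus; adding the two
       bounds, [F1] forces [Rabs X + Rabs e <= Rabs X / 4 + Rabs e / 2], impossible for [e <> 0]. *)
    assert (F2 : Rabs X <= Cmod (X - e * Ci)).
    { eapply Rle_trans; [|apply re_le_Cmod]. right. f_equal.
      unfold Re, Cminus, Cplus, Copp, Cmult, Ci, RtoC; simpl. ring. }
    assert (F3 : Rabs e <= Cmod (X - e * Ci)).
    { eapply Rle_trans; [|apply im_le_Cmod]. rewrite <- Rabs_Ropp. right. f_equal.
      unfold Im, Cminus, Cplus, Copp, Cmult, Ci, RtoC; simpl. ring. }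
    lra.
  - pose proof (Hq s Hsab ltac:(lra)) as K.
    pose proof (near t t0 ltac:(lra) ltac:(rewrite Rminus_eq_0, Rabs_R0; auto)) as K2.
    assert (K3 : Cmod (gamma t - gamma t0) <= 2 * m * Rabs (t - t0)).
    { triangle (gamma t - gamma t0 - (t - t0)%R * v t0)%C ((t - t0)%R * v t0)%C.
      rewrite Cmod_scal. fold m. pose proof (Rabs_pos (t - t0)). nra. }
    assert (K4 : Cmod (gamma s - gamma t0) <= Rabs e * (5 / 4) + 2 * m * Rabs (t - t0)).
    { eapply Rle_trans; [apply Cmod_split with (b := (e * nu)%C) (c := (gamma t - gamma t0)%C);
        rewrite <- E; ring|].
      rewrite Cmod_scal. pose proof (Rabs_pos e). nra. }
    assert (K5 : 4 * (m + 1) * r <= q).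
    { apply Rmult_le_reg_r with (/ (4 * (m + 1))); [apply Rinv_0_lt_compat; lra|].
      rewrite Rmult_assoc, (Rmult_comm r), <- Rmult_assoc, Rinv_r, Rmult_1_l by lra. exact r2. }
    pose proof (Rabs_pos (t - t0)). nra.
Qed.

(** * Integrals along the curve *)

Lemma Cmod_0_eq_le (c : C) : Cmod c <= 0 -> c = 0%C.
Proof. intros H. apply Cmod_eq_0. pose proof (Cmod_ge_0 c). lra. Qed.

Lemma ccont_pcont_2 (op : C -> C -> C) (E : R -> Prop) (p q : R -> C) (t : R) :
  (forall e, 0 < e -> exists d, 0 < d /\ forall u w, Cmod (u - p t) < d -> Cmod (w - q t) < d ->
     Cmod (op u w - op (p t) (q t)) < e) ->
  pcont E p t -> pcont E q t -> pcont E (fun s => op (p s) (q s)) t.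
Proof.
  intros Hop Hp Hq e ep. destruct (Hop e ep) as (d & dp & Hd).
  destruct (Hp d dp) as (d1 & p1 & H1). destruct (Hq d dp) as (d2 & p2 & H2).
  exists (Rmin d1 d2). split; [apply Rmin_glb_lt; auto|]. intros s Es Hs. apply Hd.
  - apply H1; auto. eapply Rlt_le_trans; [apply Hs|apply Rmin_l].
  - apply H2; auto. eapply Rlt_le_trans; [apply Hs|apply Rmin_r].
Qed.

Lemma pcont_plus (E : R -> Prop) (p q : R -> C) (t : R) :
  pcont E p t -> pcont E q t -> pcont E (fun s => p s + q s)%C t.
Proof.
  apply (ccont_pcont_2 Cplus). intros e ep. exists (e / 2). split; [lra|]. intros u w Hu Hw.
  eapply Rle_lt_trans; [apply Cmod_split with (b := (u - p t)%C) (c := (w - q t)%C); ring|]. lra.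
Qed.

Lemma pcont_mult (E : R -> Prop) (p q : R -> C) (t : R) :
  pcont E p t -> pcont E q t -> pcont E (fun s => p s * q s)%C t.
Proof.
  apply (ccont_pcont_2 Cmult). intros e ep.
  pose proof (Cmod_ge_0 (p t)) as hp. pose proof (Cmod_ge_0 (q t)) as hq.
  set (K := Cmod (p t) + Cmod (q t) + 1).
  assert (K0 : 0 < e / K) by (apply Rdiv_lt_0_compat; unfold K; lra).
  exists (Rmin 1 (e / K)). split; [apply Rmin_glb_lt; lra|]. intros u w Hu Hw.
  pose proof (Rmin_l 1 (e / K)). pose proof (Rmin_r 1 (e / K)).
  assert (d0 : 0 < Rmin 1 (e / K)) by (apply Rmin_glb_lt; lra).
  triangle3 ((u - p t) * (w - q t))%C ((u - p t) * q t)%C (p t * (w - q t))%C.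
  rewrite !Cmod_mult. pose proof (Cmod_ge_0 (u - p t)). pose proof (Cmod_ge_0 (w - q t)).
  apply Rlt_le_trans with (e / K * K).
  - unfold K at 2. nra.
  - right. field. unfold K. lra.
Qed.

Lemma pcont_const (E : R -> Prop) (c : C) (t : R) : pcont E (fun _ => c) t.
Proof.
  intros e ep. exists 1. split; [lra|]. intros s _ _.
  replace (c - c)%C with (RtoC 0) by ring. now rewrite Cmod_0.
Qed.

Lemma pcont_inv (E : R -> Prop) (p : R -> C) (t : R) :
  p t <> 0%C -> pcont E p t -> pcont E (fun s => / p s)%C t.
Proof.
  intros n Hp. apply pcont_comp with (D := fun _ => True) (f := Cinv); auto.
  apply cdiff_ccont with (1 := cdiff_inv _ n).
Qed.

Lemma pcont_pow (E : R -> Prop) (p : R -> C) (t : R) (n : nat) :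
  pcont E p t -> pcont E (fun s => p s ^ n)%C t.
Proof.
  intros H. induction n as [|n IH].
  - apply (pcont_const _ (RtoC 1)).
  - now apply (pcont_mult _ p (fun s => p s ^ n)%C).
Qed.


Lemma is_RIntC_zero (h : R -> C) (a b : R) :
  a <= b -> (forall t, a < t < b -> h t = 0%C) -> is_RIntC h a b (RtoC 0).
Proof.
  intros ab H. apply is_RInt_ext with (fun _ => RtoC 0).
  - rewrite Rmin_left, Rmax_right by auto. intros t Ht. symmetry. auto.
  - pose proof (is_RInt_const (V := C_R_NormedModule) a b (RtoC 0)) as K.
    rewrite scal_R_Cmult, Cmult_0_r in K. exact K.
Qed.

Lemma is_RIntC_ext_point (h k : R -> C) (a b t0 : R) (l : C) :
  a <= b -> (forall t, a < t < b -> t <> t0 -> h t = k t) -> is_RIntC h a b l -> is_RIntC k a b l.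
Proof.
  intros ab H Hh.
  assert (Z : is_RIntC (fun t => k t - h t)%C a b (RtoC 0)).
  { destruct (classic (a < t0 < b)) as [Ht|Ht].
    - replace (RtoC 0) with (plus (G := C_AbelianMonoid) (RtoC 0) (RtoC 0)).
      2: { eqC. change plus with Cplus. ring. }
      apply (is_RInt_Chasles (V := C_R_NormedModule)) with t0; apply is_RIntC_zero; try lra.
      + intros t Ht'. rewrite H by lra. ring.
      + intros t Ht'. rewrite H by lra. ring.
    - apply is_RIntC_zero; auto. intros t Ht'. rewrite H; [ring|auto|intros ->; auto]. }
  replace l with (0 + l)%C by ring.
  apply is_RInt_ext with (fun t => (k t - h t) + h t)%C.
  - intros t _. eqC. ring.
  - now apply is_RIntC_plus.
Qed.

(** Integrals ignore finitely many parameters. This discards the corners, where [velocity] and the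
    normal carry no information. *)
Lemma is_RIntC_ext_list (L : list R) (h k : R -> C) (a b : R) (l : C) :
  a <= b -> (forall t, a < t < b -> ~ In t L -> h t = k t) -> is_RIntC h a b l -> is_RIntC k a b l.
Proof.
  intros ab. revert h. induction L as [|t0 L IH]; intros h H Hh.
  - apply is_RInt_ext with h; auto. rewrite Rmin_left, Rmax_right by auto. intros t Ht.
    apply H; auto.
  - set (h' := fun t => if Req_EM_T t t0 then k t else h t).
    apply (IH h').
    + intros t Ht n. unfold h'. destruct Req_EM_T as [|n']; auto.
      apply H; auto. intros [->|]; auto.
    + apply is_RIntC_ext_point with h t0; auto.
      intros t Ht n. unfold h'. destruct Req_EM_T; tauto.
Qed.

(** The derivative is known only inside, so [P] is compared with the indefinite integral of the
    clamped integrand: the difference has derivative 0 inside and is continuous up to the ends. *)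
Lemma is_RIntC_ftc (w P : R -> C) (x y : R) :
  x < y -> (forall t, x <= t <= y -> pcont (fun s => x <= s <= y) w t) ->
  (forall t, x <= t <= y -> pcont (fun s => x <= s <= y) P t) ->
  (forall t, x < t < y -> pdiff P t (w t)) -> is_RIntC w x y (P y - P x)%C.
Proof.
  intros xy Hw HP Hd.
  set (u := fun t => w (clamp x y t)).
  assert (Hu : forall t, pcont (fun _ => True) u t) by (apply pcont_clamp; auto; lra).
  set (F := fun t => RIntC u x t).
  assert (HF : forall t, is_RIntC u x t (F t)).
  { intros t. apply (RInt_correct (V := C_R_CompleteNormedModule)), ex_RInt_continuous.
    intros s _. now apply continuous_of_pcont. }
  assert (dF : forall t, pdiff F t (u t)).
  { intros t. apply pdiff_of_is_derive. apply is_derive_RInt with x.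
    - now apply filter_forall.
    - now apply continuous_of_pcont. }
  assert (E : Cmod ((P y + -(1) * F y) - (P x + -(1) * F x)) <= 0 * (y - x)).
  { apply (mvt_bound (fun t => P t + -(1) * F t)%C (fun t => w t + -(1) * u t)%C); [lra| | |].
    - intros t Ht. apply pcont_plus; auto.
      apply pdiff_pcont with (-(1) * u t)%C. now apply pdiff_cmult.
    - intros t Ht. apply pdiff_plus; auto. now apply pdiff_cmult.
    - intros t Ht. unfold u. rewrite clamp_id by lra.
      replace (w t + - (1) * w t)%C with (RtoC 0) by ring. rewrite Cmod_0. lra. }
  rewrite Rmult_0_l in E. apply Cmod_0_eq_le in E.
  assert (F0 : F x = RtoC 0) by apply (RInt_point (V := C_R_CompleteNormedModule)).
  replace (P y - P x)%C with (F y).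
  - apply is_RInt_ext with u; [|apply HF]. rewrite Rmin_left, Rmax_right by lra.
    intros t Ht. unfold u. now rewrite clamp_id by lra.
  - apply Ceq_minus. rewrite F0 in E.
    replace (F y - (P y - P x))%C with (- (P y + - (1) * F y - (P x + - (1) * 0)))%C by ring.
    rewrite E. ring.
Qed.

Definition piecewise_regular (gamma : R -> C) (a b : R) (N : nat) (s : nat -> R) (v : nat -> R -> C)
  : Prop :=
  s 0%nat = a /\ s N = b /\
  forall i, (i < N)%nat -> smooth_piece gamma (s i) (s (S i)) (v i).

Lemma piecewise_smooth_regular (gamma : R -> C) (a b : R) :
  piecewise_smooth gamma a b ->
  (forall t, a <= t <= b -> pcont (fun s => a <= s <= b) gamma t) /\
  exists N s v, piecewise_regular gamma a b N s v.
Proof.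
  intros (Hc & N & s & s0 & sN & Hs).
  assert (Hc' : forall t, a <= t <= b -> pcont (fun s => a <= s <= b) gamma t)
    by now apply continuous_on_pcont.
  split; auto.
  assert (mono : forall i j, (i <= j)%nat -> (j <= N)%nat -> s i <= s j).
  { intros i j Hij. induction Hij as [|j Hij IH]; intros HjN; [lra|].
    destruct (Hs j) as [H _]; [lia|]. specialize (IH ltac:(lia)). lra. }
  assert (Q : forall i, exists v, (i < N)%nat -> smooth_piece gamma (s i) (s (S i)) v).
  { intros i. destruct (Nat.lt_ge_cases i N) as [h|h].
    - destruct (Hs i h) as (lt & v & Hv & Hn & Hd). exists v. intros _.
      assert (a <= s i) by (rewrite <- s0; apply mono; lia).
      assert (s (S i) <= b) by (rewrite <- sN; apply mono; lia).
      repeat split; auto.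
      + intros t Ht. apply pcont_mono with (fun s => a <= s <= b); [intros; lra|apply Hc'; lra].
      + now apply continuous_on_pcont.
      + intros t Ht. apply pdiff_of_is_derive. auto.
    - exists gamma. lia. }
  exists N, s, (fun i => proj1_sig (constructive_indefinite_description _ (Q i))).
  split; [|split]; auto. intros i Hi.
  destruct (constructive_indefinite_description _ (Q i)) as [v Hv]. simpl. auto.
Qed.

Lemma regular_mono (gamma : R -> C) (a b : R) (N : nat) (s : nat -> R) (v : nat -> R -> C) (i j : nat) :
  piecewise_regular gamma a b N s v -> (i <= j)%nat -> (j <= N)%nat -> s i <= s j.
Proof.
  intros (_ & _ & Hs) Hij. induction Hij as [|j Hij IH]; intros HjN; [lra|].
  destruct (Hs j) as [H _]; [lia|]. specialize (IH ltac:(lia)). lra.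
Qed.

Lemma regular_within (gamma : R -> C) (a b : R) (N : nat) (s : nat -> R) (v : nat -> R -> C) (i : nat) :
  piecewise_regular gamma a b N s v -> (i < N)%nat -> a <= s i /\ s (S i) <= b.
Proof.
  intros H Hi. assert (H' := H). destruct H' as (<- & <- & _).
  split; eapply regular_mono; eauto; lia.
Qed.

Definition on_open_piece (N : nat) (s : nat -> R) (t : R) : Prop :=
  exists i, (i < N)%nat /\ s i < t < s (S i).

Lemma regular_cases (gamma : R -> C) (a b : R) (N : nat) (s : nat -> R) (v : nat -> R -> C) (t : R) :
  piecewise_regular gamma a b N s v -> a <= t <= b ->
  on_open_piece N s t \/ exists i, (i <= N)%nat /\ t = s i.
Proof.
  intros H. assert (H' := H). destruct H' as (s0 & sN & _). rewrite <- sN. intros [at_ tb].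
  assert (A : forall k, (k <= N)%nat -> t <= s k ->
    on_open_piece N s t \/ exists i, (i <= N)%nat /\ t = s i).
  { induction k as [|k IH]; intros Hk tk.
    - right. exists 0%nat. split; [lia|]. lra.
    - destruct (Rle_dec t (s k)) as [h|h].
      + apply IH; auto. lia.
      + destruct (Req_dec t (s (S k))) as [e|e].
        * right. exists (S k). auto.
        * left. exists k. split; [lia|]. lra. }
  apply (A N); auto.
Qed.

(* The derivative of the curve, with the junk values of [velocity] at the corners replaced by 0. *)
Definition speed (gamma : R -> C) (N : nat) (s : nat -> R) (t : R) : C :=
  if excluded_middle_informative (on_open_piece N s t) then velocity gamma t else 0%C.

Lemma speed_piece (gamma : R -> C) (a b : R) (N : nat) (s : nat -> R) (v : nat -> R -> C) (i : nat) (t : R) :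
  piecewise_regular gamma a b N s v -> (i < N)%nat -> s i < t < s (S i) ->
  speed gamma N s t = v i t /\ velocity gamma t = v i t.
Proof.
  intros H Hi Ht.
  assert (E : velocity gamma t = v i t) by (apply pdiff_velocity, (proj2 (proj2 H) i Hi); auto).
  split; auto. unfold speed. destruct excluded_middle_informative as [|n]; auto.
  exfalso. apply n. exists i. auto.
Qed.

Lemma path_bounded (p : R -> C) (x y : R) :
  x <= y -> (forall t, x <= t <= y -> pcont (fun s => x <= s <= y) p t) ->
  exists M, 0 < M /\ forall t, x <= t <= y -> Cmod (p t) <= M.
Proof.
  intros xy Hc.
  (* The bound is sought in the form [/ d], so that decreasing the tolerance weakens the claim. *)
  destruct (compact_interval (fun d t => Cmod (p t) <= / d) x y) as (d & dp & Hd); auto.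
  - intros d d' t [h1 h2] H. eapply Rle_trans; [apply H|]. apply Rinv_le_contravar; auto.
  - intros t Ht. destruct (Hc t Ht 1) as (d & dp & Hd); [lra|].
    pose proof (Cmod_ge_0 (p t)).
    exists d, (/ (Cmod (p t) + 1)). repeat split; auto.
    + apply Rinv_0_lt_compat. lra.
    + intros s Hs Hst. rewrite Rinv_inv. specialize (Hd s Hs Hst).
      triangle (p t) (p s - p t)%C. lra.
  - exists (/ d). split; auto. now apply Rinv_0_lt_compat.
Qed.

Lemma speed_bounded (gamma : R -> C) (a b : R) (N : nat) (s : nat -> R) (v : nat -> R -> C) :
  piecewise_regular gamma a b N s v -> exists M, 0 < M /\ forall t, Cmod (speed gamma N s t) <= M.
Proof.
  intros H.
  assert (A : forall k, (k <= N)%nat -> exists M, 0 < M /\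
    forall i t, (i < k)%nat -> s i < t < s (S i) -> Cmod (speed gamma N s t) <= M).
  { induction k as [|k IH]; intros Hk.
    - exists 1. split; [lra|]. intros. lia.
    - destruct IH as (M & Mp & HM); [lia|].
      destruct (proj2 (proj2 H) k) as (xy & _ & Hv & _); [lia|].
      destruct (path_bounded (v k) (s k) (s (S k))) as (M' & Mp' & HM'); auto; [lra|].
      exists (M + M'). split; [lra|]. intros i t Hi Ht.
      destruct (Nat.eq_dec i k) as [->|n].
      + rewrite (proj1 (speed_piece _ _ _ _ _ _ k t H ltac:(lia) Ht)).
        specialize (HM' t ltac:(lra)). lra.
      + specialize (HM i t ltac:(lia) Ht). lra. }
  destruct (A N (le_n _)) as (M & Mp & HM). exists M. split; auto. intros t.
  destruct (classic (on_open_piece N s t)) as [(i & Hi & Ht)|n].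
  - now apply HM with i.
  - unfold speed. destruct excluded_middle_informative; [tauto|]. rewrite Cmod_0. lra.
Qed.

Lemma speed_integrable (gamma : R -> C) (a b : R) (N : nat) (s : nat -> R) (v : nat -> R -> C)
    (p : R -> C) :
  piecewise_regular gamma a b N s v ->
  (forall t, a <= t <= b -> pcont (fun s => a <= s <= b) p t) ->
  is_RIntC (fun t => p t * speed gamma N s t)%C a b (RIntC (fun t => p t * speed gamma N s t)%C a b).
Proof.
  intros H Hp. apply (RInt_correct (V := C_R_CompleteNormedModule)).
  assert (A : forall k, (k <= N)%nat ->
    ex_RInt (V := C_R_NormedModule) (fun t => p t * speed gamma N s t)%C a (s k)).
  { induction k as [|k IH]; intros Hk.
    - rewrite (proj1 H). apply ex_RInt_point.
    - apply (ex_RInt_Chasles (V := C_R_NormedModule)) with (s k); [apply IH; lia|].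
      destruct (proj2 (proj2 H) k) as (xy & _ & Hv & _); [lia|].
      destruct (regular_within _ _ _ _ _ _ k H) as [ax yb]; [lia|].
      apply ex_RInt_ext with (fun t => p (clamp (s k) (s (S k)) t) * v k (clamp (s k) (s (S k)) t))%C.
      + rewrite Rmin_left, Rmax_right by lra. intros t Ht. rewrite clamp_id by lra.
        now rewrite (proj1 (speed_piece _ _ _ _ _ _ k t H ltac:(lia) Ht)).
      + apply (ex_RInt_continuous (V := C_R_CompleteNormedModule)). intros t _.
        apply continuous_of_pcont.
        apply (pcont_clamp (fun t => p t * v k t)%C); [lra|].
        intros u Hu. apply pcont_mult; auto.
        apply pcont_mono with (fun s => a <= s <= b); [intros; lra|apply Hp; lra]. }
  rewrite <- (proj1 (proj2 H)). apply A. lia.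
Qed.

(** The increments over the pieces telescope because [P] is continuous across the corners. On the
    closed curve this makes the integral vanish whenever [P b = P a]. *)
Lemma speed_ftc (gamma : R -> C) (a b : R) (N : nat) (s : nat -> R) (v : nat -> R -> C)
    (p P : R -> C) :
  piecewise_regular gamma a b N s v ->
  (forall t, a <= t <= b -> pcont (fun s => a <= s <= b) p t) ->
  (forall t, a <= t <= b -> pcont (fun s => a <= s <= b) P t) ->
  (forall i t, (i < N)%nat -> s i < t < s (S i) -> pdiff P t (p t * v i t)%C) ->
  is_RIntC (fun t => p t * speed gamma N s t)%C a b (P b - P a)%C.
Proof.
  intros H Hp HP Hd.
  assert (A : forall k, (k <= N)%nat ->
    is_RIntC (fun t => p t * speed gamma N s t)%C a (s k) (P (s k) - P a)%C).
  { induction k as [|k IH]; intros Hk.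
    - rewrite (proj1 H). replace (P a - P a)%C with (zero (G := C_R_NormedModule)).
      + apply is_RInt_point.
      + eqC. change (RtoC 0 = (P a - P a)%C). ring.
    - destruct (proj2 (proj2 H) k) as (xy & _ & Hv & _); [lia|].
      destruct (regular_within _ _ _ _ _ _ k H) as [ax yb]; [lia|].
      replace (P (s (S k)) - P a)%C with (plus (G := C_R_NormedModule) (P (s k) - P a)%C (P (s (S k)) - P (s k))%C).
      2: { eqC. change plus with Cplus. ring. }
      apply (is_RInt_Chasles (V := C_R_NormedModule)) with (s k); [apply IH; lia|].
      apply is_RInt_ext with (fun t => p t * v k t)%C.
      + rewrite Rmin_left, Rmax_right by lra. intros t Ht.
        now rewrite (proj1 (speed_piece _ _ _ _ _ _ k t H ltac:(lia) Ht)).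
      + assert (sub : forall q t, (forall t, a <= t <= b -> pcont (fun s => a <= s <= b) q t) ->
          s k <= t <= s (S k) -> pcont (fun u => s k <= u <= s (S k)) q t).
        { intros q t Hq Ht. apply pcont_mono with (fun s => a <= s <= b); [intros; lra|apply Hq; lra]. }
        apply is_RIntC_ftc; auto.
        * intros t Ht. apply pcont_mult; auto. }
  rewrite <- (proj1 (proj2 H)). apply A. lia.
Qed.

Lemma is_RIntC_velocity (gamma : R -> C) (a b : R) (N : nat) (s : nat -> R) (v : nat -> R -> C)
    (h k : R -> C) (l : C) :
  a <= b -> piecewise_regular gamma a b N s v ->
  (forall t, on_open_piece N s t -> h t = k t) -> is_RIntC h a b l -> is_RIntC k a b l.
Proof.
  intros ab H Heq. apply is_RIntC_ext_list with (map s (seq 0 (S N))); auto.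
  intros t Ht n. apply Heq. destruct (regular_cases _ _ _ _ _ _ t H) as [|(i & Hi & E)]; auto; [lra|].
  exfalso. apply n. rewrite E. apply in_map, in_seq. lia.
Qed.

(** * Winding numbers *)

Record curve_data (gamma : R -> C) (a b : R) (N : nat) (s : nat -> R) (v : nat -> R -> C) : Prop := {
  curve_simple : simple_closed gamma a b;
  curve_cont : forall t, a <= t <= b -> pcont (fun u => a <= u <= b) gamma t;
  curve_regular : piecewise_regular gamma a b N s v
}.

(** The factor [1 / (2 * PI * Ci)] is left out, so the value is [2 * PI * Ci] inside and 0
    outside. *)
Definition winding (gamma : R -> C) (a b : R) (N : nat) (s : nat -> R) (w : C) : C :=
  RIntC (fun t => / (gamma t - w) * speed gamma N s t)%C a b.

Lemma pdiff_const (c : C) (t : R) : pdiff (fun _ => c) t 0.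
Proof.
  intros e ep. exists 1. split; [lra|]. intros s _.
  replace (c - c - (s - t)%R * 0)%C with (RtoC 0) by ring. rewrite Cmod_0.
  pose proof (Rabs_pos (s - t)). nra.
Qed.

Lemma trace_neq (gamma : R -> C) (a b t : R) (z : C) :
  ~ trace gamma a b z -> a <= t <= b -> (gamma t - z)%C <> 0%C.
Proof. intros H Ht h. apply Ceq_minus in h. apply H. exists t. auto. Qed.

Lemma pcont_resolvent (gamma : R -> C) (a b t : R) (z : C) :
  (forall t, a <= t <= b -> pcont (fun u => a <= u <= b) gamma t) ->
  ~ trace gamma a b z -> a <= t <= b -> pcont (fun u => a <= u <= b) (fun t => / (gamma t - z))%C t.
Proof.
  intros Hg Hz Ht. apply (pcont_inv _ (fun t => gamma t - z)%C); [now apply (trace_neq gamma a b)|].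
  apply pcont_plus; auto. apply pcont_const.
Qed.

Lemma pdiff_resolvent (gamma : R -> C) (t : R) (z l : C) :
  (gamma t - z)%C <> 0%C -> pdiff gamma t l ->
  pdiff (fun t => / (gamma t - z))%C t (- / ((gamma t - z) * (gamma t - z)) * l)%C.
Proof.
  intros n H. apply (pdiff_comp Cinv (fun t => gamma t - z)%C); [|now apply cdiff_inv].
  replace l with (l + 0)%C by ring. apply pdiff_plus; auto. apply pdiff_const.
Qed.

Lemma winding_integral (gamma : R -> C) (a b : R) (N : nat) (s : nat -> R) (v : nat -> R -> C) (w : C) :
  curve_data gamma a b N s v -> ~ trace gamma a b w ->
  is_RIntC (fun t => / (gamma t - w) * speed gamma N s t)%C a b (winding gamma a b N s w).
Proof.
  intros [Hs Hc Hr] Hw. apply (speed_integrable gamma a b N s v (fun t => / (gamma t - w))%C); auto.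
  intros t Ht. now apply pcont_resolvent.
Qed.

(* The first-order term of [winding w] at [w = z] is the integral of the derivative of
   [1 / (gamma - z)] along a closed curve. *)
Lemma winding_cdiff (gamma : R -> C) (a b : R) (N : nat) (s : nat -> R) (v : nat -> R -> C) (z : C) :
  curve_data gamma a b N s v -> ~ trace gamma a b z -> cdiff (winding gamma a b N s) z 0.
Proof.
  intros D Hz. assert (D' := D). destruct D' as [(ab & cl & inj) Hc Hr].
  destruct (path_distance gamma z a b) as (d & dp & Hd); [lra|auto| |].
  { intros t Ht h. apply Hz. exists t. auto. }
  destruct (speed_bounded _ _ _ _ _ _ Hr) as (M & Mp & HM).
  (* The difference of the two resolvents minus its first-order term is
     [(w - z)^2 / ((gamma - z)^2 (gamma - w))], where the factors of the denominator are at least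
     [d], [d] and [d / 2]. *)
  set (K := 2 * M * (b - a) / (d * d * d)).
  assert (d3 : 0 < d * d * d) by (repeat apply Rmult_lt_0_compat; auto).
  assert (K0 : 0 <= K) by (apply Rdiv_le_0_compat; nra).
  intros e ep. exists (Rmin (d / 2) (e / (K + 1))).
  split; [apply Rmin_glb_lt; [lra|apply Rdiv_lt_0_compat; lra]|].
  intros w Hw.
  pose proof (Rlt_le_trans _ _ _ Hw (Rmin_l _ _)) as H1.
  pose proof (Rlt_le_trans _ _ _ Hw (Rmin_r _ _)) as H2.
  assert (Aw : forall t, a <= t <= b -> d / 2 <= Cmod (gamma t - w)).
  { intros t Ht. specialize (Hd t Ht).
    assert (Cmod (gamma t - z) <= Cmod (gamma t - w) + Cmod (w - z)) by (apply Cmod_split; ring). lra. }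
  assert (Tw : ~ trace gamma a b w).
  { intros (t & Ht & E). specialize (Aw t Ht). rewrite E in Aw.
    replace (gamma t - gamma t)%C with (RtoC 0) in Aw by ring. rewrite Cmod_0 in Aw. lra. }
  assert (I0 : is_RIntC (fun t => ((w - z) * / ((gamma t - z) * (gamma t - z))) * speed gamma N s t)%C a b
    ((- (w - z) * / (gamma b - z)) - (- (w - z) * / (gamma a - z)))%C).
  { apply (speed_ftc gamma a b N s v (fun t => (w - z) * / ((gamma t - z) * (gamma t - z)))%C
      (fun t => - (w - z) * / (gamma t - z))%C); auto.
    - intros t Ht. apply pcont_mult; [apply pcont_const|].
      apply (pcont_inv _ (fun t => (gamma t - z) * (gamma t - z))%C).
      + apply Cmult_neq_0; now apply (trace_neq gamma a b).
      + apply pcont_mult; (apply pcont_plus; [auto|apply pcont_const]).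
    - intros t Ht. apply pcont_mult; [apply pcont_const|]. now apply pcont_resolvent.
    - intros i t Hi Ht. destruct (regular_within _ _ _ _ _ _ i Hr Hi).
      assert (n : (gamma t - z)%C <> 0%C) by (apply (trace_neq gamma a b); auto; lra).
      replace ((w - z) * / ((gamma t - z) * (gamma t - z)) * v i t)%C
        with (- (w - z) * (- / ((gamma t - z) * (gamma t - z)) * v i t))%C by (field; auto).
      apply pdiff_cmult, pdiff_resolvent; auto. apply (proj2 (proj2 Hr) i Hi). auto. }
  rewrite cl in I0.
  pose proof (is_RIntC_minus _ _ _ _ _ _ (is_RIntC_minus _ _ _ _ _ _
    (winding_integral _ _ _ _ _ _ w D Tw) (winding_integral _ _ _ _ _ _ z D Hz)) I0) as I.
  match type of I with is_RInt _ _ _ ?l =>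
    replace l with (winding gamma a b N s w - winding gamma a b N s z - 0 * (w - z))%C in I by ring end.
  assert (B : Cmod (winding gamma a b N s w - winding gamma a b N s z - 0 * (w - z)) <=
    (2 * M / (d * d * d) * (Cmod (w - z) * Cmod (w - z))) * (b - a)).
  { refine (is_RIntC_bound _ _ _ _ _ _ _ I); [lra|]. intros t Ht. cbv beta.
    assert (n1 : (gamma t - z)%C <> 0%C) by (apply (trace_neq gamma a b); auto).
    assert (n2 : (gamma t - w)%C <> 0%C) by (apply (trace_neq gamma a b); auto).
    replace (_ - _ - _)%C with ((w - z) * (w - z) * / ((gamma t - z) * (gamma t - z) * (gamma t - w))
      * speed gamma N s t)%C by (field; auto).
    rewrite !Cmod_mult, Cmod_inv, !Cmod_mult by (repeat apply Cmult_neq_0; auto).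
    specialize (Hd t Ht). specialize (Aw t Ht). specialize (HM t).
    replace (2 * M / (d * d * d) * (Cmod (w - z) * Cmod (w - z)))
      with (Cmod (w - z) * Cmod (w - z) * / (d * d * (d / 2)) * M) by (field; lra).
    apply Rmult_le_compat; [| apply Cmod_ge_0 | |auto].
    - apply Rmult_le_pos; [apply Rmult_le_pos; apply Cmod_ge_0|].
      left. apply Rinv_0_lt_compat. repeat apply Rmult_lt_0_compat; lra.
    - apply Rmult_le_compat_l; [apply Rmult_le_pos; apply Cmod_ge_0|].
      apply Rinv_le_contravar; [repeat apply Rmult_lt_0_compat; lra|].
      apply Rmult_le_compat; try lra; nra. }
  eapply Rle_trans; [apply B|].
  replace (2 * M / (d * d * d) * (Cmod (w - z) * Cmod (w - z)) * (b - a))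
    with (K * Cmod (w - z) * Cmod (w - z)) by (unfold K; field; lra).
  apply Rmult_le_compat_r; [apply Cmod_ge_0|].
  eapply Rle_trans; [apply Rmult_le_compat_l; [auto|left; apply H2]|].
  apply mult_div_succ_le; auto.
Qed.

(** A vanishing derivative makes the winding integral locally constant off the curve. The set where
    it takes its value at [z] and the set where it takes another value are then open, and would
    separate the component. *)
Lemma winding_component (gamma : R -> C) (a b : R) (N : nat) (s : nat -> R) (v : nat -> R -> C)
    (D : C -> Prop) (z w : C) :
  curve_data gamma a b N s v -> is_component (fun y => ~ trace gamma a b y) D -> D z -> D w ->
  winding gamma a b N s z = winding gamma a b N s w.
Proof.
  intros CD (_ & HE & Hc & _) Dz Dw.
  assert (HW := fun z => winding_cdiff gamma a b N s v z CD).
  set (W := winding gamma a b N s) in *. clearbody W.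
  assert (Ho : Copen (fun y => ~ trace gamma a b y)).
  { destruct CD as [(ab & _) Hcont _]. now apply trace_complement_open. }
  assert (lc : forall x, ~ trace gamma a b x -> exists r, 0 < r /\
    forall y, Cmod (y - x) < r -> ~ trace gamma a b y /\ W y = W x).
  { intros x Hx. destruct (Ho x Hx) as (r & rp & Hr). exists r. split; auto.
    intros y Hy. split; auto.
    assert (E : W (x + 1 * (y - x))%C = W (x + 0 * (y - x))%C).
    { apply (pdiff_zero_const (fun t : R => W (x + t * (y - x))%C)); [lra|]. intros t Ht.
      replace (RtoC 0) with (0 * (y - x))%C by ring.
      apply (pdiff_comp W (fun t : R => x + t * (y - x))%C); [apply pdiff_segment|].
      apply HW, Hr.
      replace (x + t * (y - x) - x)%C with (t * (y - x))%C by ring.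
      rewrite Cmod_scal_pos by lra. pose proof (Cmod_ge_0 (y - x)). nra. }
    replace (x + 1 * (y - x))%C with y in E by ring.
    replace (x + 0 * (y - x))%C with x in E by ring. exact E. }
  apply NNPP. intros n. apply Hc.
  exists (fun y => ~ trace gamma a b y /\ W y = W z), (fun y => ~ trace gamma a b y /\ W y <> W z).
  split; [|split; [|split; [|split; [|split]]]].
  - apply open_Copen. intros x [Hx E]. destruct (lc x Hx) as (r & rp & Hr).
    exists r. split; auto. intros y Hy. destruct (Hr y Hy) as [h1 h2]. split; auto. congruence.
  - apply open_Copen. intros x [Hx E]. destruct (lc x Hx) as (r & rp & Hr).
    exists r. split; auto. intros y Hy. destruct (Hr y Hy) as [h1 h2]. split; auto. congruence.
  - intros x Dx. destruct (classic (W x = W z)); auto.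
  - exists z. auto.
  - exists w. split; auto.
  - intros x _ [_ h1] [_ h2]. auto.
Qed.

(** The value is constant on the component, which contains points arbitrarily far away, and there
    the integrand is arbitrarily small. *)
Lemma winding_outer (gamma : R -> C) (a b : R) (N : nat) (s : nat -> R) (v : nat -> R -> C)
    (D : C -> Prop) (z : C) :
  curve_data gamma a b N s v -> outer_component gamma a b D -> D z -> winding gamma a b N s z = 0%C.
Proof.
  intros CD [HD Hu] Dz. assert (CD' := CD). destruct CD' as [(ab & _) Hc Hr].
  destruct (path_bounded gamma a b) as (B & Bp & HB); [lra|auto|].
  destruct (speed_bounded _ _ _ _ _ _ Hr) as (M & Mp & HM).
  apply Cmod_0_eq. intros e ep.
  set (Q := B + M * (b - a) / e).
  assert (0 < M * (b - a) / e) by (apply Rdiv_lt_0_compat; nra).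
  assert (exists w, D w /\ Q < Cmod w) as (w & Dw & Hw).
  { apply NNPP. intros n. apply Hu. exists Q. intros w Dw.
    destruct (Rle_dec (Cmod w) Q); auto. exfalso. apply n. exists w. split; auto. lra. }
  rewrite (winding_component _ _ _ _ _ _ D z w CD HD Dz Dw).
  assert (Tw : ~ trace gamma a b w) by (apply HD; auto).
  replace e with (e / (b - a) * (b - a)) by (field; lra).
  refine (is_RIntC_bound _ _ _ _ _ _ _ (winding_integral _ _ _ _ _ _ w CD Tw)); [lra|].
  intros t Ht. rewrite Cmod_mult, Cmod_inv by now apply (trace_neq gamma a b).
  assert (K : M * (b - a) / e <= Cmod (gamma t - w)).
  { assert (Cmod w <= Cmod (gamma t) + Cmod (w - gamma t)) by (apply Cmod_split; ring).
    rewrite (Cmod_sym w) in H0. specialize (HB t Ht). unfold Q in Hw. lra. }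
  apply Rle_trans with (/ (M * (b - a) / e) * M).
  - apply Rmult_le_compat; auto using Cmod_ge_0.
    + left. apply Rinv_0_lt_compat. lra.
    + apply Rinv_le_contravar; auto.
  - right. field. split; lra.
Qed.

Lemma winding_inner (gamma : R -> C) (a b : R) (N : nat) (s : nat -> R) (v : nat -> R -> C)
    (D : C -> Prop) (z : C) :
  curve_data gamma a b N s v -> positively_oriented gamma a b D -> D z ->
  winding gamma a b N s z = (2 * PI * Ci)%C.
Proof.
  intros CD Hp Dz. assert (CD' := CD). destruct CD' as [(ab & _) Hc Hr].
  apply (is_RInt_unique (V := C_R_CompleteNormedModule)).
  apply (is_RIntC_velocity gamma a b N s v) with (4 := Hp z Dz); auto; [lra|].
  intros t (i & Hi & Ht). destruct (speed_piece _ _ _ _ _ _ i t Hr Hi Ht) as [E1 E2].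
  rewrite E1, E2. unfold Cdiv. ring.
Qed.

(** * The interior lies to the left *)

(** By Lagrange's identity the component of [n] along the left normal carries the whole length of
    [n], so it is 1 or -1. *)
Lemma left_normal_dichotomy (n l : C) :
  l <> 0%C -> Cmod n = 1 -> Re n * Re l + Im n * Im l = 0 ->
  n = left_normal l \/ n = (- left_normal l)%C.
Proof.
  intros hl hn ho. assert (m0 := proj1 (Cmod_gt_0 l) hl). set (m := Cmod l) in *.
  pose proof (Cmod2_alt l) as E1. fold m in E1. pose proof (Cmod2_alt n) as E2. rewrite hn in E2.
  destruct l as [x y]. destruct n as [u w]. unfold Re, Im in *. simpl in E1, E2, ho.
  assert (F : left_normal (x, y) = (- y / m, x / m)).
  { unfold left_normal. fold m. unfold Cdiv, Cmult, Ci, Cinv, RtoC; simpl. f_equal; field; lra. }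
  rewrite F.
  assert (Em : m * m = x * x + y * y) by lra. assert (En : u * u + w * w = 1) by lra.
  (* [k / m] is the component of [n] along the left normal. *)
  set (k := - u * y + w * x).
  assert (K2 : k * k = m * m).
  { replace (m * m) with ((x * x + y * y) * (u * u + w * w)) by (rewrite En; lra). unfold k.
    transitivity ((- u * y + w * x) * (- u * y + w * x) + (u * x + w * y) * (u * x + w * y)); [rewrite ho; ring|ring]. }
  assert (U : u * (m * m) = - y * k).
  { unfold k. rewrite Em.
    replace (u * (x * x + y * y)) with (x * (u * x + w * y) - y * (- u * y + w * x)) by ring.
    rewrite ho. ring. }
  assert (V : w * (m * m) = x * k).
  { unfold k. rewrite Em.
    replace (w * (x * x + y * y)) with (y * (u * x + w * y) + x * (- u * y + w * x)) by ring.
    rewrite ho. ring. }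
  assert (mm : m * m <> 0) by (apply Rgt_not_eq, Rmult_lt_0_compat; auto).
  assert (cases : k = m \/ k = - m).
  { assert ((k - m) * (k + m) = 0) by lra. apply Rmult_integral in H. destruct H; [left|right]; lra. }
  destruct cases as [hk|hk]; rewrite hk in U, V; [left|right].
  - f_equal; apply Rmult_eq_reg_r with (m * m); auto.
    + rewrite U. field. lra.
    + rewrite V. field. lra.
  - unfold Copp; simpl. f_equal; apply Rmult_eq_reg_r with (m * m); auto.
    + rewrite U. field. lra.
    + rewrite V. field. lra.
Qed.

(** The relative error counts twice, once for the vector and once for its modulus. *)
Lemma left_normal_close (l k : C) :
  l <> 0%C -> k <> 0%C -> Cmod (left_normal l - left_normal k) <= 2 * Cmod (l - k) / Cmod k.
Proof.
  intros hl hk. assert (ml := proj1 (Cmod_gt_0 l) hl). assert (mk := proj1 (Cmod_gt_0 k) hk).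
  assert (cl : RtoC (Cmod l) <> 0%C) by (apply RtoC_neq_0; lra).
  assert (ck : RtoC (Cmod k) <> 0%C) by (apply RtoC_neq_0; lra).
  eapply Rle_trans; [apply Cmod_split with (b := (Ci * (l - k) / Cmod k)%C)
    (c := (left_normal l * ((Cmod k - Cmod l)%R / Cmod k))%C)|].
  - unfold left_normal. rewrite RtoC_minus. field. auto.
  - rewrite Cmod_mult, Cmod_left_normal by auto.
    rewrite !Cmod_div, Cmod_mult, Cmod_Ci, !Cmod_R, (Rabs_pos_eq (Cmod k)) by (auto; lra).
    assert (h : Rabs (Cmod k - Cmod l) <= Cmod (l - k)).
    { assert (Cmod k <= Cmod l + Cmod (k - l)) by (apply Cmod_split; ring).
      assert (Cmod l <= Cmod k + Cmod (l - k)) by (apply Cmod_split; ring).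
      rewrite (Cmod_sym k) in H. apply Rabs_le. lra. }
    unfold Rdiv. rewrite !Rmult_1_l, <- Rmult_plus_distr_r.
    apply Rmult_le_compat_r; [left; now apply Rinv_0_lt_compat|]. lra.
Qed.

(** Since [/ 8 + / 2 + / 16] is below 1, the relative perturbation of the product cannot push it out
    of the right half-plane. *)
Lemma Re_mult_conj_nonneg (m K : R) (al be : C) :
  0 <= m -> 0 <= K -> Cmod al <= / 8 -> Cmod be <= / 2 ->
  0 <= Re (m * (1 + al) * Cconj (K * (1 + be))).
Proof.
  intros hm hK ha hb.
  replace (m * (1 + al) * Cconj (K * (1 + be)))%C
    with ((m * K)%R * (1 + (al + Cconj be + al * Cconj be)))%C.
  2: { rewrite Cmult_conj, Cplus_conj, RtoC_mult.
       replace (Cconj K) with (RtoC K) by (unfold Cconj, RtoC; simpl; f_equal; ring).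
       replace (Cconj 1) with (RtoC 1) by (unfold Cconj, RtoC; simpl; f_equal; ring). ring. }
  rewrite re_scal_l, re_plus, re_RtoC. apply Rmult_le_pos; [now apply Rmult_le_pos|].
  assert (h : Cmod (al + Cconj be + al * Cconj be) <= 1).
  { eapply Rle_trans; [apply Cmod_triangle|]. eapply Rle_trans; [apply Rplus_le_compat_r, Cmod_triangle|].
    rewrite Cmod_mult, Cmod_conj. pose proof (Cmod_ge_0 al). pose proof (Cmod_ge_0 be). nra. }
  pose proof (re_le_Cmod (al + Cconj be + al * Cconj be)) as h2.
  apply Rabs_le_between in h2. lra.
Qed.

(** For a straight arc [A = X * T] and velocity [u = m * T] the expression equals
    [- 2 * Ci * e * m / (X^2 + e^2)]. The bending of the arc and the turning of the velocity enter
    through the small relative errors [be] and [al], which do not change the sign of the imaginary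
    part. *)
Lemma resolvent_jump_near (m X e : R) (T A u err : C) :
  0 < m -> 0 < e -> Cmod T = 1 -> A = (X * T + err)%C -> Cmod err <= Rabs X / 8 ->
  Cmod (u - m * T) <= m / 8 -> (A + e * (Ci * T))%C <> 0%C -> (A - e * (Ci * T))%C <> 0%C ->
  Im ((/ (A + e * (Ci * T)) - / (A - e * (Ci * T))) * u) <= 0.
Proof.
  intros mp ep CT EA Herr Hu n1 n2.
  assert (T0 : T <> 0%C) by (apply Cmod_gt_0; lra).
  assert (mC : RtoC m <> 0%C) by (apply RtoC_neq_0; lra).
  set (K := X * X + e * e). assert (K0 : 0 < K) by (unfold K; nra).
  assert (KC : RtoC K <> 0%C) by (apply RtoC_neq_0; lra).
  set (z := (err / T)%C).
  assert (Cz : Cmod z <= Rabs X / 8) by (unfold z; rewrite Cmod_div, CT by auto; lra).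
  set (al := ((u - m * T) / (m * T))%C). set (be := ((2 * X * z + z * z) / K)%C).
  assert (Cal : Cmod al <= / 8).
  { unfold al. rewrite Cmod_div, Cmod_mult, CT, Cmod_R, Rabs_pos_eq by (auto using Cmult_neq_0; lra).
    apply Rmult_le_reg_r with (m * 1); [lra|]. field_simplify; [|lra]. lra. }
  assert (Cbe : Cmod be <= / 2).
  { unfold be. rewrite Cmod_div, Cmod_R, (Rabs_pos_eq K) by (auto; lra).
    apply Rmult_le_reg_r with K; auto. unfold Rdiv. rewrite Rmult_assoc, Rinv_l, Rmult_1_r by lra.
    eapply Rle_trans; [apply Cmod_triangle|]. rewrite !Cmod_mult, !Cmod_R, (Rabs_pos_eq 2) by lra.
    pose proof (Rabs_pos X). pose proof (Cmod_ge_0 z).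
    assert (S : Rabs X * Rabs X = X * X) by (rewrite <- Rabs_mult; apply Rabs_pos_eq; nra).
    assert (2 * Rabs X * Cmod z <= 2 * Rabs X * (Rabs X / 8)) by (apply Rmult_le_compat_l; lra).
    assert (Cmod z * Cmod z <= (Rabs X / 8) * (Rabs X / 8)) by (apply Rmult_le_compat; lra).
    unfold K. nra. }
  pose proof (Re_mult_conj_nonneg m K al be (Rlt_le _ _ mp) (Rlt_le _ _ K0) Cal Cbe) as P.
  assert (Eu : u = (m * (1 + al) * T)%C) by (unfold al; field; auto).
  set (q := (K * (1 + be))%C) in *.
  assert (Eq : ((A + e * (Ci * T)) * (A - e * (Ci * T)) = q * (T * T))%C).
  { unfold q, be, z. rewrite EA. unfold K. rewrite RtoC_plus, !RtoC_mult.
    replace (Ci * T)%C with (T * Ci)%C by ring.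
    transitivity ((X * T + err) * (X * T + err) - e * e * (T * T) * (Ci * Ci))%C; [ring|].
    replace (Ci * Ci)%C with (- (1))%C
      by (unfold Ci, Cmult, Copp, RtoC; simpl; f_equal; ring).
    field. split; auto. rewrite <- !RtoC_mult, <- RtoC_plus. exact KC. }
  assert (q0 : q <> 0%C).
  { intros h. rewrite h, Cmult_0_l in Eq. revert Eq. now apply Cmult_neq_0. }
  assert (mq := proj1 (Cmod_gt_0 q) q0).
  assert (E : ((/ (A + e * (Ci * T)) - / (A - e * (Ci * T))) * u =
    (-2 * e / (Cmod q ^ 2))%R * (Ci * (m * (1 + al) * Cconj q)))%C).
  { transitivity ((-2 * e)%R * Ci * T * u / ((A + e * (Ci * T)) * (A - e * (Ci * T))))%C.
    - rewrite RtoC_mult. replace (RtoC (-2)) with (- (2))%C by (rewrite <- RtoC_opp; f_equal; ring).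
      field. auto.
    - rewrite Eq, Eu. rewrite RtoC_div by (apply pow_nonzero; lra).
      rewrite Cmod2_conj. field. repeat split; auto.
      intros h. apply (f_equal Cmod) in h. rewrite Cmod_conj, Cmod_0 in h. lra. }
  rewrite E, im_scal_l.
  replace (Im (Ci * (m * (1 + al) * Cconj q))) with (Re (m * (1 + al) * Cconj q)).
  2: { generalize (m * (1 + al) * Cconj q)%C. intros [x y].
       unfold Im, Re, Ci, Cmult; simpl. ring. }
  assert (0 < Cmod q ^ 2) by (apply pow_lt; auto).
  assert (0 <= e / Cmod q ^ 2) by (apply Rdiv_le_0_compat; lra).
  replace (-2 * e / Cmod q ^ 2) with (- (2 * (e / Cmod q ^ 2))) by (field; lra). nra.
Qed.

(** Away from the crossing both resolvents have denominators at least [r / 2], so their difference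
    is linear in the displacement and disappears in the limit. *)
Lemma resolvent_jump_far (A d u : C) (r M : R) :
  0 < r -> r <= Cmod A -> Cmod d <= r / 2 -> Cmod u <= M ->
  Cmod ((/ (A + d) - / (A - d)) * u) <= 8 * M / (r * r) * Cmod d.
Proof.
  intros rp HA Hd Hu.
  assert (h1 : r / 2 <= Cmod (A + d)).
  { assert (Cmod A <= Cmod (A + d) + Cmod (- d)) by (apply Cmod_split; ring).
    rewrite Cmod_opp in H. lra. }
  assert (h2 : r / 2 <= Cmod (A - d)).
  { assert (Cmod A <= Cmod (A - d) + Cmod d) by (apply Cmod_split; ring). lra. }
  assert (n1 : (A + d)%C <> 0%C) by (apply Cmod_gt_0; lra).
  assert (n2 : (A - d)%C <> 0%C) by (apply Cmod_gt_0; lra).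
  replace ((/ (A + d) - / (A - d)) * u)%C with (- (2 * d * / ((A + d) * (A - d)) * u))%C
    by (field; auto).
  rewrite Cmod_opp, !Cmod_mult, Cmod_inv, Cmod_mult, Cmod_R, Rabs_pos_eq
    by (auto using Cmult_neq_0; lra).
  replace (8 * M / (r * r) * Cmod d) with (2 * Cmod d * / (r / 2 * (r / 2)) * M) by (field; lra).
  assert (0 < r / 2 * (r / 2)) by nra.
  pose proof (Cmod_ge_0 d). pose proof (Cmod_ge_0 u).
  apply Rmult_le_compat; auto.
  - apply Rmult_le_pos; [lra|]. left. apply Rinv_0_lt_compat. nra.
  - apply Rmult_le_compat_l; [lra|]. apply Rinv_le_contravar; auto. apply Rmult_le_compat; lra.
Qed.

(* If the normal pointed to the left, the winding number would drop by 1 when the curve is crossed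
   from right to left; but the contribution of the arc near the crossing is an increase, and that of
   the rest of the curve tends to 0. *)
Lemma outward_normal_right (gamma : R -> C) (a b : R) (N : nat) (s : nat -> R) (v : nat -> R -> C)
    (Oin Oout : C -> Prop) (i : nat) (t0 : R) (n : C) :
  curve_data gamma a b N s v -> inner_component gamma a b Oin -> outer_component gamma a b Oout ->
  positively_oriented gamma a b Oin -> (i < N)%nat -> s i < t0 < s (S i) ->
  is_outward_unit_normal gamma Oin Oout t0 n -> n = (- left_normal (v i t0))%C.
Proof.
  intros CD Hin Hout Hpos Hi Ht0 (Cn & orth & dl & dlp & Hdl).
  assert (CD' := CD). destruct CD' as [Hs Hc Hr].
  destruct (speed_piece _ _ _ _ _ _ i t0 Hr Hi Ht0) as [_ Ev].
  rewrite Ev in orth.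
  assert (Hp := proj2 (proj2 Hr) i Hi).
  destruct (regular_within _ _ _ _ _ _ i Hr Hi) as [ax yb].
  assert (v0 : v i t0 <> 0%C) by (apply Hp; lra).
  destruct (left_normal_dichotomy n (v i t0) v0 Cn orth) as [E|E]; auto. exfalso.
  assert (m0 := proj1 (Cmod_gt_0 _) v0). set (m := Cmod (v i t0)) in *.
  assert (mC : RtoC m <> 0%C) by (apply RtoC_neq_0; lra).
  set (T := (v i t0 / m)%C).
  assert (CT : Cmod T = 1).
  { unfold T. rewrite Cmod_div, Cmod_R, Rabs_pos_eq by (auto; lra). fold m. field. lra. }
  assert (ET : n = (Ci * T)%C) by (rewrite E; unfold left_normal, T; fold m; field; auto).
  destruct (smooth_piece_secant gamma (v i) (s i) (s (S i)) t0 (m / 8) Hp) as (d & dp & Hd); [lra|lra|].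
  set (d1 := Rmin d (Rmin (t0 - s i) (s (S i) - t0))).
  assert (dp1 : 0 < d1) by (repeat apply Rmin_glb_lt; lra).
  assert (d1d : d1 <= d) by min_le.
  assert (d1x : d1 <= t0 - s i) by min_le.
  assert (d1y : d1 <= s (S i) - t0) by min_le.
  destruct (curve_separation gamma a b t0 d1 Hs Hc) as (r & rp & Hsep); [lra|auto|].
  destruct (speed_bounded _ _ _ _ _ _ Hr) as (M & Mp & HM).
  assert (ab : a < b) by apply Hs.
  set (K := 8 * M / (r * r) * (b - a)).
  assert (K0 : 0 <= K).
  { unfold K. apply Rmult_le_pos; [apply Rdiv_le_0_compat|]; nra. }
  (* The last bound makes the far contribution at most [K * e <= 1], to be set against a jump of
     [2 * PI]. *)
  set (e := Rmin (dl / 2) (Rmin (r / 2) (1 / (K + 1)))).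
  assert (ep : 0 < e) by (repeat apply Rmin_glb_lt; try lra; apply Rdiv_lt_0_compat; lra).
  assert (e1 : e <= dl / 2) by min_le.
  assert (e2 : e <= r / 2) by min_le.
  assert (e3 : e <= 1 / (K + 1)) by min_le.
  destruct (Hdl e) as [I1 O1]; [lra|].
  set (p := gamma t0) in *.
  assert (T1 : ~ trace gamma a b (p - e * n)%C) by now apply Hin.
  assert (T2 : ~ trace gamma a b (p + e * n)%C) by now apply Hout.
  pose proof (is_RIntC_minus _ _ _ _ _ _ (winding_integral _ _ _ _ _ _ _ CD T1)
    (winding_integral _ _ _ _ _ _ _ CD T2)) as I.
  rewrite (winding_inner _ _ _ _ _ _ _ _ CD Hpos I1), (winding_outer _ _ _ _ _ _ _ _ CD Hout O1) in I.
  (* The jump [2 * PI * Ci] is purely imaginary, so imaginary parts suffice; near the crossing they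
     have a sign, which no bound on the modulus would reveal. *)
  apply (is_RInt_fct_extend_snd (U := R_NormedModule) (V := R_NormedModule)) in I.
  assert (B : snd (2 * PI * Ci - 0)%C <= (b - a) * (8 * M / (r * r) * e)).
  { refine (is_RInt_le _ (fun _ => 8 * M / (r * r) * e) a b _ _ (Rlt_le _ _ ab) I (is_RInt_const _ _ _) _).
    intros t Ht. cbv beta.
    match goal with |- snd ?c <= _ => change (Im c <= 8 * M / (r * r) * e) end.
    replace (_ - _)%C with
      ((/ ((gamma t - p) + e * n) - / ((gamma t - p) - e * n)) * speed gamma N s t)%C.
    2: { replace (gamma t - (p - e * n))%C with (gamma t - p + e * n)%C by ring.
         replace (gamma t - (p + e * n))%C with (gamma t - p - e * n)%C by ring. ring. }
    assert (0 <= 8 * M / (r * r) * e).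
    { apply Rmult_le_pos; [apply Rdiv_le_0_compat|]; nra. }
    destruct (Rlt_dec (Rabs (t - t0)) d1) as [h|h].
    - assert (h' := h). apply Rabs_def2 in h'.
      apply Rle_trans with 0; auto.
      destruct (Hd t t0) as [Q1 _]; [lra|lra|lra|rewrite Rminus_eq_0, Rabs_R0; lra|].
      destruct (Hd t t) as [_ Q2]; [lra|lra|lra|lra|].
      rewrite (proj1 (speed_piece _ _ _ _ _ _ i t Hr Hi ltac:(lra))). rewrite ET.
      apply resolvent_jump_near with m ((t - t0) * m) (gamma t - p - (t - t0)%R * v i t0)%C; auto.
      + unfold T, p. rewrite RtoC_mult. field. auto.
      + rewrite Rabs_mult, (Rabs_pos_eq m) by lra.
        replace (Rabs (t - t0) * m / 8) with (m / 8 * Rabs (t - t0)) by field. exact Q1.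
      + replace (m * T)%C with (v i t0) by (unfold T; field; auto). lra.
      + rewrite <- ET. replace (gamma t - p + e * n)%C with (gamma t - (p - e * n))%C by ring.
        apply (trace_neq gamma a b); auto. lra.
      + rewrite <- ET. replace (gamma t - p - e * n)%C with (gamma t - (p + e * n))%C by ring.
        apply (trace_neq gamma a b); auto. lra.
    - eapply Rle_trans; [apply Rle_abs|]. eapply Rle_trans; [apply im_le_Cmod|].
      replace e with (Cmod (e * n)) at 3 by (rewrite Cmod_scal_pos, Cn; lra).
      apply resolvent_jump_far; auto.
      + apply Hsep; lra.
      + rewrite Cmod_scal_pos, Cn; lra. }
  replace (snd (2 * PI * Ci - 0)%C) with (2 * PI) in B.
  2: { unfold Cminus, Cplus, Copp, Cmult, Ci, RtoC; simpl. ring. }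
  assert (C1 : K * e <= 1).
  { eapply Rle_trans; [apply Rmult_le_compat_l; [auto|apply e3]|]. apply mult_div_succ_le; lra. }
  unfold K in C1. pose proof PI2_1. unfold PI2 in H. lra.
Qed.

(** By injectivity each point of the list has at most one parameter inside the interval, so cutting
    there and keeping one side removes it. *)
Lemma avoid_points (gamma : R -> C) (a b : R) (L : list C) (x y : R) :
  (forall s t, a <= s < b -> a <= t < b -> gamma s = gamma t -> s = t) -> a <= x -> x < y -> y <= b ->
  exists x' y', x <= x' /\ x' < y' /\ y' <= y /\ forall t, x' < t < y' -> ~ In (gamma t) L.
Proof.
  intros inj. revert x y. induction L as [|c L IH]; intros x y ax xy yb.
  - exists x, y. repeat split; try lra. intros t _ [].
  - destruct (IH x y ax xy yb) as (x' & y' & h1 & h2 & h3 & h4).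
    destruct (classic (exists u, x' < u < y' /\ gamma u = c)) as [(u & Hu & E)|n].
    + exists x', u. repeat split; try lra. intros t Ht [h|h].
      * assert (u = t) by (apply inj; try lra; congruence). lra.
      * apply (h4 t); auto. lra.
    + exists x', y'. repeat split; try lra. intros t Ht [h|h].
      * apply n. exists t. auto.
      * now apply (h4 t).
Qed.

Lemma convex_lt (A B c u : R) : A < c -> B < c -> 0 <= u <= 1 -> (1 - u) * A + u * B < c.
Proof. intros. destruct (Rle_dec u (1 / 2)); nra. Qed.

(** The normal field may be unspecified at [t0], and where it is given its [delta] varies with the
    point. So one interior point near a good parameter [t1] is carried to [gamma t + e * nu] along
    paths that [curve_sides] keeps off the curve: the direction changes first, then the distance,
    then the base point. *)
Lemma left_side_interior (gamma : R -> C) (a b : R) (N : nat) (s : nat -> R) (v : nat -> R -> C)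
    (Oin Oout : C -> Prop) (n : C -> C) (i : nat) (t0 : R) :
  curve_data gamma a b N s v -> inner_component gamma a b Oin -> outer_component gamma a b Oout ->
  positively_oriented gamma a b Oin -> is_outward_normal_field gamma a b Oin Oout n ->
  (i < N)%nat -> s i < t0 < s (S i) ->
  exists r, 0 < r /\ forall t e nu, Rabs (t - t0) < r -> 0 < e < r ->
    Cmod (nu - left_normal (v i t0)) < / 4 -> Oin (gamma t + e * nu)%C.
Proof.
  intros CD Hin Hout Hpos (L & HL) Hi Ht0.
  assert (CD' := CD). destruct CD' as [Hs Hc Hr].
  assert (Hp := proj2 (proj2 Hr) i Hi).
  destruct (regular_within _ _ _ _ _ _ i Hr Hi) as [ax yb].
  assert (v0 : v i t0 <> 0%C) by (apply Hp; lra).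
  assert (m0 := proj1 (Cmod_gt_0 _) v0).
  destruct (curve_sides gamma (v i) a b (s i) (s (S i)) t0 Hs Hc Hp ax yb Ht0) as (r & rp & Hsides).
  destruct (smooth_piece_secant gamma (v i) (s i) (s (S i)) t0 (Cmod (v i t0) / 16) Hp)
    as (d & dp & Hd); [lra|lra|].
  set (q := Rmin (Rmin r d) (Rmin (t0 - s i) (s (S i) - t0))).
  assert (qp : 0 < q) by (repeat apply Rmin_glb_lt; lra).
  assert (q1 : q <= r) by min_le.
  assert (q2 : q <= d) by min_le.
  assert (q3 : q <= t0 - s i) by min_le.
  assert (q4 : q <= s (S i) - t0) by min_le.
  destruct (avoid_points gamma a b L (t0 - q) (t0 + q)) as (x' & y' & h1 & h2 & h3 & h4);
    [apply Hs|lra|lra|lra|].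
  set (t1 := (x' + y') / 2).
  assert (Ht1 : x' < t1 < y') by (unfold t1; lra).
  assert (Rt1 : Rabs (t1 - t0) < q) by (apply Rabs_between; lra).
  assert (Hn : n (gamma t1) = (- left_normal (v i t1))%C).
  { apply (outward_normal_right gamma a b N s v Oin Oout i t1); auto; [lra|].
    apply HL; [lra|auto]. }
  destruct (HL t1 ltac:(lra) (h4 t1 Ht1)) as (_ & _ & dl & dlp & Hdl).
  set (e1 := Rmin dl q / 2).
  assert (e1p : 0 < e1 /\ e1 < dl /\ e1 < q).
  { assert (0 < Rmin dl q) by (apply Rmin_glb_lt; auto).
    pose proof (Rmin_l dl q). pose proof (Rmin_r dl q). unfold e1. lra. }
  destruct (Hdl e1) as [I1 _]; [lra|]. rewrite Hn in I1.
  set (nu1 := left_normal (v i t1)) in *.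
  assert (v1 : v i t1 <> 0%C) by (apply Hp; lra).
  assert (Cnu : Cmod (nu1 - left_normal (v i t0)) < / 4).
  { destruct (Hd t1 t1) as [_ Q]; [lra|lra|lra|lra|].
    eapply Rle_lt_trans; [apply left_normal_close; auto|].
    apply Rmult_lt_reg_r with (Cmod (v i t0)); auto. unfold Rdiv.
    rewrite Rmult_assoc, Rinv_l, Rmult_1_r by lra. lra. }
  destruct Hin as [Hcomp Hbdd].
  exists q. split; auto. intros t e nu Ht He Hnu.
  assert (J0 : Oin (gamma t1 + e1 * nu1)%C).
  { replace (gamma t1 + e1 * nu1)%C with (gamma t1 - e1 * - nu1)%C by ring. exact I1. }
  assert (J1 : Oin (gamma t1 + e1 * nu)%C).
  { refine (component_segment _ _ _ _ Hcomp _ J0). intros u Hu.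
    replace (gamma t1 + e1 * nu1 + u * (gamma t1 + e1 * nu - (gamma t1 + e1 * nu1)))%C
      with (gamma t1 + e1 * (nu1 + u * (nu - nu1)))%C by ring.
    apply Hsides; [lra|rewrite Rabs_pos_eq; lra|].
    eapply Rle_lt_trans; [apply Cmod_split with (b := ((1 - u)%R * (nu1 - left_normal (v i t0)))%C)
      (c := (u * (nu - left_normal (v i t0)))%C); rewrite RtoC_minus; ring|].
    rewrite !Cmod_scal_pos by lra. now apply convex_lt. }
  assert (J2 : Oin (gamma t1 + e * nu)%C).
  { refine (component_segment _ _ _ _ Hcomp _ J1). intros u Hu.
    replace (gamma t1 + e1 * nu + u * (gamma t1 + e * nu - (gamma t1 + e1 * nu)))%C
      with (gamma t1 + (e1 + u * (e - e1))%R * nu)%C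
      by (rewrite RtoC_plus, RtoC_mult, RtoC_minus; ring).
    assert (0 < e1 + u * (e - e1) < q).
    { replace (e1 + u * (e - e1)) with ((1 - u) * e1 + u * e) by ring.
      split; [|apply convex_lt; lra].
      apply Ropp_lt_cancel. rewrite Ropp_0.
      replace (- ((1 - u) * e1 + u * e)) with ((1 - u) * - e1 + u * - e) by ring.
      apply convex_lt; lra. }
    apply Hsides; [lra|rewrite Rabs_pos_eq; lra|auto]. }
  assert (Ht' := Ht). apply Rabs_def2 in Ht'.
  apply (component_path _ _ (fun u => gamma u + e * nu)%C (t0 - Rmax (Rabs (t - t0)) (Rabs (t1 - t0)))
    (t0 + Rmax (Rabs (t - t0)) (Rabs (t1 - t0))) t1 Hcomp); auto.
  - pose proof (Rmax_r (Rabs (t - t0)) (Rabs (t1 - t0))).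
    pose proof (Rle_abs (t1 - t0)). pose proof (Rle_abs (- (t1 - t0))). rewrite Rabs_Ropp in H1. lra.
  - assert (Rmax (Rabs (t - t0)) (Rabs (t1 - t0)) < q) by (apply Rmax_lub_lt; auto).
    intros u Hu. apply pcont_plus; [|apply pcont_const].
    apply pcont_mono with (fun u => a <= u <= b); [intros; lra|apply Hc; lra].
  - assert (Rmax (Rabs (t - t0)) (Rabs (t1 - t0)) < q) by (apply Rmax_lub_lt; auto).
    intros u Hu. apply Hsides; auto; [|rewrite Rabs_pos_eq; lra]. apply Rabs_between. lra.
  - pose proof (Rmax_l (Rabs (t - t0)) (Rabs (t1 - t0))).
    pose proof (Rle_abs (t - t0)). pose proof (Rle_abs (- (t - t0))). rewrite Rabs_Ropp in H1. lra.
Qed.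

(** * Boundary values of a primitive *)

(** Uniform in the parameter and over a cone of directions, so that it applies with the normal of a
    neighbouring parameter and with the initial direction of a circular arc. *)
Definition left_of (gamma : R -> C) (Om : C -> Prop) (t0 : R) (l : C) : Prop :=
  exists r, 0 < r /\ forall t e nu, Rabs (t - t0) < r -> 0 < e < r ->
    Cmod (nu - left_normal l) < / 4 -> Om (gamma t + e * nu)%C.

(** The limit is taken over the whole cone, with a linear rate, so that shifted curves and circular
    arcs, which do not follow the exact normal, read off the same value [h]. *)
Definition boundary_value (gamma : R -> C) (G : C -> C) (t : R) (l h : C) : Prop :=
  exists K d, 0 < K /\ 0 < d /\ forall e nu, 0 < e < d -> Cmod (nu - left_normal l) < / 4 ->
    Cmod (G (gamma t + e * nu)%C - h) <= K * e.

Lemma primitive_segment (G g : C -> C) (x y : C) (M : R) :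
  (forall u : R, 0 <= u <= 1 -> cdiff G (x + u * (y - x))%C (g (x + u * (y - x))%C)) ->
  (forall u : R, 0 <= u <= 1 -> Cmod (g (x + u * (y - x))%C) <= M) ->
  Cmod (G y - G x) <= M * Cmod (y - x).
Proof.
  intros HG HM.
  assert (Hd : forall u : R, 0 <= u <= 1 ->
    pdiff (fun u : R => G (x + u * (y - x))%C) u (g (x + u * (y - x)) * (y - x))%C).
  { intros u Hu. apply (pdiff_comp G (fun u : R => x + u * (y - x))%C); [apply pdiff_segment|auto]. }
  pose proof (mvt_bound (fun u : R => G (x + u * (y - x))%C)
    (fun u : R => g (x + u * (y - x)) * (y - x))%C 0 1 (M * Cmod (y - x))) as B.
  cbv beta in B.
  replace (x + 1 * (y - x))%C with y in B by ring.
  replace (x + 0 * (y - x))%C with x in B by ring.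
  rewrite Rminus_0_r, Rmult_1_r in B. apply B; [lra| | |].
  - intros t Ht. eapply pdiff_pcont. now apply Hd.
  - intros t Ht. apply Hd. lra.
  - intros t Ht. rewrite Cmod_mult. apply Rmult_le_compat_r; [apply Cmod_ge_0|]. apply HM. lra.
Qed.

Lemma ccont_bounded (E : C -> Prop) (g : C -> C) (c : C) :
  ccont E g c -> exists r, 0 < r /\ forall w, E w -> Cmod (w - c) < r -> Cmod (g w) <= Cmod (g c) + 1.
Proof.
  intros H. destruct (H 1 Rlt_0_1) as (r & rp & Hr). exists r. split; auto.
  intros w Ew Hw. specialize (Hr w Ew Hw).
  eapply Rle_trans; [apply Cmod_split with (b := g c) (c := (g w - g c)%C); ring|]. lra.
Qed.

Lemma Cmod_near_normal (l nu : C) : l <> 0%C -> Cmod (nu - left_normal l) < / 4 -> Cmod nu <= 5 / 4.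
Proof.
  intros hl h. triangle (nu - left_normal l)%C (left_normal l). rewrite Cmod_left_normal by auto. lra.
Qed.

(** Continuity of [g] at [gamma t0] bounds it nearby, so [G] is Lipschitz on the truncated cone. Its
    values along the normal at distances halved each time converge, and the Lipschitz bound carries
    the limit to all other directions. *)
Lemma boundary_value_exists (gamma : R -> C) (Om : C -> Prop) (G g : C -> C) (t0 : R) (l : C) :
  l <> 0%C -> left_of gamma Om t0 l -> (forall w, Om w -> cdiff G w (g w)) ->
  ccont (fun w => Om w \/ w = gamma t0) g (gamma t0) ->
  exists h, boundary_value gamma G t0 l h.
Proof.
  intros hl (r & rp & Hr) HG Hg.
  destruct (ccont_bounded _ _ _ Hg) as (q & qp & Hq).
  set (M := Cmod (g (gamma t0)) + 1) in *.
  assert (Mp : 0 < M) by (unfold M; pose proof (Cmod_ge_0 (g (gamma t0))); lra).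
  set (d := Rmin r (q / 2)).
  assert (dp : 0 < d) by (apply Rmin_glb_lt; lra).
  assert (d1 : d <= r) by min_le. assert (d2 : d <= q / 2) by min_le.
  assert (t00 : Rabs (t0 - t0) < r) by (rewrite Rminus_eq_0, Rabs_R0; auto).
  assert (inO : forall e nu, 0 < e < d -> Cmod (nu - left_normal l) < / 4 ->
    Om (gamma t0 + e * nu)%C /\ Cmod (g (gamma t0 + e * nu)%C) <= M).
  { intros e nu He Hnu. assert (O : Om (gamma t0 + e * nu)%C) by (apply Hr; auto; lra).
    split; auto. apply Hq; auto.
    replace (gamma t0 + e * nu - gamma t0)%C with (e * nu)%C by ring.
    rewrite Cmod_scal_pos by lra. pose proof (Cmod_near_normal l nu hl Hnu). nra. }
  assert (Lip : forall e nu e' nu', 0 < e < d -> 0 < e' < d -> Cmod (nu - left_normal l) < / 4 ->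
    Cmod (nu' - left_normal l) < / 4 ->
    Cmod (G (gamma t0 + e' * nu')%C - G (gamma t0 + e * nu)%C) <= M * Cmod (e' * nu' - e * nu)).
  { intros e nu e' nu' He He' Hnu Hnu'.
    replace (e' * nu' - e * nu)%C with (gamma t0 + e' * nu' - (gamma t0 + e * nu))%C by ring.
    assert (A : forall u : R, 0 <= u <= 1 -> exists e'' nu'', 0 < e'' < d /\
      Cmod (nu'' - left_normal l) < / 4 /\
      (gamma t0 + e * nu + u * (gamma t0 + e' * nu' - (gamma t0 + e * nu)))%C =
      (gamma t0 + RtoC e'' * nu'')%C).
    { intros u Hu. set (e'' := (1 - u) * e + u * e').
      assert (e0 : 0 < e'' < d).
      { split; [|apply convex_lt; lra]. unfold e''.
        apply Ropp_lt_cancel. rewrite Ropp_0.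
        replace (- ((1 - u) * e + u * e')) with ((1 - u) * - e + u * - e') by ring.
        apply convex_lt; lra. }
      assert (eC : RtoC e'' <> 0%C) by (apply RtoC_neq_0; lra).
      set (k := u * e' / e'').
      assert (k1 : 1 - k = (1 - u) * e / e'') by (unfold k, e'' in *; field; lra).
      assert (k01 : 0 <= k <= 1).
      { split; [apply Rdiv_le_0_compat; nra|].
        assert (0 <= 1 - k); [|lra]. rewrite k1. apply Rdiv_le_0_compat; nra. }
      exists e'', ((1 - k)%R * nu + k * nu')%C. split; auto. split.
      - replace ((1 - k)%R * nu + k * nu' - left_normal l)%C
          with ((1 - k)%R * (nu - left_normal l) + k * (nu' - left_normal l))%C
          by (rewrite RtoC_minus; ring).
        eapply Rle_lt_trans; [apply Cmod_triangle|]. rewrite !Cmod_scal_pos by lra.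
        apply convex_lt; auto.
      - rewrite k1. unfold k. rewrite !RtoC_div, !RtoC_mult, RtoC_minus by lra. field. auto. }
    apply primitive_segment with g.
    - intros u Hu. destruct (A u Hu) as (e'' & nu'' & H1 & H2 & E). rewrite E.
      apply HG. now apply inO.
    - intros u Hu. destruct (A u Hu) as (e'' & nu'' & H1 & H2 & E). rewrite E.
      now apply inO. }
  set (nu0 := left_normal l).
  assert (H0 : Cmod (nu0 - left_normal l) < / 4).
  { unfold nu0. replace (left_normal l - left_normal l)%C with (RtoC 0) by ring. rewrite Cmod_0. lra. }
  assert (C0 : Cmod nu0 = 1) by now apply Cmod_left_normal.
  set (ee := fun n : nat => d / 2 / 2 ^ n).
  assert (eep : forall n, 0 < ee n < d).
  { intros n. assert (1 <= 2 ^ n) by (apply pow_R1_Rle; lra). unfold ee. split.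
    - apply Rdiv_lt_0_compat; lra.
    - apply Rmult_lt_reg_r with (2 ^ n); [lra|]. field_simplify; nra. }
  destruct (C_complete (fun n => G (gamma t0 + ee n * nu0)%C) (M * (d / 2))) as [h Hh].
  { intros n k nk. eapply Rle_trans; [apply Lip; auto|].
    replace (ee k * nu0 - ee n * nu0)%C with ((ee k - ee n)%R * nu0)%C by (rewrite RtoC_minus; ring).
    rewrite Cmod_scal, C0, Rmult_1_r.
    replace (M * (d / 2) / 2 ^ n) with (M * ee n) by (unfold ee; field; apply pow_nonzero; lra).
    apply Rmult_le_compat_l; [lra|].
    assert (ee k <= ee n).
    { unfold ee. apply Rmult_le_compat_l; [lra|]. apply Rinv_le_contravar; [apply pow_lt; lra|].
      apply Rle_pow; auto. lra. }
    pose proof (eep k). rewrite Rabs_left1; lra. }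
  exists h, (5 / 4 * M), d. split; [lra|]. split; auto. intros e nu He Hnu.
  apply le_epsilon. intros x xp.
  destruct (pow_lt_1_zero (/ 2) ltac:(rewrite Rabs_pos_eq; lra) (x / (M * d))) as [n Hn].
  { apply Rdiv_lt_0_compat; nra. }
  specialize (Hn n (le_n _)). rewrite Rabs_pos_eq, pow_inv in Hn by (apply pow_le; lra).
  specialize (Hh n).
  triangle (G (gamma t0 + e * nu)%C - G (gamma t0 + ee n * nu0)%C)%C (- (h - G (gamma t0 + ee n * nu0)%C))%C.
  rewrite Cmod_opp.
  pose proof (Lip (ee n) nu0 e nu (eep n) He H0 Hnu) as L.
  assert (L2 : Cmod (e * nu - ee n * nu0) <= 5 / 4 * e + ee n).
  { triangle (e * nu)%C (- (ee n * nu0))%C.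
    pose proof (eep n).
    rewrite Cmod_opp, !Cmod_scal_pos, C0 by lra. pose proof (Cmod_near_normal l nu hl Hnu). nra. }
  assert (L3 : M * ee n <= x / 2).
  { apply Rmult_lt_compat_l with (r := M * (d / 2)) in Hn; [|nra].
    unfold ee. unfold Rdiv at 1. left. eapply Rle_lt_trans; [|eapply Rlt_le_trans; [apply Hn|]].
    - right. ring.
    - right. field. nra. }
  replace (M * (d / 2) / 2 ^ n) with (M * ee n) in Hh by (unfold ee; field; apply pow_nonzero; lra).
  assert (M * Cmod (e * nu - ee n * nu0) <= M * (5 / 4 * e + ee n)) by (apply Rmult_le_compat_l; lra).
  lra.
Qed.

(* Compare with the translates [gamma + e nu] of the curve, along which [G] has derivative close
   to [g(gamma t0) v t0]. *)
Lemma boundary_value_diff (gamma v : R -> C) (Om : C -> Prop) (G g : C -> C) (h : R -> C) (x y t0 : R) :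
  smooth_piece gamma x y v -> x < t0 < y -> left_of gamma Om t0 (v t0) ->
  (forall w, Om w -> cdiff G w (g w)) ->
  ccont (fun w => Om w \/ w = gamma t0) g (gamma t0) ->
  (forall t, x < t < y -> boundary_value gamma G t (v t) (h t)) ->
  pdiff h t0 (g (gamma t0) * v t0)%C.
Proof.
  intros Hp Ht0 (r & rp & Hr) HG Hg Hh k kp.
  set (c := gamma t0) in *. set (l := v t0) in *.
  assert (l0 : l <> 0%C) by (apply Hp; lra).
  assert (m0 := proj1 (Cmod_gt_0 l) l0).
  pose proof (Cmod_ge_0 (g c)) as gc0.
  (* The derivative error splits into three products, at most [k'] times 1, [Cmod l] and
     [Cmod (g c)]; hence the denominator. *)
  set (k' := Rmin 1 (k / (Cmod l + 1 + Cmod (g c) + 1))).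
  assert (kp' : 0 < k') by (apply Rmin_glb_lt; [lra|]; apply Rdiv_lt_0_compat; lra).
  destruct (Hg k' kp') as (q & qp & Hq).
  set (kk := Rmin k' (Cmod l / 16)).
  assert (kkp : 0 < kk) by (apply Rmin_glb_lt; lra).
  assert (kk1 : kk <= k') by min_le. assert (kk2 : kk <= Cmod l / 16) by min_le.
  destruct (smooth_piece_secant gamma v x y t0 kk Hp) as (d & dp & Hd); [lra|auto|].
  assert (cg : pcont (fun s => x <= s <= y) gamma t0) by (apply Hp; lra).
  destruct (cg (q / 2)) as (d' & dp' & Hd'); [lra|].
  set (R0 := Rmin (Rmin r d) (Rmin d' (Rmin (t0 - x) (y - t0)))).
  assert (Rp : 0 < R0) by (repeat apply Rmin_glb_lt; lra).
  assert (R1 : R0 <= r) by min_le.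
  assert (R2 : R0 <= d) by min_le.
  assert (R3 : R0 <= d') by min_le.
  assert (R4 : R0 <= t0 - x /\ R0 <= y - t0).
  { split; (eapply Rle_trans; [apply Rmin_r|]; eapply Rle_trans; [apply Rmin_r|]);
      [apply Rmin_l|apply Rmin_r]. }
  exists R0. split; auto.
  set (nu := left_normal l).
  assert (N0 : Cmod (nu - left_normal l) < / 4).
  { unfold nu. replace (left_normal l - left_normal l)%C with (RtoC 0) by ring. rewrite Cmod_0. lra. }
  assert (C0 : Cmod nu = 1) by now apply Cmod_left_normal.
  (* The normal at [t0] lies in the cone of every nearby parameter, so a single displacement
     [e * nu] serves for [h t] and for [h t0]. *)
  assert (N1 : forall t, Rabs (t - t0) < R0 -> Cmod (nu - left_normal (v t)) < / 4).
  { intros t Ht. assert (Ht' := Ht). apply Rabs_def2 in Ht'.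
    destruct (Hd t t) as [_ Q]; [lra|lra|lra|lra|]. fold l in Q.
    rewrite Cmod_sym. unfold nu. eapply Rle_lt_trans; [apply left_normal_close; auto; apply Hp; lra|].
    apply Rmult_lt_reg_r with (Cmod l); auto. unfold Rdiv.
    rewrite Rmult_assoc, Rinv_l, Rmult_1_r by lra. lra. }
  assert (main : forall t1 t2 e, t1 <= t2 -> Rabs (t1 - t0) < R0 -> Rabs (t2 - t0) < R0 ->
    0 < e < Rmin r (q / 2) ->
    Cmod ((G (gamma t2 + e * nu)%C + (0 + t2 * - (g c * l))) -
          (G (gamma t1 + e * nu)%C + (0 + t1 * - (g c * l)))) <= k * (t2 - t1)).
  { intros t1 t2 e Ht12 Ht1 Ht2 He.
    pose proof (Rmin_l r (q / 2)). pose proof (Rmin_r r (q / 2)).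
    apply Rabs_def2 in Ht1. apply Rabs_def2 in Ht2.
    assert (near : forall t, t1 <= t <= t2 -> Om (gamma t + e * nu)%C /\
      Cmod (g (gamma t + e * nu)%C - g c) < k').
    { intros t Ht. assert (O : Om (gamma t + e * nu)%C).
      { apply Hr; auto; [apply Rabs_between|]; lra. }
      split; auto. apply Hq; auto.
      assert (A : Cmod (gamma t - c) < q / 2) by (apply Hd'; [lra|apply Rabs_between; lra]).
      triangle (gamma t - c)%C (e * nu)%C.
      rewrite Cmod_scal_pos, C0 by lra. lra. }
    assert (der : forall t, t1 <= t <= t2 ->
      pdiff (fun t => G (gamma t + e * nu)%C + (0 + t * - (g c * l)))%C t
        (g (gamma t + e * nu)%C * (v t + 0) + - (g c * l))%C).
    { intros t Ht. apply pdiff_plus; [|apply pdiff_linear].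
      apply (pdiff_comp G (fun t => gamma t + e * nu)%C).
      - apply pdiff_plus; [apply Hp; lra|apply pdiff_const].
      - apply HG. now apply near. }
    apply (mvt_bound (fun t : R => G (gamma t + e * nu)%C + (0 + t * - (g c * l)))%C
       (fun t => g (gamma t + e * nu)%C * (v t + 0) + - (g c * l))%C); auto.
    - intros t Ht. eapply pdiff_pcont. now apply der.
    - intros t Ht. apply der. lra.
    - intros t Ht. destruct (near t) as [_ Q]; [lra|].
      destruct (Hd t t) as [_ Q2]; [lra|lra|apply Rabs_between; lra|apply Rabs_between; lra|].
      fold l in Q2.
      triangle3 ((g (gamma t + e * nu)%C - g c) * (v t - l))%C ((g (gamma t + e * nu)%C - g c) * l)%C (g c * (v t - l))%C.
      rewrite !Cmod_mult.
      assert (k' <= 1) by min_le.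
      assert (k2 : k' <= k / (Cmod l + 1 + Cmod (g c) + 1)) by min_le.
      pose proof (Cmod_ge_0 (g (gamma t + e * nu)%C - g c)). pose proof (Cmod_ge_0 (v t - l)).
      apply Rmult_le_compat_r with (r := Cmod l + 1 + Cmod (g c) + 1) in k2; [|lra].
      replace (k / (Cmod l + 1 + Cmod (g c) + 1) * (Cmod l + 1 + Cmod (g c) + 1)) with k in k2
        by (field; lra).
      assert (Cmod (g (gamma t + e * nu)%C - g c) * Cmod (v t - l) <= k' * 1) by nra.
      assert (Cmod (g (gamma t + e * nu)%C - g c) * Cmod l <= k' * Cmod l) by nra.
      assert (Cmod (g c) * Cmod (v t - l) <= Cmod (g c) * k') by nra.
      lra. }
  intros t Ht.
  assert (Ht' := Ht). apply Rabs_def2 in Ht'.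
  destruct (Hh t) as (K1 & d1 & K1p & d1p & H1); [lra|].
  destruct (Hh t0) as (K2 & d2 & K2p & d2p & H2); [lra|]. fold c l in H2.
  assert (t00 : Rabs (t0 - t0) < R0) by (rewrite Rminus_eq_0, Rabs_R0; auto).
  assert (main' : forall e, 0 < e < Rmin r (q / 2) ->
    Cmod (G (gamma t + e * nu)%C - G (c + e * nu)%C - (t - t0)%R * (g c * l)) <= k * Rabs (t - t0)).
  { intros e He. destruct (Rle_dec t0 t) as [h'|h'].
    - rewrite (Rabs_pos_eq (t - t0)) by lra.
      eapply Rle_trans; [|apply (main t0 t e h' t00 Ht He)]. right. f_equal.
      fold c. rewrite RtoC_minus. ring.
    - rewrite (Rabs_left1 (t - t0)) by lra. rewrite Ropp_minus_distr.
      eapply Rle_trans; [|apply (main t t0 e ltac:(lra) Ht t00 He)]. right.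
      rewrite <- Cmod_opp. f_equal. fold c. rewrite RtoC_minus. ring. }
  apply le_epsilon. intros z zp.
  (* The estimate [main'] is uniform in the displacement, so [e] may be chosen after [t], small
     enough that replacing [h] by [G] at both parameters costs at most [(K1 + K2) * e <= z]. *)
  set (e := Rmin (Rmin d1 d2) (Rmin (Rmin r (q / 2)) (z / (K1 + K2))) / 2).
  assert (zK : 0 < z / (K1 + K2)) by (apply Rdiv_lt_0_compat; lra).
  assert (e0 : 0 < e).
  { unfold e. apply Rdiv_lt_0_compat; [|lra]. repeat apply Rmin_glb_lt; lra. }
  assert (e1 : e < d1 /\ e < d2 /\ e < Rmin r (q / 2) /\ e <= z / (K1 + K2)).
  { pose proof (Rmin_l (Rmin d1 d2) (Rmin (Rmin r (q / 2)) (z / (K1 + K2)))).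
    pose proof (Rmin_r (Rmin d1 d2) (Rmin (Rmin r (q / 2)) (z / (K1 + K2)))).
    pose proof (Rmin_l d1 d2). pose proof (Rmin_r d1 d2).
    pose proof (Rmin_l (Rmin r (q / 2)) (z / (K1 + K2))).
    pose proof (Rmin_r (Rmin r (q / 2)) (z / (K1 + K2))). unfold e in *. lra. }
  specialize (H1 e nu ltac:(lra) (N1 t Ht)). specialize (H2 e nu ltac:(lra) N0).
  specialize (main' e ltac:(lra)).
  assert ((K1 + K2) * e <= z).
  { apply Rle_trans with ((K1 + K2) * (z / (K1 + K2))); [apply Rmult_le_compat_l; lra|].
    right. field. lra. }
  triangle3 (- (G (gamma t + e * nu)%C - h t))%C (G (c + e * nu)%C - h t0)%C (G (gamma t + e * nu)%C - G (c + e * nu)%C - (t - t0)%R * (g c * l))%C.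
  rewrite Cmod_opp. lra.
Qed.

(** * Corners *)

Lemma left_normal_scal (r : R) (l : C) : 0 < r -> l <> 0%C -> left_normal (r * l) = left_normal l.
Proof.
  intros rp hl. assert (m := proj1 (Cmod_gt_0 l) hl). unfold left_normal.
  rewrite Cmod_scal_pos, RtoC_mult by lra. field.
  split; apply RtoC_neq_0; lra.
Qed.

(** A side of a corner parametrised outwards from the corner [e 0], every chord being within
    relative error [/ 32] of the tangent [l]. The incoming side is reversed to fit this form. *)
Definition arm (e : R -> C) (l : C) (L : R) : Prop :=
  0 < L /\ l <> 0%C /\ forall s t, 0 <= s <= L -> 0 <= t <= L ->
    Cmod (e s - e t - (s - t)%R * l) <= Cmod l / 32 * Rabs (s - t).

Lemma arm_chord (e : R -> C) (l : C) (L s t : R) :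
  arm e l L -> 0 <= s -> s < t -> t <= L ->
  exists al, Cmod al <= / 32 /\ (e t - e s)%C = ((t - s)%R * (l * (1 + al)))%C.
Proof.
  intros (Lp & hl & H) h1 h2 h3. assert (m := proj1 (Cmod_gt_0 l) hl).
  specialize (H t s ltac:(lra) ltac:(lra)). rewrite Rabs_pos_eq in H by lra.
  assert (tC : RtoC (t - s) <> 0%C) by (apply RtoC_neq_0; lra).
  exists ((e t - e s - (t - s)%R * l) / ((t - s)%R * l))%C. split.
  - rewrite Cmod_div, Cmod_scal_pos by (auto using Cmult_neq_0; lra).
    apply Rmult_le_reg_r with ((t - s) * Cmod l); [nra|]. unfold Rdiv.
    rewrite Rmult_assoc, Rinv_l, Rmult_1_r by nra. lra.
  - field. auto.
Qed.

(** The next chord and the position vector from the corner are both close to the direction [l], so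
    their scalar product is not negative. Hence a circle about the corner meets the arm at most
    once. *)
Lemma arm_increasing (e : R -> C) (l : C) (L s t : R) :
  arm e l L -> 0 <= s -> s < t -> t <= L -> Cmod (e s - e 0) < Cmod (e t - e 0).
Proof.
  intros H h1 h2 h3. assert (H' := H). destruct H' as (Lp & hl & _).
  assert (m := proj1 (Cmod_gt_0 l) hl).
  destruct (arm_chord e l L s t H h1 h2 h3) as (be & Cbe & Ebe).
  destruct (Req_dec s 0) as [->|s0].
  { replace (e 0 - e 0)%C with (RtoC 0) by ring. rewrite Cmod_0, Ebe.
    apply Cmod_gt_0. apply Cmult_neq_0; [apply RtoC_neq_0; lra|].
    apply Cmult_neq_0; auto. intros h.
    assert (be = (- (1))%C) by (apply Ceq_minus; rewrite <- h; ring). subst be.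
    rewrite Cmod_m1 in Cbe. lra. }
  destruct (arm_chord e l L 0 s H) as (al & Cal & Eal); [lra|lra|lra|].
  set (x := (e s - e 0)%C) in *. set (d := (e t - e s)%C) in *.
  replace (e t - e 0)%C with (x + d)%C by (unfold x, d; ring).
  assert (P : 0 <= Re d * Re x + Im d * Im x).
  { replace (Re d * Re x + Im d * Im x) with (Re (d * Cconj x))
      by (rewrite re_mult, re_conj, im_conj; ring).
    rewrite Eal, Ebe, !Cmult_conj.
    replace ((t - s)%R * (l * (1 + be)) * (Cconj (s - 0)%R * (Cconj l * Cconj (1 + al))))%C
      with ((l * Cconj l) * ((t - s)%R * (1 + be) * Cconj ((s - 0)%R * (1 + al))))%C
      by (rewrite Cmult_conj; ring).
    rewrite <- Cmod2_conj, re_scal_l. apply Rmult_le_pos; [apply pow2_ge_0|].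
    apply Re_mult_conj_nonneg; lra. }
  assert (d0 : 0 < Cmod d).
  { apply Cmod_gt_0. rewrite Ebe.
    apply Cmult_neq_0; [apply RtoC_neq_0; lra|].
    apply Cmult_neq_0; auto. intros h.
    assert (be = (- (1))%C) by (apply Ceq_minus; rewrite <- h; ring). subst be.
    rewrite Cmod_m1 in Cbe. lra. }
  pose proof (Cmod2_alt x) as E1. pose proof (Cmod2_alt d) as E2. pose proof (Cmod2_alt (x + d)) as E3.
  rewrite re_plus, im_plus in E3.
  apply Rsqr_incrst_0; try apply Cmod_ge_0. unfold Rsqr.
  assert (0 < Cmod d * Cmod d) by (apply Rmult_lt_0_compat; auto). nra.
Qed.

Lemma arm_direction (e : R -> C) (l : C) (L s : R) :
  arm e l L -> 0 < s <= L -> Cmod (left_normal (e s - e 0) - left_normal l) <= / 16.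
Proof.
  intros H Hs. assert (H' := H). destruct H' as (Lp & hl & _).
  assert (m := proj1 (Cmod_gt_0 l) hl).
  destruct (arm_chord e l L 0 s H) as (al & Cal & ->); [lra|lra|lra|].
  assert (n : (l * (1 + al))%C <> 0%C).
  { apply Cmult_neq_0; auto. intros h.
    assert (al = (- (1))%C) by (apply Ceq_minus; rewrite <- h; ring). subst al.
    rewrite Cmod_m1 in Cal. lra. }
  rewrite left_normal_scal by (auto; lra).
  eapply Rle_trans; [apply left_normal_close; auto|].
  replace (l * (1 + al) - l)%C with (l * al)%C by ring. rewrite Cmod_mult.
  apply Rmult_le_reg_r with (Cmod l); auto. unfold Rdiv.
  rewrite Rmult_assoc, Rinv_l, Rmult_1_r by lra. nra.
Qed.

(** Intermediate value property of the distance to the corner: if the radius were never attained,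
    the distance would stay below it all along the arm by real induction. *)
Lemma arm_radius (e : R -> C) (l : C) (L r : R) :
  arm e l L -> 0 < r < Cmod (e L - e 0) -> exists s, 0 < s < L /\ Cmod (e s - e 0) = r.
Proof.
  intros H Hr. assert (H' := H). destruct H' as (Lp & hl & Hs).
  assert (m := proj1 (Cmod_gt_0 l) hl).
  set (F := fun s => Cmod (e s - e 0)).
  assert (lip : forall s t, 0 <= s <= L -> 0 <= t <= L -> F s <= F t + 2 * Cmod l * Rabs (s - t)).
  { intros s t h1 h2. specialize (Hs s t h1 h2). unfold F.
    triangle3 (e t - e 0)%C ((s - t)%R * l)%C (e s - e t - (s - t)%R * l)%C.
    rewrite Cmod_scal. pose proof (Rabs_pos (s - t)). nra. }
  apply NNPP. intros n.
  assert (A : forall s, 0 <= s <= L -> F s < r).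
  { apply real_induction; [lra| | |].
    - unfold F. replace (e 0 - e 0)%C with (RtoC 0) by ring. rewrite Cmod_0. lra.
    - intros t Ht Ft. exists ((r - F t) / (2 * Cmod l)). split; [apply Rdiv_lt_0_compat; lra|].
      intros s h1 h2. pose proof (lip s t ltac:(lra) ltac:(lra)) as Q.
      rewrite Rabs_pos_eq in Q by lra.
      assert (s - t < (r - F t) / (2 * Cmod l)) by lra.
      apply Rmult_lt_compat_l with (r := 2 * Cmod l) in H0; [|lra].
      replace (2 * Cmod l * ((r - F t) / (2 * Cmod l))) with (r - F t) in H0 by (field; lra). lra.
    - intros t Ht IH. destruct (Rlt_dec (F t) r) as [|nl]; auto. exfalso.
      destruct (Req_dec (F t) r) as [E|E].
      + assert (t <> L) by (intros ->; unfold F in E; lra).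
        apply n. exists t. split; auto. lra.
      + set (w := Rmin (t / 2) ((F t - r) / (4 * Cmod l))).
        assert (h1 : 0 < (F t - r) / (4 * Cmod l)) by (apply Rdiv_lt_0_compat; lra).
        assert (w0 : 0 < w) by (apply Rmin_glb_lt; lra).
        assert (w1 : w <= t / 2) by min_le.
        assert (w2 : w <= (F t - r) / (4 * Cmod l)) by min_le.
        pose proof (IH (t - w) ltac:(lra)) as Q. pose proof (lip t (t - w) ltac:(lra) ltac:(lra)) as Q2.
        replace (t - (t - w)) with w in Q2 by ring. rewrite Rabs_pos_eq in Q2 by lra.
        apply Rmult_le_compat_l with (r := 4 * Cmod l) in w2; [|lra].
        replace (4 * Cmod l * ((F t - r) / (4 * Cmod l))) with (F t - r) in w2 by (field; lra). lra. }
  specialize (A L ltac:(lra)). unfold F in A. lra.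
Qed.

Lemma cexp_ne_1 (th : R) : 0 < th < 2 * PI -> cexp (th * Ci) <> 1%C.
Proof.
  intros H E. apply (f_equal Re) in E. unfold cexp, Re, Im, Cmult, Ci, RtoC in E; simpl in E.
  replace (th * 0 - 0 * 1) with 0 in E by ring. replace (th * 1 + 0 * 0) with (2 * (th / 2)) in E by field.
  rewrite exp_0, cos_2a_sin in E.
  assert (0 < sin (th / 2)) by (apply sin_gt_0; lra). nra.
Qed.

Lemma cexp_neg (z : C) : (cexp z * cexp (- z))%C = 1%C.
Proof. rewrite <- cexp_plus. replace (z + - z)%C with (RtoC 0) by ring. apply cexp_0. Qed.

(** A negative angle is shifted by a full turn, so that the arc from [x] to [y] is always traversed
    anticlockwise. *)
Lemma polar_quotient (x y : C) :
  x <> 0%C -> Cmod x = Cmod y -> x <> y ->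
  exists be : R, 0 < be < 2 * PI /\ y = (x * cexp (be * Ci))%C.
Proof.
  intros hx hm hn. assert (m := proj1 (Cmod_gt_0 x) hx). pose proof PI_RGT_0.
  destruct (polar_unit (y / x)%C) as (th & Hth & E).
  { rewrite Cmod_div, <- hm by auto. field. lra. }
  assert (Ey : y = (x * cexp (th * Ci))%C) by (rewrite <- E; field; auto).
  assert (th0 : th <> 0).
  { intros ->. apply hn. rewrite Ey. replace (0 * Ci)%C with (RtoC 0) by ring. rewrite cexp_0. ring. }
  destruct (Rlt_dec 0 th).
  - exists th. split; auto. lra.
  - exists (th + 2 * PI). split; [lra|].
    replace ((th + 2 * PI)%R * Ci)%C with (th * Ci + 2 * PI * Ci)%C
      by (rewrite RtoC_plus, RtoC_mult; ring).
    now rewrite cexp_2PI.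
Qed.

(* For small [th] the rotation of [c + x] about [c] by [sg th] is a displacement in a direction close
   to the normal [l]. *)
Lemma rotation_displacement (x l : C) (sg : R) :
  x <> 0%C -> sg = 1 \/ sg = -1 -> Cmod (left_normal (sg * x) - left_normal l) <= / 8 ->
  forall r, 0 < r -> exists d, 0 < d /\ forall th, 0 < th < d ->
    exists e nu, 0 < e < r /\ Cmod (nu - left_normal l) < / 4 /\
      (x * cexp ((sg * th)%R * Ci) - x)%C = (RtoC e * nu)%C.
Proof.
  intros hx hs Hl r rp. assert (m := proj1 (Cmod_gt_0 x) hx).
  assert (mC : RtoC (Cmod x) <> 0%C) by (apply RtoC_neq_0; lra).
  (* The relative error [/ 16] of [cexp z - 1] against [z], added to the [/ 8] of the hypothesis,
     stays below [/ 4]. *)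
  destruct (cdiff_cexp_0 (/ 16)) as (d & dp & Hd); [lra|].
  exists (Rmin d (r / Cmod x)). split; [apply Rmin_glb_lt; auto; apply Rdiv_lt_0_compat; auto|].
  intros th Hth. pose proof (Rmin_l d (r / Cmod x)). pose proof (Rmin_r d (r / Cmod x)).
  assert (tC : RtoC th <> 0%C) by (apply RtoC_neq_0; lra).
  set (z := ((sg * th)%R * Ci)%C).
  assert (Cz : Cmod z = th).
  { unfold z. rewrite Cmod_mult, Cmod_Ci, Cmod_R, Rmult_1_r, Rabs_mult, (Rabs_pos_eq th) by lra.
    destruct hs as [->| ->]; [rewrite Rabs_pos_eq by lra|rewrite Rabs_left by lra]; ring. }
  assert (Hz : Cmod (cexp z - 1 - z) <= / 16 * th).
  { specialize (Hd z). replace (z - 0)%C with z in Hd by ring. rewrite cexp_0 in Hd.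
    replace (cexp z - 1 - 1 * z)%C with (cexp z - 1 - z)%C in Hd by ring. rewrite Cz in Hd.
    apply Hd. lra. }
  exists (Cmod x * th), ((x / Cmod x) * ((cexp z - 1) / th))%C. split; [|split].
  - split; [nra|]. apply Rmult_lt_reg_r with (/ Cmod x); [now apply Rinv_0_lt_compat|].
    replace (Cmod x * th * / Cmod x) with th by (field; lra). unfold Rdiv in *. lra.
  - assert (Cs : Cmod (sg * x) = Cmod x).
    { rewrite Cmod_scal. destruct hs as [->| ->]; [rewrite Rabs_pos_eq by lra|rewrite Rabs_left by lra]; ring. }
    eapply Rle_lt_trans; [apply Cmod_split with
      (b := ((x / Cmod x) * ((cexp z - 1 - z) / th))%C)
      (c := (left_normal (sg * x) - left_normal l)%C)|].
    + replace (left_normal (sg * x)) with ((x / Cmod x) * (z / th))%C.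
      * field. auto.
      * unfold left_normal, z. rewrite Cs, RtoC_mult. field. auto.
    + rewrite Cmod_mult, !Cmod_div, !Cmod_R, (Rabs_pos_eq (Cmod x)), (Rabs_pos_eq th) by (auto; lra).
      replace (Cmod x / Cmod x) with 1 by (field; lra).
      assert (Cmod (cexp z - 1 - z) / th <= / 16).
      { apply Rmult_le_reg_r with th; [lra|]. unfold Rdiv. rewrite Rmult_assoc, Rinv_l, Rmult_1_r by lra. lra. }
      lra.
  - rewrite RtoC_mult. field. auto.
Qed.

Lemma pdiff_circle (c x : C) (t : R) :
  pdiff (fun th : R => c + x * cexp (th * Ci))%C t (x * cexp (t * Ci) * Ci)%C.
Proof.
  assert (H : pdiff (fun th : R => 0 + th * Ci)%C t Ci) by apply pdiff_linear.
  assert (K := pdiff_comp _ _ _ _ _ H (cdiff_cexp _)). cbv beta in K.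
  apply (pdiff_cmult x) in K. apply (pdiff_plus _ _ _ _ _ (pdiff_const c t)) in K.
  replace (x * cexp (t * Ci) * Ci)%C with (0 + x * (cexp (0 + t * Ci) * Ci))%C.
  - apply pdiff_ext_loc with (3 := K) (e := 1); [lra|]. intros s _. now rewrite Cplus_0_l.
  - rewrite !Cplus_0_l. ring.
Qed.

(* The two sides of a corner are joined inside the region by an arc of a small circle. *)
Lemma corner_jump (gamma : R -> C) (a b : R) (Om : C -> Prop) (G g : C -> C) (h : R -> C)
    (v w : R -> C) (x tm tp y : R) :
  is_component (fun z => ~ trace gamma a b z) Om ->
  (forall s t, a <= s < b -> a <= t < b -> gamma s = gamma t -> s = t) ->
  smooth_piece gamma x tm v -> smooth_piece gamma tp y w -> a <= x -> tm <= b -> a <= tp -> y <= b ->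
  gamma tm = gamma tp ->
  (forall d, 0 < d -> exists r, 0 < r /\ forall t, a <= t <= b -> Cmod (gamma t - gamma tp) < r ->
     tm - d < t <= tm \/ tp <= t < tp + d) ->
  (forall t, x < t < tm -> left_of gamma Om t (v t) /\ boundary_value gamma G t (v t) (h t)) ->
  (forall t, tp < t < y -> left_of gamma Om t (w t) /\ boundary_value gamma G t (w t) (h t)) ->
  (forall z, Om z -> cdiff G z (g z)) ->
  ccont (fun z => Om z \/ trace gamma a b z) g (gamma tp) ->
  forall e d, 0 < e -> 0 < d -> exists t u, tm - d < t < tm /\ tp < u < tp + d /\ Cmod (h u - h t) < e.
Proof.
  intros Hcomp inj Pv Pw ax tmb atp yb Etp Hiso Hv Hw HG Hg e d ep dp.
  set (c := gamma tp) in *.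
  assert (xtm : x < tm) by apply Pv. assert (tpy : tp < y) by apply Pw.
  assert (lv : v tm <> 0%C) by (apply Pv; lra).
  assert (lw : w tp <> 0%C) by (apply Pw; lra).
  assert (mv := proj1 (Cmod_gt_0 _) lv). assert (mw := proj1 (Cmod_gt_0 _) lw).
  destruct (smooth_piece_secant gamma v x tm tm (Cmod (v tm) / 32) Pv) as (dv & dvp & Hdv); [lra|lra|].
  destruct (smooth_piece_secant gamma w tp y tp (Cmod (w tp) / 32) Pw) as (dw & dwp & Hdw); [lra|lra|].
  (* Where the curve closes up, [tp < tm] and both sides may belong to the same piece; half of the
     gap keeps the parameters of the two arms apart. *)
  set (L0 := if Rlt_dec tp tm then (tm - tp) / 2 else 1).
  assert (L0p : 0 < L0) by (unfold L0; destruct Rlt_dec; lra).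
  set (L := Rmin (Rmin (Rmin d dv) dw) (Rmin L0 (Rmin (tm - x) (y - tp))) / 2).
  assert (HL : 0 < L /\ L < d /\ L < dv /\ L < dw /\ L < L0 /\ L < tm - x /\ L < y - tp).
  { assert (0 < Rmin (Rmin (Rmin d dv) dw) (Rmin L0 (Rmin (tm - x) (y - tp))))
      by (repeat apply Rmin_glb_lt; lra).
    pose proof (Rmin_l (Rmin (Rmin d dv) dw) (Rmin L0 (Rmin (tm - x) (y - tp)))).
    pose proof (Rmin_r (Rmin (Rmin d dv) dw) (Rmin L0 (Rmin (tm - x) (y - tp)))).
    pose proof (Rmin_l (Rmin d dv) dw). pose proof (Rmin_r (Rmin d dv) dw).
    pose proof (Rmin_l d dv). pose proof (Rmin_r d dv).
    pose proof (Rmin_l L0 (Rmin (tm - x) (y - tp))). pose proof (Rmin_r L0 (Rmin (tm - x) (y - tp))).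
    pose proof (Rmin_l (tm - x) (y - tp)). pose proof (Rmin_r (tm - x) (y - tp)).
    unfold L. lra. }
  destruct HL as (Lp & Ld & Ldv & Ldw & LL0 & Lx & Ly).
  set (em := fun s => gamma (tm - s)). set (ew := fun s => gamma (tp + s)).
  assert (em0 : em 0 = c) by (unfold em; now rewrite Rminus_0_r).
  assert (ew0 : ew 0 = c) by (unfold ew; now rewrite Rplus_0_r).
  assert (Am : arm em (- v tm)%C L).
  { split; auto. split.
    - intros h0. apply lv. replace (v tm) with (- - v tm)%C by ring. rewrite h0. ring.
    - intros s t Hs Ht. rewrite Cmod_opp. unfold em.
      destruct (Hdv (tm - s) (tm - t)) as [Q _]; try lra; try (apply Rabs_between; lra).
      replace (Rabs (s - t)) with (Rabs ((tm - s) - (tm - t)))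
        by (rewrite Rabs_minus_sym; f_equal; ring).
      eapply Rle_trans; [|apply Q]. right. f_equal. rewrite !RtoC_minus. ring. }
  assert (Aw : arm ew (w tp) L).
  { split; auto. split; auto.
    intros s t Hs Ht. unfold ew.
    destruct (Hdw (tp + s) (tp + t)) as [Q _]; try lra; try (apply Rabs_between; lra).
    replace (tp + s - (tp + t)) with (s - t) in Q by ring. exact Q. }
  destruct (Hiso L Lp) as (r & rp & Hr).
  assert (Hg' : ccont (fun z => Om z \/ trace gamma a b z) g c) by exact Hg.
  destruct (ccont_bounded _ _ _ Hg') as (q & qp & Hq).
  set (M := Cmod (g c) + 1) in *.
  assert (Mp : 0 < M) by (unfold M; pose proof (Cmod_ge_0 (g c)); lra).
  pose proof PI_RGT_0 as PIp.
  (* Small enough to reach both arms, to meet no other part of the curve, to keep [g] below [M], and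
     to make the arc, of length at most [2 * PI * rho], contribute less than [e / 3]. *)
  set (rho := Rmin (Rmin (Rmin r q) (e / 3 / (2 * PI * M)))
    (Rmin (Cmod (em L - em 0)) (Cmod (ew L - ew 0))) / 2).
  assert (m1 : 0 < Cmod (em L - em 0)).
  { pose proof (arm_increasing em _ L 0 L Am ltac:(lra) Lp ltac:(lra)).
    pose proof (Cmod_ge_0 (em 0 - em 0)). lra. }
  assert (m2 : 0 < Cmod (ew L - ew 0)).
  { pose proof (arm_increasing ew _ L 0 L Aw ltac:(lra) Lp ltac:(lra)).
    pose proof (Cmod_ge_0 (ew 0 - ew 0)). lra. }
  assert (m3 : 0 < e / 3 / (2 * PI * M)) by (apply Rdiv_lt_0_compat; nra).
  assert (Hrho : 0 < rho /\ rho < r /\ rho < q /\ rho < e / 3 / (2 * PI * M) /\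
    rho < Cmod (em L - em 0) /\ rho < Cmod (ew L - ew 0)).
  { assert (0 < Rmin (Rmin (Rmin r q) (e / 3 / (2 * PI * M)))
      (Rmin (Cmod (em L - em 0)) (Cmod (ew L - ew 0)))) by (repeat apply Rmin_glb_lt; lra).
    pose proof (Rmin_l (Rmin (Rmin r q) (e / 3 / (2 * PI * M)))
      (Rmin (Cmod (em L - em 0)) (Cmod (ew L - ew 0)))).
    pose proof (Rmin_r (Rmin (Rmin r q) (e / 3 / (2 * PI * M)))
      (Rmin (Cmod (em L - em 0)) (Cmod (ew L - ew 0)))).
    pose proof (Rmin_l (Rmin r q) (e / 3 / (2 * PI * M))).
    pose proof (Rmin_r (Rmin r q) (e / 3 / (2 * PI * M))).
    pose proof (Rmin_l r q). pose proof (Rmin_r r q).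
    pose proof (Rmin_l (Cmod (em L - em 0)) (Cmod (ew L - ew 0))).
    pose proof (Rmin_r (Cmod (em L - em 0)) (Cmod (ew L - ew 0))).
    unfold rho. lra. }
  destruct Hrho as (rho0 & rhor & rhoq & rhoe & rhom & rhow).
  destruct (arm_radius em _ L rho Am) as (sm & Hsm & Em); [lra|].
  destruct (arm_radius ew _ L rho Aw) as (sw & Hsw & Ew); [lra|].
  set (t := tm - sm). set (u := tp + sw).
  exists t, u. split; [unfold t; lra|]. split; [unfold u; lra|].
  set (A := (gamma u - c)%C). set (B := (gamma t - c)%C).
  assert (CA : Cmod A = rho) by (rewrite <- Ew; unfold A; rewrite ew0; reflexivity).
  assert (CB : Cmod B = rho) by (rewrite <- Em; unfold B; rewrite em0; reflexivity).
  assert (A0 : A <> 0%C) by (apply Cmod_gt_0; lra).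
  assert (B0 : B <> 0%C) by (apply Cmod_gt_0; lra).
  assert (AB : A <> B).
  { intros E. assert (gu : gamma u = gamma t).
    { apply Ceq_minus. replace (gamma u - gamma t)%C with (A - B)%C by (unfold A, B; ring).
      rewrite E. ring. }
    apply inj in gu; [|unfold u; lra|unfold t; lra].
    unfold t, u, L0 in *. destruct (Rlt_dec tp tm); lra. }
  (* The arc turns anticlockwise from the outgoing side to the incoming one and so sweeps the sector
     to the left of both. *)
  destruct (polar_quotient A B A0 ltac:(congruence) AB) as (be & Hbe & EB).
  set (p := fun th : R => (c + A * cexp (th * Ci))%C).
  assert (Cp : forall th, Cmod (p th - c) = rho).
  { intros th. unfold p. replace (c + A * cexp (th * Ci) - c)%C with (A * cexp (th * Ci))%C by ring.
    rewrite Cmod_mult, CA, Cmod_cexp. replace (Re (th * Ci)) with 0; [rewrite exp_0; ring|].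
    unfold Re, Cmult, Ci, RtoC; simpl. ring. }
  assert (uniq : forall e' l s s', arm e' l L -> 0 <= s <= L -> 0 <= s' <= L ->
    Cmod (e' s - e' 0) = Cmod (e' s' - e' 0) -> s = s').
  { intros e' l s s' Ha h1 h2 E. destruct (Rtotal_order s s') as [k|[k|k]]; auto.
    - pose proof (arm_increasing e' l L s s' Ha ltac:(lra) k ltac:(lra)). lra.
    - pose proof (arm_increasing e' l L s' s Ha ltac:(lra) k ltac:(lra)). lra. }
  (* The circle meets the curve only on the two arms, once on each, and these two points are the
     ends of the arc. *)
  assert (off : forall th, 0 < th < be -> ~ trace gamma a b (p th)).
  { intros th Hth (k & Hk & E).
    assert (Ck : Cmod (gamma k - c) = rho) by (rewrite <- E; apply Cp).
    destruct (Hr k Hk) as [Hk'|Hk']; [lra| |].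
    - assert (s' : tm - k = sm).
      { apply (uniq em (- v tm)%C); auto; try lra. rewrite Em, em0. unfold em.
        replace (tm - (tm - k)) with k by ring. auto. }
      assert (kt : k = t) by (unfold t; lra). subst k.
      assert (EE : (A * cexp (th * Ci))%C = B).
      { unfold B. rewrite <- E. unfold p. ring. }
      rewrite EB in EE.
      apply (cexp_ne_1 (be - th)); [lra|].
      replace ((be - th)%R * Ci)%C with (be * Ci + - (th * Ci))%C by (rewrite RtoC_minus; ring).
      rewrite cexp_plus, <- (cexp_neg (th * Ci)). f_equal.
      apply Ceq_minus. apply Ceq_minus in EE.
      replace (A * cexp (th * Ci) - A * cexp (be * Ci))%C
        with (- (A * (cexp (be * Ci) - cexp (th * Ci))))%C in EE by ring.
      apply NNPP. intros nz. apply (Cmult_neq_0 A _ A0 nz).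
      replace (A * (cexp (be * Ci) - cexp (th * Ci)))%C
        with (- - (A * (cexp (be * Ci) - cexp (th * Ci))))%C by ring.
      rewrite EE. ring.
    - assert (s' : k - tp = sw).
      { apply (uniq ew (w tp)); auto; try lra. rewrite Ew, ew0. unfold ew.
        replace (tp + (k - tp)) with k by ring. auto. }
      assert (ku : k = u) by (unfold u; lra). subst k.
      assert (EE : (A * cexp (th * Ci))%C = A).
      { unfold A at 2. rewrite <- E. unfold p. ring. }
      apply (cexp_ne_1 th); [lra|]. apply Ceq_minus. apply Ceq_minus in EE.
      replace (A * cexp (th * Ci) - A)%C with (A * (cexp (th * Ci) - 1))%C in EE by ring.
      apply NNPP. intros nz. now apply (Cmult_neq_0 A _ A0 nz). }
  assert (wu : w u <> 0%C) by (apply Pw; unfold u; lra).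
  assert (vt : v t <> 0%C) by (apply Pv; unfold t; lra).
  (* [/ 16] for the chord against the tangent at the corner, and [/ 16] for the tangent at [u]
     against the one at the corner. *)
  assert (dirA : Cmod (left_normal (1 * A) - left_normal (w u)) <= / 8).
  { replace (1 * A)%C with A by ring.
    eapply Rle_trans; [apply Cmod_split with (b := (left_normal A - left_normal (w tp))%C)
      (c := (- (left_normal (w u) - left_normal (w tp)))%C); ring|].
    rewrite Cmod_opp.
    pose proof (arm_direction ew (w tp) L sw Aw ltac:(lra)) as Q1. rewrite ew0 in Q1.
    change (Cmod (left_normal A - left_normal (w tp)) <= / 16) in Q1.
    destruct (Hdw u u) as [_ Q2]; try (unfold u; lra); try (apply Rabs_between; unfold u; lra).
    pose proof (left_normal_close (w u) (w tp) wu lw) as Q3.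
    assert (2 * Cmod (w u - w tp) / Cmod (w tp) <= / 16); [|lra].
    apply Rmult_le_reg_r with (Cmod (w tp)); auto. unfold Rdiv.
    rewrite Rmult_assoc, Rinv_l, Rmult_1_r by lra. lra. }
  assert (dirB : Cmod (left_normal ((-1)%R * B) - left_normal (v t)) <= / 8).
  { assert (on : forall z, left_normal (- z) = (- left_normal z)%C).
    { intros z. unfold left_normal, Cdiv. rewrite Cmod_opp. ring. }
    replace ((-1)%R * B)%C with (- B)%C.
    2: { replace (RtoC (-1)) with (- RtoC 1)%C by (rewrite <- RtoC_opp; f_equal; ring). ring. }
    triangle (left_normal (- B) - left_normal (v tm))%C (- (left_normal (v t) - left_normal (v tm)))%C.
    rewrite Cmod_opp.
    pose proof (arm_direction em (- v tm) L sm Am ltac:(lra)) as Q1. rewrite em0, on in Q1.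
    change (Cmod (left_normal B - - left_normal (v tm)) <= / 16) in Q1.
    rewrite on. replace (- left_normal B - left_normal (v tm))%C
      with (- (left_normal B - - left_normal (v tm)))%C by ring. rewrite Cmod_opp.
    destruct (Hdv t t) as [_ Q2]; try (unfold t; lra); try (apply Rabs_between; unfold t; lra).
    pose proof (left_normal_close (v t) (v tm) vt lv) as Q3.
    assert (2 * Cmod (v t - v tm) / Cmod (v tm) <= / 16); [|lra].
    apply Rmult_le_reg_r with (Cmod (v tm)); auto. unfold Rdiv.
    rewrite Rmult_assoc, Rinv_l, Rmult_1_r by lra. lra. }
  destruct (Hw u) as [(rw & rwp & Lw) (Kw & bw & Kwp & bwp & Bw)]; [unfold u; lra|].
  destruct (Hv t) as [(rv & rvp & Lv) (Kv & bv & Kvp & bvp & Bv)]; [unfold t; lra|].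
  assert (start : exists th1, 0 < th1 < be / 2 /\ Om (p th1) /\ Cmod (G (p th1) - h u) < e / 3).
  { destruct (rotation_displacement A (w u) 1 A0 (or_introl eq_refl) dirA
      (Rmin rw (Rmin bw (e / 3 / Kw)))) as (dd & ddp & Hdd).
    { repeat apply Rmin_glb_lt; auto. apply Rdiv_lt_0_compat; lra. }
    set (th1 := Rmin dd (be / 2) / 2).
    assert (0 < Rmin dd (be / 2)) by (apply Rmin_glb_lt; lra).
    pose proof (Rmin_l dd (be / 2)). pose proof (Rmin_r dd (be / 2)).
    destruct (Hdd th1) as (ee & nu & Hee & Hnu & E); [unfold th1; lra|].
    rewrite Rmult_1_l in E.
    assert (Ep : p th1 = (gamma u + ee * nu)%C).
    { rewrite <- E. unfold p, A. ring. }
    pose proof (Rmin_l rw (Rmin bw (e / 3 / Kw))). pose proof (Rmin_r rw (Rmin bw (e / 3 / Kw))).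
    pose proof (Rmin_l bw (e / 3 / Kw)). pose proof (Rmin_r bw (e / 3 / Kw)).
    exists th1. split; [unfold th1; lra|]. rewrite Ep. split.
    - apply Lw; auto; [rewrite Rminus_eq_0, Rabs_R0; auto|lra].
    - eapply Rle_lt_trans; [apply Bw; auto; lra|].
      apply Rlt_le_trans with (Kw * (e / 3 / Kw)); [apply Rmult_lt_compat_l; lra|].
      right. field. lra. }
  (* Only the estimate is proved at this end; membership in [Om] reaches it along the arc from the
     start, through [Op]. *)
  assert (finish : exists th2, 0 < th2 < be / 2 /\ Cmod (G (p (be - th2)) - h t) < e / 3).
  { destruct (rotation_displacement B (v t) (-1) B0 (or_intror eq_refl) dirB
      (Rmin rv (Rmin bv (e / 3 / Kv)))) as (dd & ddp & Hdd).
    { repeat apply Rmin_glb_lt; auto. apply Rdiv_lt_0_compat; lra. }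
    set (th1 := Rmin dd (be / 2) / 2).
    assert (0 < Rmin dd (be / 2)) by (apply Rmin_glb_lt; lra).
    pose proof (Rmin_l dd (be / 2)). pose proof (Rmin_r dd (be / 2)).
    destruct (Hdd th1) as (ee & nu & Hee & Hnu & E); [unfold th1; lra|].
    assert (Ep : p (be - th1) = (gamma t + ee * nu)%C).
    { rewrite <- E. unfold p.
      replace ((be - th1)%R * Ci)%C with (be * Ci + (-1 * th1)%R * Ci)%C.
      - rewrite cexp_plus, Cmult_assoc, <- EB. unfold B. ring.
      - rewrite <- Cmult_plus_distr_r, <- RtoC_plus. f_equal. f_equal. ring. }
    pose proof (Rmin_l rv (Rmin bv (e / 3 / Kv))). pose proof (Rmin_r rv (Rmin bv (e / 3 / Kv))).
    pose proof (Rmin_l bv (e / 3 / Kv)). pose proof (Rmin_r bv (e / 3 / Kv)).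
    exists th1. split; [unfold th1; lra|]. rewrite Ep.
    eapply Rle_lt_trans; [apply Bv; auto; lra|].
    apply Rlt_le_trans with (Kv * (e / 3 / Kv)); [apply Rmult_lt_compat_l; lra|].
    right. field. lra. }
  destruct start as (th1 & Hth1 & O1 & S1). destruct finish as (th2 & Hth2 & S2).
  assert (Op : forall th, th1 <= th <= be - th2 -> Om (p th)).
  { apply (component_path _ _ p th1 (be - th2) th1 Hcomp); auto; [lra| |].
    - intros th _. eapply pdiff_pcont. apply pdiff_circle.
    - intros th Hth. apply off. lra. }
  assert (dGp : forall th, th1 <= th <= be - th2 ->
    pdiff (fun th => G (p th)) th (g (p th) * (A * cexp (th * Ci) * Ci))%C).
  { intros th Hth. apply (pdiff_comp G p); [apply pdiff_circle|]. apply HG, Op. auto. }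
  assert (arc : Cmod (G (p (be - th2)) - G (p th1)) <= M * rho * (be - th2 - th1)).
  { apply (mvt_bound (fun th => G (p th)) (fun th => g (p th) * (A * cexp (th * Ci) * Ci))%C);
      [lra| | |].
    - intros th Hth. eapply pdiff_pcont. now apply dGp.
    - intros th Hth. apply dGp. lra.
    - intros th Hth. rewrite Cmod_mult. apply Rmult_le_compat; try apply Cmod_ge_0.
      + apply Hq; [left; apply Op; lra|]. rewrite Cp. auto.
      + rewrite Cmod_mult, Cmod_Ci, Rmult_1_r. rewrite <- (Cp th). right. f_equal. unfold p. ring. }
  assert (arc' : M * rho * (be - th2 - th1) < e / 3).
  { apply Rlt_trans with (M * rho * (2 * PI)); [apply Rmult_lt_compat_l; nra|].
    apply Rmult_lt_compat_l with (r := 2 * PI * M) in rhoe; [|nra].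
    replace (2 * PI * M * (e / 3 / (2 * PI * M))) with (e / 3) in rhoe by (field; lra). lra. }
  rewrite Cmod_sym in arc.
  triangle3 (- (G (p th1) - h u))%C (G (p th1) - G (p (be - th2)%R))%C (G (p (be - th2)%R) - h t)%C.
  rewrite Cmod_opp. lra.
Qed.

(** * Cauchy's theorem up to the boundary *)

(* [h] differs by a constant from the indefinite integral of [w], so it has limits at both ends. *)
Lemma primitive_end_values (w h : R -> C) (x y : R) :
  x < y -> (forall t, x <= t <= y -> pcont (fun s => x <= s <= y) w t) ->
  (forall t, x < t < y -> pdiff h t (w t)) ->
  exists al om, is_RIntC w x y (om - al)%C /\
    forall e, 0 < e -> exists d, 0 < d /\
      (forall t, x < t < y -> t < x + d -> Cmod (h t - al) < e) /\
      (forall t, x < t < y -> y - d < t -> Cmod (h t - om) < e).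
Proof.
  intros xy Hw Hh.
  set (u := fun t => w (clamp x y t)).
  assert (Hu : forall t, pcont (fun _ => True) u t) by (apply pcont_clamp; auto; lra).
  set (F := fun t => RIntC u x t).
  assert (dF : forall t, pdiff F t (u t)).
  { intros t. apply pdiff_of_is_derive. apply is_derive_RInt with x.
    - apply filter_forall. intros z.
      apply (RInt_correct (V := C_R_CompleteNormedModule)), ex_RInt_continuous.
      intros s _. now apply continuous_of_pcont.
    - now apply continuous_of_pcont. }
  set (k := (h ((x + y) / 2)%R + -(1) * F ((x + y) / 2)%R)%C).
  assert (cst : forall t, x < t < y -> h t = (F t + k)%C).
  { assert (d0 : forall t, x < t < y -> pdiff (fun t => h t + -(1) * F t)%C t 0).
    { intros t Ht. replace (RtoC 0) with (w t + -(1) * u t)%C.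
      - apply pdiff_plus; auto. now apply pdiff_cmult.
      - unfold u. rewrite clamp_id by lra. ring. }
    assert (E : forall s t, x < s < y -> x < t < y -> s <= t ->
      (h t + -(1) * F t)%C = (h s + -(1) * F s)%C).
    { intros s t Hs Ht st. apply (pdiff_zero_const (fun t => h t + -(1) * F t)%C); auto.
      intros r Hr. apply d0. lra. }
    intros t Ht. assert (K : (h t + -(1) * F t)%C = k).
    { destruct (Rle_dec t ((x + y) / 2)) as [c|c].
      - symmetry. apply (E t); lra.
      - apply (E ((x + y) / 2)); lra. }
    rewrite <- K. ring. }
  exists (F x + k)%C, (F y + k)%C. split.
  - replace (F y + k - (F x + k))%C with (F y - F x)%C by ring.
    apply is_RIntC_ftc; auto.
    + intros t Ht. eapply pdiff_pcont. apply dF.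
    + intros t Ht. replace (w t) with (u t); auto. unfold u. now rewrite clamp_id by lra.
  - intros e ep.
    destruct (pdiff_pcont F x _ (fun _ => True) (dF x) e ep) as (d1 & p1 & H1).
    destruct (pdiff_pcont F y _ (fun _ => True) (dF y) e ep) as (d2 & p2 & H2).
    exists (Rmin d1 d2). pose proof (Rmin_l d1 d2). pose proof (Rmin_r d1 d2).
    split; [apply Rmin_glb_lt; auto|]. split.
    + intros t Ht Htd. rewrite cst by auto. replace (F t + k - (F x + k))%C with (F t - F x)%C by ring.
      apply H1; auto. apply Rabs_between. lra.
    + intros t Ht Htd. rewrite cst by auto. replace (F t + k - (F y + k))%C with (F t - F y)%C by ring.
      apply H2; auto. apply Rabs_between. lra.
Qed.

Lemma isolated_corner (gamma : R -> C) (a b : R) (t0 d : R) :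
  simple_closed gamma a b ->
  (forall t, a <= t <= b -> pcont (fun s => a <= s <= b) gamma t) -> a < t0 < b -> 0 < d ->
  exists r, 0 < r /\ forall t, a <= t <= b -> Cmod (gamma t - gamma t0) < r ->
    t0 - d < t <= t0 \/ t0 <= t < t0 + d.
Proof.
  intros Hs Hc Ht0 dp. destruct (curve_separation gamma a b t0 d Hs Hc Ht0 dp) as (r & rp & Hr).
  exists r. split; auto. intros t Ht Hlt.
  destruct (Rlt_dec (Rabs (t - t0)) d) as [k|k].
  - apply Rabs_def2 in k. lra.
  - specialize (Hr t Ht ltac:(lra)). lra.
Qed.

(** The curve arrives at its base point with parameter [b] and leaves it with parameter [a], so the
    nearby parameters lie at opposite ends of the interval. *)
Lemma isolated_base_point (gamma : R -> C) (a b d : R) :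
  simple_closed gamma a b ->
  (forall t, a <= t <= b -> pcont (fun s => a <= s <= b) gamma t) -> 0 < d ->
  exists r, 0 < r /\ forall t, a <= t <= b -> Cmod (gamma t - gamma a) < r ->
    b - d < t <= b \/ a <= t < a + d.
Proof.
  intros (ab & cl & inj) Hc dp.
  destruct (Rle_dec (a + d) (b - d)) as [k|k].
  - destruct (path_distance gamma (gamma a) (a + d) (b - d)) as (r & rp & Hr); auto.
    + intros t Ht. apply pcont_mono with (fun s => a <= s <= b); [intros; lra|apply Hc; lra].
    + intros t Ht E. apply inj in E; lra.
    + exists r. split; auto. intros t Ht Hlt. apply NNPP. intros n.
      specialize (Hr t ltac:(lra)). lra.
  - exists 1. split; [lra|]. intros t Ht _. lra.
Qed.

(** Piece [k] contributes the difference [om k - al k] of the end values of [h]. Agreement at the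
    corners makes the sum telescope, and agreement at the base point closes it to 0. *)
Lemma cauchy_up_to_boundary (gamma : R -> C) (a b : R) (N : nat) (s : nat -> R) (v : nat -> R -> C)
    (Om : C -> Prop) (f g : C -> C) :
  curve_data gamma a b N s v -> is_component (fun z => ~ trace gamma a b z) Om ->
  (forall i t, (i < N)%nat -> s i < t < s (S i) -> left_of gamma Om t (v i t)) ->
  disk_bijection Om f -> holomorphic_on Om g ->
  (forall t, a <= t <= b -> ccont (fun z => Om z \/ trace gamma a b z) g (gamma t)) ->
  is_RIntC (fun t => g (gamma t) * speed gamma N s t)%C a b (RtoC 0).
Proof.
  intros CD Hcomp Hleft Hf Hg Hgc. assert (CD' := CD). destruct CD' as [Hs Hc Hr].
  assert (Hs' := Hs). destruct Hs' as (ab & cl & inj).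
  assert (Ho : Copen Om).
  { apply (component_open (fun z => ~ trace gamma a b z)); auto. now apply trace_complement_open. }
  destruct (holomorphic_primitive Om f g Ho Hf Hg) as [G HG].
  assert (Hs0 := proj1 Hr). assert (HsN := proj1 (proj2 Hr)). assert (Hsi := proj2 (proj2 Hr)).
  assert (within := fun i => regular_within gamma a b N s v i Hr).
  assert (Hgc1 : forall t, a <= t <= b -> ccont (fun w => Om w \/ w = gamma t) g (gamma t)).
  { intros t Ht e ep. destruct (Hgc t Ht e ep) as (d & dp & Hd). exists d. split; auto.
    intros w [O| ->] Hw; apply Hd; auto. right. exists t. auto. }
  (* Stated through [velocity], which does not mention the piece, so that one function serves for
     all pieces. *)
  set (h := fun t => epsilon (inhabits (RtoC 0)) (fun k => boundary_value gamma G t (velocity gamma t) k)).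
  assert (Hh : forall i t, (i < N)%nat -> s i < t < s (S i) -> boundary_value gamma G t (v i t) (h t)).
  { intros i t Hi Ht. destruct (within i Hi).
    rewrite <- (proj2 (speed_piece gamma a b N s v i t Hr Hi Ht)). unfold h. apply epsilon_spec.
    rewrite (proj2 (speed_piece gamma a b N s v i t Hr Hi Ht)).
    apply (boundary_value_exists gamma Om G g); auto.
    - apply (Hsi i Hi). lra.
    - apply Hgc1. lra. }
  assert (Dh : forall i t, (i < N)%nat -> s i < t < s (S i) -> pdiff h t (g (gamma t) * v i t)%C).
  { intros i t Hi Ht. destruct (within i Hi).
    apply (boundary_value_diff gamma (v i) Om G g h (s i) (s (S i))); auto. apply Hgc1. lra. }
  assert (Hpc : forall t, a <= t <= b -> pcont (fun u => a <= u <= b) (fun t => g (gamma t)) t).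
  { intros t Ht. apply pcont_comp with (fun z => Om z \/ trace gamma a b z); auto.
    intros u Hu. right. exists u. auto. }
  assert (ends : forall i, exists p : C * C, (i < N)%nat ->
    is_RIntC (fun t => g (gamma t) * v i t)%C (s i) (s (S i)) (snd p - fst p)%C /\
    forall e, 0 < e -> exists d, 0 < d /\
      (forall t, s i < t < s (S i) -> t < s i + d -> Cmod (h t - fst p) < e) /\
      (forall t, s i < t < s (S i) -> s (S i) - d < t -> Cmod (h t - snd p) < e)).
  { intros i. destruct (Nat.lt_ge_cases i N) as [Hi|Hi]; [|exists (RtoC 0, RtoC 0); lia].
    destruct (within i Hi).
    destruct (primitive_end_values (fun t => g (gamma t) * v i t)%C h (s i) (s (S i))) as (al & om & H1 & H2).
    - apply (Hsi i Hi).
    - intros t Ht. apply pcont_mult.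
      + apply pcont_mono with (fun u => a <= u <= b); [intros; lra|apply Hpc; lra].
      + now apply (Hsi i Hi).
    - auto.
    - exists (al, om). intros _. split; auto. }
  set (al := fun i => fst (proj1_sig (constructive_indefinite_description _ (ends i)))).
  set (om := fun i => snd (proj1_sig (constructive_indefinite_description _ (ends i)))).
  assert (Hends : forall i, (i < N)%nat ->
    is_RIntC (fun t => g (gamma t) * v i t)%C (s i) (s (S i)) (om i - al i)%C /\
    forall e, 0 < e -> exists d, 0 < d /\
      (forall t, s i < t < s (S i) -> t < s i + d -> Cmod (h t - al i) < e) /\
      (forall t, s i < t < s (S i) -> s (S i) - d < t -> Cmod (h t - om i) < e)).
  { intros i Hi. unfold al, om. destruct constructive_indefinite_description as [p Hp]. exact (Hp Hi). }
  clearbody al om. clear ends.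
  (* The end values are limits of [h], and [corner_jump] supplies parameters arbitrarily near the
     two ends at which [h] differs by less than [e / 3]. *)
  assert (glue : forall i j, (i < N)%nat -> (j < N)%nat -> gamma (s (S i)) = gamma (s j) ->
    (forall d, 0 < d -> exists r, 0 < r /\ forall t, a <= t <= b -> Cmod (gamma t - gamma (s j)) < r ->
       s (S i) - d < t <= s (S i) \/ s j <= t < s j + d) -> om i = al j).
  { intros i j Hi Hj Eg Hiso. symmetry. apply Ceq_minus, Cmod_0_eq. intros e ep.
    destruct (Hends i Hi) as [_ Ei]. destruct (Hends j Hj) as [_ Ej].
    destruct (Ei (e / 3)) as (di & dip & _ & Hdi); [lra|].
    destruct (Ej (e / 3)) as (dj & djp & Hdj & _); [lra|].
    destruct (within i Hi). destruct (within j Hj).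
    assert (lti : s i < s (S i)) by apply (Hsi i Hi). assert (ltj : s j < s (S j)) by apply (Hsi j Hj).
    set (d := Rmin (Rmin di dj) (Rmin (s (S i) - s i) (s (S j) - s j))).
    assert (dp : 0 < d) by (repeat apply Rmin_glb_lt; lra).
    assert (d1 : d <= di) by min_le.
    assert (d2 : d <= dj) by min_le.
    assert (d3 : d <= s (S i) - s i) by min_le.
    assert (d4 : d <= s (S j) - s j) by min_le.
    destruct (corner_jump gamma a b Om G g h (v i) (v j) (s i) (s (S i)) (s j) (s (S j)))
      with (e := e / 3) (d := d) as (t & u & Ht & Hu & Hj'); auto; try lra.
    - apply Hgc. lra.
    - specialize (Hdi t ltac:(lra) ltac:(lra)). specialize (Hdj u ltac:(lra) ltac:(lra)).
      triangle3 (- (h u - al j))%C (h u - h t)%C (h t - om i)%C. rewrite Cmod_opp. lra. }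
  assert (mono := fun i j => regular_mono gamma a b N s v i j Hr).
  assert (step : forall k, (k < N)%nat ->
    is_RIntC (fun t => g (gamma t) * speed gamma N s t)%C a (s (S k)) (om k - al 0%nat)%C).
  { assert (piece : forall k, (k < N)%nat ->
      is_RIntC (fun t => g (gamma t) * speed gamma N s t)%C (s k) (s (S k)) (om k - al k)%C).
    { intros k Hk. apply is_RInt_ext with (fun t => g (gamma t) * v k t)%C; [|now apply Hends].
      assert (s k < s (S k)) by apply (Hsi k Hk).
      rewrite Rmin_left, Rmax_right by lra. intros t Ht.
      now rewrite (proj1 (speed_piece gamma a b N s v k t Hr Hk Ht)). }
    induction k as [|k IH]; intros Hk.
    - rewrite <- Hs0. auto.
    - assert (E : om k = al (S k)).
      { apply glue; [lia|lia|reflexivity|]. intros d dp. apply isolated_corner; auto.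
        rewrite <- Hs0 at 1. rewrite <- HsN. split.
        - apply Rle_lt_trans with (s k); [apply mono; lia|apply (Hsi k); lia].
        - apply Rlt_le_trans with (s (S (S k))); [apply (Hsi (S k)); lia|apply mono; lia]. }
      replace (om (S k) - al 0%nat)%C
        with (plus (G := C_R_NormedModule) (om k - al 0%nat)%C (om (S k) - al (S k))%C).
      + apply (is_RInt_Chasles (V := C_R_NormedModule)) with (s (S k)); [apply IH; lia|auto].
      + change plus with Cplus. rewrite E. eqC. ring. }
  assert (N0 : (0 < N)%nat).
  { destruct N; [|lia]. rewrite Hs0 in HsN. lra. }
  pose proof (step (N - 1)%nat ltac:(lia)) as I.
  replace (S (N - 1)) with N in I by lia. rewrite HsN in I.
  rewrite (glue (N - 1)%nat 0%nat) in I.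
  - replace (al 0%nat - al 0%nat)%C with (RtoC 0) in I by ring. exact I.
  - lia.
  - lia.
  - replace (S (N - 1)) with N by lia. rewrite HsN, Hs0. auto.
  - replace (S (N - 1)) with N by lia. rewrite HsN, Hs0. intros d dp.
    now apply isolated_base_point.
Qed.

(** * The Riemann map on the boundary *)

(** Corners are reached as well: a parameter inside an adjacent piece is chosen first, then a short
    step along its left normal. *)
Lemma interior_adherent (gamma : R -> C) (a b : R) (N : nat) (s : nat -> R) (v : nat -> R -> C)
    (Om : C -> Prop) (t r : R) :
  curve_data gamma a b N s v ->
  (forall i t, (i < N)%nat -> s i < t < s (S i) -> left_of gamma Om t (v i t)) ->
  a <= t <= b -> 0 < r -> exists w, Om w /\ Cmod (w - gamma t) < r.
Proof.
  intros [(ab & _) Hc Hr] Hleft Ht rp.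
  destruct (Hc t Ht (r / 2)) as (d & dp & Hd); [lra|].
  assert (Hs0 := proj1 Hr). assert (HsN := proj1 (proj2 Hr)). assert (Hsi := proj2 (proj2 Hr)).
  assert (N0 : (0 < N)%nat) by (destruct N; [rewrite Hs0 in HsN; lra|lia]).
  assert (near : exists i u, (i < N)%nat /\ s i < u < s (S i) /\ Rabs (u - t) < d).
  { destruct (regular_cases gamma a b N s v t Hr Ht) as [(i & Hi & Hit)|(i & Hi & ->)].
    - exists i, t. rewrite Rminus_eq_0, Rabs_R0. auto.
    - destruct (Nat.eq_dec i N) as [->|n].
      + assert (lt : s (N - 1)%nat < s (S (N - 1))) by (apply (Hsi (N - 1)%nat); lia).
        replace (S (N - 1)) with N in lt by lia.
        assert (0 < Rmin d (s N - s (N - 1)%nat)) by (apply Rmin_glb_lt; lra).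
        pose proof (Rmin_l d (s N - s (N - 1)%nat)). pose proof (Rmin_r d (s N - s (N - 1)%nat)).
        exists (N - 1)%nat, (s N - Rmin d (s N - s (N - 1)%nat) / 2).
        replace (S (N - 1)) with N by lia. split; [lia|]. split; [lra|]. apply Rabs_between. lra.
      + assert (lt : s i < s (S i)) by (apply (Hsi i); lia).
        assert (0 < Rmin d (s (S i) - s i)) by (apply Rmin_glb_lt; lra).
        pose proof (Rmin_l d (s (S i) - s i)). pose proof (Rmin_r d (s (S i) - s i)).
        exists i, (s i + Rmin d (s (S i) - s i) / 2).
        split; [lia|]. split; [lra|]. apply Rabs_between. lra. }
  destruct near as (i & u & Hi & Hu & Hut).
  destruct (regular_within gamma a b N s v i Hr Hi).
  destruct (Hleft i u Hi Hu) as (q & qp & Hq).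
  assert (l0 : v i u <> 0%C) by (apply (Hsi i Hi); lra).
  set (e := Rmin q (r / 2) / 2).
  assert (0 < Rmin q (r / 2)) by (apply Rmin_glb_lt; lra).
  pose proof (Rmin_l q (r / 2)). pose proof (Rmin_r q (r / 2)).
  exists (gamma u + e * left_normal (v i u))%C. split.
  - apply Hq; [rewrite Rminus_eq_0, Rabs_R0; auto|unfold e; lra|].
    replace (left_normal (v i u) - left_normal (v i u))%C with (RtoC 0) by ring. rewrite Cmod_0. lra.
  - specialize (Hd u ltac:(lra) Hut).
    triangle (gamma u - gamma t)%C (e * left_normal (v i u))%C.
    rewrite Cmod_scal_pos, Cmod_left_normal by (auto; unfold e; lra). unfold e. lra.
Qed.

(** If [Cmod (f c) < 1], then [f c = f x] with [x] inside, and every value close to [f c] is taken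
    close to [x]. By injectivity the interior points near [c] would then also lie near [x], which is
    at a positive distance from [c]. *)
Lemma disk_bijection_boundary (Om E : C -> Prop) (f : C -> C) (c : C) :
  Copen Om -> disk_bijection Om f -> ~ Om c -> (forall w, Om w -> E w) -> ccont E f c ->
  (forall r, 0 < r -> exists w, Om w /\ Cmod (w - c) < r) -> Cmod (f c) = 1.
Proof.
  intros Ho Hf nc HE Hc Hadh. assert (Hf' := Hf). destruct Hf' as (_ & Hb & Hi & Hs).
  apply Rle_antisym.
  - apply le_epsilon. intros e ep. destruct (Hc e ep) as (d & dp & Hd).
    destruct (Hadh d dp) as (w & Ow & Hw). specialize (Hd w (HE w Ow) Hw). specialize (Hb w Ow).
    rewrite Cmod_sym in Hd.
    triangle (f w) (f c - f w)%C. lra.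
  - apply Rnot_lt_le. intros lt. destruct (Hs (f c) lt) as (x & Ox & Ex).
    assert (xc : 0 < Cmod (x - c)).
    { apply Cmod_gt_0. intros h. apply Ceq_minus in h. subst x. auto. }
    destruct (disk_bijection_open Om f x (Cmod (x - c) / 2) Ho Hf Ox) as (d & dp & Hd); [lra|].
    destruct (Hc d dp) as (d' & dp' & Hd').
    destruct (Hadh (Rmin d' (Cmod (x - c) / 2))) as (w & Ow & Hw); [apply Rmin_glb_lt; lra|].
    pose proof (Rmin_l d' (Cmod (x - c) / 2)). pose proof (Rmin_r d' (Cmod (x - c) / 2)).
    rewrite <- Ex in Hd'. destruct (Hd (f w)) as (w' & Ow' & Hw' & E'); [apply Hd'; auto; lra|].
    apply Hi in E'; auto. subst w'.
    assert (Cmod (x - c) <= Cmod (x - w) + Cmod (w - c)) by (apply Cmod_split; ring).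
    rewrite (Cmod_sym x w) in H1. lra.
Qed.

Lemma ccont_mult (E : C -> Prop) (p q : C -> C) (t : C) :
  ccont E p t -> ccont E q t -> ccont E (fun s => p s * q s)%C t.
Proof.
  intros Hp Hq e ep.
  pose proof (Cmod_ge_0 (p t)) as hp. pose proof (Cmod_ge_0 (q t)) as hq.
  set (K := Cmod (p t) + Cmod (q t) + 1).
  assert (K0 : 0 < e / K) by (apply Rdiv_lt_0_compat; unfold K; lra).
  assert (d0 : 0 < Rmin 1 (e / K)) by (apply Rmin_glb_lt; lra).
  destruct (Hp _ d0) as (d1 & p1 & H1). destruct (Hq _ d0) as (d2 & p2 & H2).
  exists (Rmin d1 d2). split; [apply Rmin_glb_lt; auto|]. intros s Es Hs.
  specialize (H1 s Es (Rlt_le_trans _ _ _ Hs (Rmin_l _ _))).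
  specialize (H2 s Es (Rlt_le_trans _ _ _ Hs (Rmin_r _ _))).
  pose proof (Rmin_l 1 (e / K)). pose proof (Rmin_r 1 (e / K)).
  triangle3 ((p s - p t) * (q s - q t))%C ((p s - p t) * q t)%C (p t * (q s - q t))%C.
  rewrite !Cmod_mult. pose proof (Cmod_ge_0 (p s - p t)). pose proof (Cmod_ge_0 (q s - q t)).
  apply Rlt_le_trans with (e / K * K).
  - unfold K at 2. nra.
  - right. field. unfold K. lra.
Qed.

Lemma ccont_minus (E : C -> Prop) (p q : C -> C) (t : C) :
  ccont E p t -> ccont E q t -> ccont E (fun s => p s - q s)%C t.
Proof.
  intros Hp Hq e ep.
  destruct (Hp (e / 2)) as (d1 & p1 & H1); [lra|]. destruct (Hq (e / 2)) as (d2 & p2 & H2); [lra|].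
  exists (Rmin d1 d2). split; [apply Rmin_glb_lt; auto|]. intros s Es Hs.
  specialize (H1 s Es (Rlt_le_trans _ _ _ Hs (Rmin_l _ _))).
  specialize (H2 s Es (Rlt_le_trans _ _ _ Hs (Rmin_r _ _))).
  triangle (p s - p t)%C (- (q s - q t))%C.
  rewrite Cmod_opp. lra.
Qed.

Lemma ccont_comp (E : C -> Prop) (f g : C -> C) (z l : C) :
  ccont E f z -> cdiff g (f z) l -> ccont E (fun w => g (f w)) z.
Proof.
  intros Hf Hg e ep. destruct (cdiff_ccont _ _ _ (fun _ => True) Hg e ep) as (d & dp & Hd).
  destruct (Hf d dp) as (d' & dp' & Hd'). exists d'. split; auto.
Qed.

Lemma ccont_pow (E : C -> Prop) (f : C -> C) (z : C) (n : nat) :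
  ccont E f z -> ccont E (fun w => f w ^ n)%C z.
Proof.
  intros H. destruct (cdiff_pow (fun w => w) (f z) 1 n (cdiff_id _)) as [l Hl].
  exact (ccont_comp E f (fun w => w ^ n)%C z l H Hl).
Qed.

Lemma ccont_ext_loc (E : C -> Prop) (f g : C -> C) (z : C) (e : R) :
  0 < e -> (forall w, Cmod (w - z) < e -> f w = g w) -> ccont E f z -> ccont E g z.
Proof.
  intros ep Heq H k kp. destruct (H k kp) as (d & dp & Hd).
  exists (Rmin d e). split; [apply Rmin_glb_lt; auto|]. intros s Es Hs.
  rewrite <- Heq, <- Heq.
  - apply Hd; auto. eapply Rlt_le_trans; [apply Hs|apply Rmin_l].
  - replace (z - z)%C with (0 : C) by ring. now rewrite Cmod_0.
  - eapply Rlt_le_trans; [apply Hs|apply Rmin_r].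
Qed.

(** * Principal parts *)

Definition principal (c : nat -> C) (n : nat) (w : C) : C :=
  sum_n_m (G := C_AbelianMonoid) (fun k => c k / w ^ k)%C 1 n.

Lemma principal_O (c : nat -> C) (w : C) : principal c 0 w = 0%C.
Proof. apply (sum_n_m_zero (G := C_AbelianMonoid)). lia. Qed.

Lemma principal_S (c : nat -> C) (n : nat) (w : C) :
  principal c (S n) w = (principal c n w + c (S n) * / w ^ S n)%C.
Proof. apply (sum_n_Sm (G := C_AbelianMonoid)). lia. Qed.

Lemma cdiff_minus (f g : C -> C) (z l k : C) :
  cdiff f z l -> cdiff g z k -> cdiff (fun w => f w - g w)%C z (l - k)%C.
Proof.
  intros H1 H2. replace (l - k)%C with (l + (0 * g z + - (1) * k))%C by ring.
  apply cdiff_ext_loc with (fun w => f w + - (1) * g w)%C 1; [lra|intros; ring|].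
  apply cdiff_plus; auto. apply (cdiff_mult (fun _ => - (1))%C g); auto. apply cdiff_const.
Qed.

Lemma cdiff_principal (c : nat -> C) (n : nat) (z : C) :
  z <> 0%C -> exists l, cdiff (principal c n) z l.
Proof.
  intros hz. induction n as [|n [l IH]].
  - exists (RtoC 0). apply cdiff_ext_loc with (fun _ => RtoC 0) 1; [lra| |apply cdiff_const].
    intros w _. now rewrite principal_O.
  - destruct (cdiff_pow (fun w => w) z 1 (S n) (cdiff_id z)) as [k Hk].
    destruct (cdiff_inv_fun (fun w => w ^ S n)%C z k) as [k' Hk']; auto.
    { apply Cpow_nz. auto. }
    eexists. apply cdiff_ext_loc with
      (fun w => principal c n w + c (S n) * / w ^ S n)%C 1; [lra| |].
    + intros w _. now rewrite principal_S.
    + apply cdiff_plus; [exact IH|].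
      apply (cdiff_mult (fun _ => c (S n)) (fun w => / w ^ S n)%C); [apply cdiff_const|exact Hk'].
Qed.

Lemma series_csum (u : nat -> C) (l : C) (e : R) :
  is_series (V := C_NormedModule) u l -> 0 < e ->
  exists N0, forall n, (N0 <= n)%nat -> Cmod (csum u (S n) - l) < e.
Proof.
  intros H ep. destruct (H (fun w => Cmod (w - l) < e)) as [N0 HN].
  { destruct (Cmod_ball l l e ep) as [d Hd]. exists d. auto. }
  assert (E : forall n, csum u (S n) = sum_n (G := C_AbelianMonoid) u n).
  { induction n as [|n IH].
    - rewrite sum_O. simpl. ring.
    - rewrite sum_Sn, <- IH. reflexivity. }
  exists N0. intros n Hn. rewrite E. exact (HN n Hn).
Qed.

Lemma series_term_bounded (u : nat -> C) (l : C) :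
  is_series (V := C_NormedModule) u l -> exists B, 0 < B /\ forall k, Cmod (u k) <= B.
Proof.
  intros H. destruct (series_csum u l 1 H Rlt_0_1) as [N0 HN].
  assert (fin : exists B, 0 < B /\ forall k, (k <= N0)%nat -> Cmod (u k) <= B).
  { clear HN. induction N0 as [|n (B & Bp & HB)].
    - exists (Cmod (u 0%nat) + 1). pose proof (Cmod_ge_0 (u 0%nat)). split; [lra|].
      intros k Hk. replace k with 0%nat by lia. lra.
    - exists (B + Cmod (u (S n))). pose proof (Cmod_ge_0 (u (S n))). split; [lra|].
      intros k Hk. destruct (Nat.eq_dec k (S n)) as [->|ne]; [lra|]. specialize (HB k ltac:(lia)). lra. }
  destruct fin as (B & Bp & HB). exists (B + 2). split; [lra|]. intros k.
  destruct (Nat.le_gt_cases k N0) as [h|h]; [specialize (HB k h); lra|].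
  pose proof (HN k ltac:(lia)) as H1. pose proof (HN (k - 1)%nat ltac:(lia)) as H2.
  replace (S (k - 1)) with k in H2 by lia. simpl in H1. set (A := csum u k) in *.
  triangle (A + u k - l)%C (- (A - l))%C.
  rewrite Cmod_opp. lra.
Qed.

(** The terms at radius [rho] are bounded by some [B], so at [w] the tail from the quadratic term on
    is dominated by a geometric series of ratio [x <= / 2], hence by [2 * B * x ^ 2]. This gives
    differentiability at 0 once the singularity there has been removed. *)
Lemma power_series_cdiff (d : nat -> C) (h : C -> C) (r : R) :
  0 < r -> h 0%C = d 0%nat ->
  (forall w, 0 < Cmod w < r -> is_series (V := C_NormedModule) (fun k => d k * w ^ k)%C (h w)) ->
  cdiff h 0 (d 1%nat).
Proof.
  intros rp h0 Hs. set (rho := r / 2).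
  assert (Cr : Cmod rho = rho) by (rewrite Cmod_R, Rabs_pos_eq; unfold rho; lra).
  destruct (series_term_bounded _ _ (Hs rho ltac:(rewrite Cr; unfold rho; lra))) as (B & Bp & HB).
  assert (rhop : 0 < rho) by (unfold rho; lra).
  assert (bound : forall w, 0 < Cmod w <= rho / 2 ->
    Cmod (h w - d 0%nat - d 1%nat * w) <= 2 * B * (Cmod w / rho) ^ 2).
  { intros w Hw. set (x := Cmod w / rho).
    assert (x0 : 0 < x) by (apply Rdiv_lt_0_compat; lra).
    assert (x1 : x <= / 2).
    { apply Rmult_le_reg_r with rho; auto. unfold x, Rdiv. rewrite Rmult_assoc, Rinv_l; lra. }
    assert (term : forall k, Cmod (d k * w ^ k) <= B * x ^ k).
    { intros k. specialize (HB k). rewrite Cmod_mult, Cmod_pow, Cr in HB. rewrite Cmod_mult, Cmod_pow.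
      replace (Cmod w) with (rho * x) by (unfold x; field; lra). rewrite Rpow_mult_distr.
      rewrite <- Rmult_assoc. apply Rmult_le_compat_r; auto. apply pow_le. lra. }
    (* The factor [1 - (/ 2) ^ n] is the partial geometric sum that lets the induction close. *)
    assert (part : forall n,
      Cmod (csum (fun k => d k * w ^ k)%C (S (S n)) - d 0%nat - d 1%nat * w) <=
        2 * B * x ^ 2 * (1 - (/ 2) ^ n)).
    { induction n as [|n IH].
      - replace (csum (fun k => d k * w ^ k)%C 2 - d 0%nat - d 1%nat * w)%C with (RtoC 0) by (simpl; ring).
        rewrite Cmod_0. simpl. lra.
      - change (csum (fun k => d k * w ^ k)%C (S (S (S n)))) with
          (csum (fun k => d k * w ^ k)%C (S (S n)) + d (S (S n)) * w ^ S (S n))%C.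
        set (A := csum (fun k => d k * w ^ k)%C (S (S n))) in *.
        triangle (A - d 0%nat - d 1%nat * w)%C (d (S (S n)) * w ^ S (S n))%C.
        specialize (term (S (S n))).
        assert (P : x ^ n <= (/ 2) ^ n) by (apply pow_incr; lra).
        replace (x ^ S (S n)) with (x ^ 2 * x ^ n) in term by (simpl; ring).
        assert (B * (x ^ 2 * x ^ n) <= B * x ^ 2 * (/ 2) ^ n).
        { rewrite <- Rmult_assoc. apply Rmult_le_compat_l; auto.
          apply Rmult_le_pos; [lra|]. apply pow2_ge_0. }
        simpl ((/ 2) ^ S n). lra. }
    apply le_epsilon. intros e ep.
    destruct (series_csum _ _ e (Hs w ltac:(unfold rho in *; lra)) ep) as [N0 HN].
    specialize (HN (S N0) ltac:(lia)). specialize (part N0).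
    set (A := csum (fun k => d k * w ^ k)%C (S (S N0))) in *.
    triangle (- (A - h w))%C (A - d 0%nat - d 1%nat * w)%C.
    rewrite Cmod_opp.
    assert (2 * B * x ^ 2 * (1 - (/ 2) ^ N0) <= 2 * B * x ^ 2); [|lra].
    assert (0 <= (/ 2) ^ N0) by (apply pow_le; lra).
    assert (0 <= 2 * B * x ^ 2) by (apply Rmult_le_pos; [lra|apply pow2_ge_0]). nra. }
  intros e ep.
  assert (K : 0 < e * rho * rho / (2 * B)) by
    (apply Rdiv_lt_0_compat; [apply Rmult_lt_0_compat; [apply Rmult_lt_0_compat|]|]; lra).
  exists (Rmin (rho / 2) (e * rho * rho / (2 * B))). split; [apply Rmin_glb_lt; lra|].
  intros w Hw. pose proof (Rlt_le_trans _ _ _ Hw (Rmin_l _ _)) as H1.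
  pose proof (Rlt_le_trans _ _ _ Hw (Rmin_r _ _)) as H2.
  replace (w - 0)%C with w in * by ring. rewrite h0.
  destruct (Cmod_ge_0 w) as [wp|wp].
  - eapply Rle_trans; [apply bound; lra|].
    replace (2 * B * (Cmod w / rho) ^ 2) with (2 * B / (rho * rho) * Cmod w * Cmod w)
      by (field; lra).
    apply Rmult_le_compat_r; [lra|].
    apply Rle_trans with (2 * B / (rho * rho) * (e * rho * rho / (2 * B))).
    + apply Rmult_le_compat_l; [|lra]. apply Rdiv_le_0_compat; [lra|]. now apply Rmult_lt_0_compat.
    + right. field. lra.
  - symmetry in wp. apply Cmod_eq_0 in wp. subst w. rewrite h0.
    replace (d 0%nat - d 0%nat - d 1%nat * 0)%C with (RtoC 0) by ring. rewrite Cmod_0. lra.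
Qed.

(** * Residues along the curve *)

(** The integral is taken in a real vector space, so multiplication by a complex constant is checked
    on the two components. *)
Lemma is_RIntC_cmult (c : C) (f : R -> C) (a b : R) (l : C) :
  is_RIntC f a b l -> is_RIntC (fun t => c * f t)%C a b (c * l)%C.
Proof.
  intros H.
  pose proof (is_RInt_fct_extend_fst (U := R_NormedModule) (V := R_NormedModule) _ _ _ _ H) as H1.
  pose proof (is_RInt_fct_extend_snd (U := R_NormedModule) (V := R_NormedModule) _ _ _ _ H) as H2.
  apply (is_RInt_fct_extend_pair (U := R_NormedModule) (V := R_NormedModule) (fun t => c * f t)%C).
  - exact (is_RInt_minus _ _ _ _ _ _ (is_RInt_scal _ _ _ (fst c) _ H1) (is_RInt_scal _ _ _ (snd c) _ H2)).
  - exact (is_RInt_plus _ _ _ _ _ _ (is_RInt_scal _ _ _ (fst c) _ H2) (is_RInt_scal _ _ _ (snd c) _ H1)).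
Qed.

Lemma is_RIntC_conj (f : R -> C) (a b : R) (l : C) :
  is_RIntC f a b l -> is_RIntC (fun t => Cconj (f t)) a b (Cconj l).
Proof.
  intros H.
  pose proof (is_RInt_fct_extend_fst (U := R_NormedModule) (V := R_NormedModule) _ _ _ _ H) as H1.
  pose proof (is_RInt_fct_extend_snd (U := R_NormedModule) (V := R_NormedModule) _ _ _ _ H) as H2.
  apply (is_RInt_fct_extend_pair (U := R_NormedModule) (V := R_NormedModule) (fun t => Cconj (f t))).
  - exact H1.
  - exact (is_RInt_opp _ _ _ _ H2).
Qed.

(** From exponent 2 on, the negative powers have the single-valued primitive [Q]; exponent 1 is the
    winding integral. *)
Lemma integral_inv_pow (gamma : R -> C) (a b : R) (N : nat) (s : nat -> R) (v : nat -> R -> C) (k : nat) :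
  curve_data gamma a b N s v -> ~ trace gamma a b 0%C ->
  is_RIntC (fun t => / (gamma t) ^ S (S k) * speed gamma N s t)%C a b (RtoC 0).
Proof.
  intros [(ab & cl & _) Hc Hr] H0.
  assert (nz : forall t, a <= t <= b -> gamma t <> 0%C).
  { intros t Ht h. apply H0. exists t. auto. }
  assert (knz : RtoC (INR (S k)) <> 0%C).
  { apply Cmod_gt_0. rewrite Cmod_R, Rabs_pos_eq by apply pos_INR. apply lt_0_INR. lia. }
  set (Q := fun w : C => (- / RtoC (INR (S k)) * / w ^ S k)%C).
  assert (dpow : forall n w, cdiff (fun w => w ^ n)%C w (RtoC (INR n) * w ^ (n - 1))%C).
  { intros n w. induction n as [|n IH].
    - replace (RtoC (INR 0) * w ^ (0 - 1))%C with (RtoC 0) by (simpl; ring).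
      apply (cdiff_const (RtoC 1)).
    - replace (RtoC (INR (S n)) * w ^ (S n - 1))%C
        with (1 * w ^ n + w * (RtoC (INR n) * w ^ (n - 1)))%C.
      + apply (cdiff_mult (fun w => w) (fun w => w ^ n)%C); auto. apply cdiff_id.
      + rewrite S_INR, RtoC_plus. destruct n as [|n]; [simpl; ring|].
        replace (S (S n) - 1)%nat with (S n) by lia. replace (S n - 1)%nat with n by lia.
        simpl Cpow. ring. }
  assert (dQ : forall w : C, w <> 0%C -> cdiff Q w (/ w ^ S (S k))%C).
  { intros w hw. assert (hp : (w ^ S k)%C <> 0%C) by (apply Cpow_nz; auto).
    assert (D := cdiff_comp Cinv (fun w => w ^ S k)%C w _ _ (dpow (S k) w) (cdiff_inv _ hp)).
    assert (D' := cdiff_mult _ _ _ _ _ (cdiff_const (- / RtoC (INR (S k)))%C w) D). cbv beta in D'.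
    replace (/ w ^ S (S k))%C with (0 * / w ^ S k + - / RtoC (INR (S k)) *
      (- / (w ^ S k * w ^ S k) * (RtoC (INR (S k)) * w ^ (S k - 1))))%C; [exact D'|].
    replace (S k - 1)%nat with k by lia.
    assert (hk : (w ^ k)%C <> 0%C) by (apply Cpow_nz; auto).
    simpl Cpow. field. auto. }
  replace (RtoC 0) with (Q (gamma b) - Q (gamma a))%C by (rewrite cl; ring).
  apply (speed_ftc gamma a b N s v (fun t => / gamma t ^ S (S k))%C (fun t => Q (gamma t))); auto.
  - intros t Ht. apply (pcont_inv _ (fun t => gamma t ^ S (S k))%C).
    + apply Cpow_nz. auto.
    + apply pcont_pow. auto.
  - intros t Ht. apply pcont_comp with (fun _ => True); auto.
    eapply cdiff_ccont. apply dQ. auto.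
  - intros i t Hi Ht. destruct (regular_within _ _ _ _ _ _ i Hr Hi).
    apply (pdiff_comp Q gamma); [apply (proj2 (proj2 Hr) i Hi); auto|apply dQ, nz; lra].
Qed.

(* Partial fractions: [1 / (y^(k+1) (y - z)) = (1 / (y^k (y - z)) - 1 / y^(k+1)) / z]. *)
Lemma integral_inv_pow_resolvent (gamma : R -> C) (a b : R) (N : nat) (s : nat -> R)
    (v : nat -> R -> C) (z : C) (k : nat) :
  curve_data gamma a b N s v -> ~ trace gamma a b 0%C -> ~ trace gamma a b z -> z <> 0%C ->
  winding gamma a b N s 0 = (2 * PI * Ci)%C -> winding gamma a b N s z = 0%C ->
  is_RIntC (fun t => / (gamma t) ^ S k * / (gamma t - z) * speed gamma N s t)%C a b
    (- (2 * PI * Ci) / z ^ S k)%C.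
Proof.
  intros CD H0 Hz nz W0 Wz. assert (ab : a < b) by apply CD.
  assert (n0 : forall t, a <= t <= b -> gamma t <> 0%C).
  { intros t Ht h. apply H0. exists t. auto. }
  assert (n1 := trace_neq gamma a b).
  pose proof (winding_integral gamma a b N s v 0 CD H0) as I0. rewrite W0 in I0.
  pose proof (winding_integral gamma a b N s v z CD Hz) as Iz. rewrite Wz in Iz.
  induction k as [|k IH].
  - replace (- (2 * PI * Ci) / z ^ 1)%C with (/ z * (0 - 2 * PI * Ci))%C by (simpl; field; auto).
    apply is_RInt_ext with
      (fun t => / z * (/ (gamma t - z) * speed gamma N s t - / (gamma t - 0) * speed gamma N s t))%C.
    + rewrite Rmin_left, Rmax_right by lra. intros t Ht. eqC.
      assert (h1 := n1 t z Hz ltac:(lra)). assert (h0 := n0 t ltac:(lra)).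
      replace (gamma t - 0)%C with (gamma t) by ring. simpl. field. auto.
    + apply is_RIntC_cmult. now apply is_RIntC_minus.
  - assert (hzk : (z ^ k)%C <> 0%C) by (apply Cpow_nz; auto).
    replace (- (2 * PI * Ci) / z ^ S (S k))%C with (/ z * (- (2 * PI * Ci) / z ^ S k - 0))%C
      by (simpl; field; auto).
    apply is_RInt_ext with
      (fun t => / z * (/ (gamma t) ^ S k * / (gamma t - z) * speed gamma N s t -
        / (gamma t) ^ S (S k) * speed gamma N s t))%C.
    + rewrite Rmin_left, Rmax_right by lra. intros t Ht. eqC.
      assert (h1 := n1 t z Hz ltac:(lra)). assert (h0 := n0 t ltac:(lra)).
      assert (hk : (gamma t ^ k)%C <> 0%C) by (apply Cpow_nz; auto). simpl. field. auto.
    + apply is_RIntC_cmult. apply is_RIntC_minus; auto. now apply integral_inv_pow with v.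
Qed.

Lemma integral_principal_part (gamma : R -> C) (a b : R) (N : nat) (s : nat -> R)
    (v : nat -> R -> C) (z : C) (c : nat -> C) (n : nat) :
  curve_data gamma a b N s v -> ~ trace gamma a b 0%C -> ~ trace gamma a b z -> z <> 0%C ->
  winding gamma a b N s 0 = (2 * PI * Ci)%C -> winding gamma a b N s z = 0%C ->
  is_RIntC (fun t => principal c n (gamma t) * / (gamma t - z) * speed gamma N s t)%C
    a b (- (2 * PI * Ci) * principal c n z)%C.
Proof.
  intros CD H0 Hz nz W0 Wz. assert (ab : a < b) by apply CD.
  induction n as [|n IH].
  - rewrite principal_O. replace (- (2 * PI * Ci) * 0)%C with (RtoC 0) by ring.
    apply is_RIntC_zero; [lra|]. intros t _.
    rewrite principal_O. ring.
  - rewrite principal_S. pose proof (is_RIntC_cmult (c (S n)) _ _ _ _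
      (integral_inv_pow_resolvent gamma a b N s v z n CD H0 Hz nz W0 Wz)) as K.
    pose proof (is_RIntC_plus _ _ _ _ _ _ IH K) as J.
    match type of J with is_RInt _ _ _ ?l => match goal with |- is_RInt _ _ _ ?r =>
      replace r with l by (unfold Cdiv; ring) end end.
    eapply is_RInt_ext; [|exact J]. intros t _. eqC. cbv beta.
    rewrite principal_S. ring.
Qed.

(** * The double layer kernel *)

(** The gradient of the logarithm of the modulus, read as a complex number, is the conjugate of
    [/ (y - z)]; its scalar product with [n] is therefore a real part. *)
Lemma log_directional_derivative (y z n : C) :
  (y - z)%C <> 0%C ->
  directional_derivative (fun x => ln (Cmod (x - z))) y n = Re (n * / (y - z)).
Proof.
  intros h. assert (m := proj1 (Cmod_gt_0 _) h). pose proof (Cmod2_alt (y - z)) as E.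
  unfold directional_derivative. apply is_derive_unique.
  set (p := Re (y - z)) in *. set (q := Im (y - z)) in *.
  assert (pq : 0 < p * p + q * q).
  { replace (p * p + q * q) with (Cmod (y - z) ^ 2) by (rewrite E; ring). apply pow_lt. auto. }
  apply is_derive_ext with (fun t => ln (sqrt ((p + t * Re n) * (p + t * Re n) + (q + t * Im n) * (q + t * Im n)))).
  - intros t. f_equal. unfold Cmod. f_equal. unfold p, q.
    destruct y, z, n. unfold Re, Im, Cminus, Cplus, Copp, Cmult, RtoC; simpl. ring.
  - auto_derive.
    + rewrite !Rmult_0_l, !Rplus_0_r. split; auto. split; auto. now apply sqrt_lt_R0.
    + rewrite !Rmult_0_l, !Rplus_0_r.
      replace (Re (n * / (y - z))) with ((p * Re n + q * Im n) / (p * p + q * q)).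
      2: { match goal with |- @eq _ ?a ?b => change (@eq R a b) end.
           rewrite re_mult. clear E. subst p q. revert pq. clear h m.
           generalize (y - z)%C. intros [u w] pq.
           unfold Cinv, Re, Im in *; simpl in *. field. lra. }
      set (S := p * p + q * q) in *.
      assert (SS : sqrt S * sqrt S = S) by (apply sqrt_sqrt; lra).
      assert (0 < sqrt S) by now apply sqrt_lt_R0.
      match goal with |- @eq _ ?a ?b => change (@eq R a b) end.
      replace (/ S) with (/ (sqrt S * sqrt S)) by now rewrite SS. unfold Rdiv.
      rewrite <- SS at 3. field. lra.
Qed.

Lemma Cconj_unit (u : C) : Cmod u = 1 -> Cconj u = (/ u)%C.
Proof.
  intros H. assert (n : u <> 0%C) by (apply Cmod_gt_0; lra).
  pose proof (Cmod2_conj u) as E. rewrite H in E. replace (RtoC (1 ^ 2)) with (RtoC 1) in E by (f_equal; ring).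
  replace (Cconj u) with (/ u * (u * Cconj u))%C by (field; auto). rewrite <- E. ring.
Qed.

(** The exceptional set of the normal field consists of points, whereas integrals ignore parameters;
    injectivity keeps these finite in number. *)
Lemma parameters_of_points (gamma : R -> C) (a b : R) (L : list C) :
  (forall s t, a <= s < b -> a <= t < b -> gamma s = gamma t -> s = t) ->
  exists T, forall t, a < t < b -> In (gamma t) L -> In t T.
Proof.
  intros inj. induction L as [|c L [T HT]].
  - exists nil. intros t _ [].
  - destruct (classic (exists u, a < u < b /\ gamma u = c)) as [(u & Hu & E)|n].
    + exists (u :: T). intros t Ht [h|h]; [left|right; auto]. apply inj; try lra. congruence.
    + exists T. intros t Ht [h|h]; auto. exfalso. apply n. exists t. auto.
Qed.

Theorem lemma3p2 :
  forall (gamma : R -> C) (a b : R) (Omega_in Omega_out : C -> Prop)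
         (n f q : C -> C) (m : nat),
    piecewise_smooth gamma a b ->
    simple_closed gamma a b ->
    inner_component gamma a b Omega_in ->
    outer_component gamma a b Omega_out ->
    Omega_in (RtoC 0) ->
    positively_oriented gamma a b Omega_in ->
    is_outward_normal_field gamma a b Omega_in Omega_out n ->
    interior_riemann_map Omega_in (trace gamma a b) f ->
    (0 < m)%nat ->
    is_faber_laurent f m q ->
    forall z : C, Omega_out z ->
      let integrand := fun y : C =>
        (f y ^ m * directional_derivative (fun x => ln (Cmod (x - z))) y (n y))%C in
      ex_arc_integral gamma a b integrand /\
      Cconj (q z) = (- (1 / PI) * arc_integral gamma a b integrand)%C.
Proof.
  intros gamma a b Om Oout n f q m Hps Hsc Hin Hout O0 Hpos Hn Hf mp Hq z Oz integrand.
  destruct (piecewise_smooth_regular gamma a b Hps) as (Hc & N & s & v & Hr).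
  assert (CD : curve_data gamma a b N s v) by (constructor; auto).
  assert (Hsc' := Hsc). destruct Hsc' as (ab & cl & inj).
  assert (Hleft : forall i t, (i < N)%nat -> s i < t < s (S i) -> left_of gamma Om t (v i t)).
  { intros i t Hi Ht. now apply (left_side_interior gamma a b N s v Om Oout n i t). }
  assert (Ho : Copen Om).
  { apply (component_open (fun y => ~ trace gamma a b y)); [now apply trace_complement_open|apply Hin]. }
  assert (T0 : ~ trace gamma a b 0%C) by now apply Hin.
  assert (Tz : ~ trace gamma a b z) by now apply Hout.
  assert (W0 := winding_inner gamma a b N s v Om 0%C CD Hpos O0).
  assert (Wz := winding_outer gamma a b N s v Oout z CD Hout Oz).
  pose proof PI_RGT_0 as PIp.
  assert (PIC : RtoC PI <> 0%C) by (apply RtoC_neq_0; lra).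
  assert (piC : (2 * PI * Ci)%C <> 0%C).
  { repeat apply Cmult_neq_0; auto using Ci_nz. apply RtoC_neq_0; lra. }
  (* The winding integral, nonzero on the interior and 0 on the exterior, tells the two apart. *)
  assert (nOz : ~ Om z).
  { intros h. apply piC. rewrite <- Wz. symmetry. now apply (winding_inner gamma a b N s v Om). }
  assert (nz : z <> 0%C) by (intros ->; auto).
  assert (Df : disk_bijection Om f).
  { destruct Hf as [H1 H2 H3 H4 _ _ _]. repeat split; auto.
    intros w Ow. destruct (H1 w Ow) as [l Hl]. exists l. now apply cdiff_of_is_derive. }
  assert (f0 := riemann_at_0 _ _ _ Hf).
  set (E := fun w => Om w \/ trace gamma a b w) in *.
  assert (fc : forall w, E w -> ccont E f w).
  { apply continuous_on_ccont. apply (riemann_boundary _ _ _ Hf). }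
  assert (Et : forall t, a <= t <= b -> E (gamma t)) by (intros t Ht; right; exists t; auto).
  assert (unit : forall t, a <= t <= b -> Cmod (f (gamma t)) = 1).
  { intros t Ht. apply (disk_bijection_boundary Om E f); auto.
    - intros h. apply (proj1 (proj2 (proj1 Hin)) _ h). exists t. auto.
    - intros w Ow. now left.
    - intros r rp. now apply (interior_adherent gamma a b N s v). }
  assert (fnz : forall w : C, Om w -> w <> 0%C -> f w <> 0%C).
  { intros w Ow hw h. apply hw. apply (riemann_injective _ _ _ Hf); auto. now rewrite f0. }
  assert (fnt : forall t, a <= t <= b -> f (gamma t) <> 0%C).
  { intros t Ht. apply Cmod_gt_0. rewrite unit; auto. lra. }
  assert (wz : forall w, E w -> (w - z)%C <> 0%C).
  { intros w Ew h. apply Ceq_minus in h. subst w. destruct Ew; auto. }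
  assert (Dz : forall w, E w -> exists l, cdiff (fun w => / (w - z))%C w l).
  { intros w Ew. apply (cdiff_inv_fun (fun w => w - z)%C w (1 - 0)%C); auto.
    apply cdiff_minus; [apply cdiff_id|apply cdiff_const]. }
  assert (I1 : is_RIntC (fun t => f (gamma t) ^ m * / (gamma t - z) * speed gamma N s t)%C a b (RtoC 0)).
  { apply (cauchy_up_to_boundary gamma a b N s v Om f (fun w => f w ^ m * / (w - z))%C CD (proj1 Hin) Hleft Df).
    - intros w Ow. destruct (proj1 Df w Ow) as [l Hl]. destruct (cdiff_pow f w l m Hl) as [l' Hl'].
      destruct (Dz w (or_introl Ow)) as [k Hk]. eexists. exact (cdiff_mult _ _ _ _ _ Hl' Hk).
    - intros t Ht. destruct (Dz _ (Et t Ht)) as [k Hk]. apply ccont_mult.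
      + apply ccont_pow, fc. auto.
      + now apply cdiff_ccont with k. }
  destruct Hq as (Nq & c & d & r & rp & Hqc & Hqd).
  change (forall w : C, w <> RtoC 0 -> q w = principal c Nq w) in Hqc.
  (* The singularity of [(/ f) ^ m - q] at 0 is removed by the value [d 0], the constant coefficient
     of the power series. *)
  set (H := fun w : C => if excluded_middle_informative (w = RtoC 0) then d 0%nat
    else ((/ f w) ^ m - q w)%C).
  assert (Hloc : forall w : C, w <> 0%C -> exists e, 0 < e /\
    forall w', Cmod (w' - w) < e -> w' <> 0%C).
  { intros w hw. exists (Cmod w). split; [now apply Cmod_gt_0|]. intros w' Hw' ->.
    replace (0 - w)%C with (- w)%C in Hw' by ring. rewrite Cmod_opp in Hw'. lra. }
  assert (qd : forall w : C, w <> 0%C -> exists l, cdiff q w l).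
  { intros w hw. destruct (cdiff_principal c Nq w hw) as [l Hl]. exists l.
    destruct (Hloc w hw) as (e & ep & He).
    apply cdiff_ext_loc with (3 := Hl) (e := e); auto. intros w' Hw'. symmetry. apply Hqc. auto. }
  assert (Hd : holomorphic_on Om H).
  { intros w Ow. destruct (classic (w = RtoC 0)) as [->|hw].
    - exists (d 1%nat). apply power_series_cdiff with r; auto.
      + unfold H. now destruct excluded_middle_informative.
      + intros w Hw. unfold H. destruct excluded_middle_informative as [->|]; auto.
        rewrite Cmod_0 in Hw. lra.
    - destruct (proj1 Df w Ow) as [l Hl].
      destruct (cdiff_inv_fun f w l (fnz w Ow hw) Hl) as [l1 Hl1].
      destruct (cdiff_pow (fun w => / f w)%C w l1 m Hl1) as [l2 Hl2].
      destruct (qd w hw) as [l3 Hl3]. exists (l2 - l3)%C.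
      destruct (Hloc w hw) as (e & ep & He).
      apply cdiff_ext_loc with (fun w => (/ f w) ^ m - q w)%C e; auto.
      + intros w' Hw'. unfold H. destruct excluded_middle_informative; auto. exfalso. now apply (He w').
      + now apply cdiff_minus. }
  assert (nt0 : forall t, a <= t <= b -> gamma t <> 0%C).
  { intros t Ht h. apply T0. exists t. auto. }
  assert (I2 : is_RIntC (fun t => H (gamma t) * / (gamma t - z) * speed gamma N s t)%C a b (RtoC 0)).
  { apply (cauchy_up_to_boundary gamma a b N s v Om f (fun w => H w * / (w - z))%C CD (proj1 Hin) Hleft Df).
    - intros w Ow. destruct (Hd w Ow) as [l Hl].
      destruct (Dz w (or_introl Ow)) as [k Hk]. eexists. exact (cdiff_mult _ _ _ _ _ Hl Hk).
    - intros t Ht. destruct (Dz _ (Et t Ht)) as [k Hk].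
      apply ccont_mult; [|now apply cdiff_ccont with k].
      destruct (Hloc _ (nt0 t Ht)) as (e & ep & He).
      apply ccont_ext_loc with (fun w => (/ f w) ^ m - q w)%C e; auto.
      + intros w' Hw'. unfold H. destruct excluded_middle_informative; auto. exfalso. now apply (He w').
      + destruct (qd _ (nt0 t Ht)) as [l Hl]. apply ccont_minus; [|now apply cdiff_ccont with l].
        apply (ccont_pow E (fun w => / f w)%C).
        apply (ccont_comp E f Cinv _ _ (fc _ (Et t Ht)) (cdiff_inv _ (fnt t Ht))). }
  assert (I3 := integral_principal_part gamma a b N s v z c Nq CD T0 Tz nz W0 Wz).
  rewrite <- (Hqc z nz) in I3.
  assert (I4 : is_RIntC (fun t => (/ f (gamma t)) ^ m * / (gamma t - z) * speed gamma N s t)%C a b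
    (0 + - (2 * PI * Ci) * q z)%C).
  { eapply is_RInt_ext; [|exact (is_RIntC_plus _ _ _ _ _ _ I2 I3)].
    rewrite Rmin_left, Rmax_right by lra. intros t Ht. eqC. cbv beta.
    assert (g0 := nt0 t ltac:(lra)). rewrite <- (Hqc _ g0).
    unfold H. destruct excluded_middle_informative; [tauto|]. ring. }
  set (L := (/ (2 * Ci) * (0 - Cconj (0 + - (2 * PI * Ci) * q z)))%C).
  assert (I5 := is_RIntC_cmult (/ (2 * Ci))%C _ _ _ _
    (is_RIntC_minus _ _ _ _ _ _ I1 (is_RIntC_conj _ _ _ _ I4))). fold L in I5.
  assert (twoi : (2 * Ci)%C <> 0%C).
  { apply Cmult_neq_0; [|apply Ci_nz]. apply RtoC_neq_0; lra. }
  assert (EL : L = (- PI * Cconj (q z))%C).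
  { unfold L. rewrite Cplus_conj, !Cmult_conj, Copp_conj, !Cmult_conj.
    replace (Cconj 0) with (RtoC 0) by (unfold Cconj, RtoC; simpl; f_equal; ring).
    replace (Cconj 2) with (RtoC 2) by (unfold Cconj, RtoC; simpl; f_equal; ring).
    replace (Cconj PI) with (RtoC PI) by (unfold Cconj, RtoC; simpl; f_equal; ring).
    replace (Cconj Ci) with (- Ci)%C by (unfold Cconj, Ci, Copp; simpl; f_equal; ring).
    field. apply Ci_nz. }
  assert (main : is_RIntC (arc_integrand gamma integrand) a b L).
  { destruct Hn as [corners Hn].
    destruct (parameters_of_points gamma a b corners inj) as [T HT].
    (* Two kinds of parameters are discarded: the ends of the pieces, where [velocity] may be junk,
       and those of the points where the normal field is unspecified. *)
    refine (is_RIntC_ext_list (map s (seq 0 (Datatypes.S N)) ++ T) _ _ a b L (Rlt_le _ _ ab) _ I5).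
    intros t Ht nin. cbv beta.
    assert (nT : ~ In (gamma t) corners).
    { intros h. apply nin, in_or_app. right. now apply HT. }
    destruct (regular_cases gamma a b N s v t Hr) as [(i & Hi & Hit)|(i & Hi & Eit)]; [lra| |].
    2: { exfalso. apply nin, in_or_app. left. rewrite Eit. apply in_map, in_seq. lia. }
    destruct (speed_piece gamma a b N s v i t Hr Hi Hit) as [E1 E2].
    assert (En := outward_normal_right gamma a b N s v Om Oout i t (n (gamma t)) CD Hin Hout Hpos Hi Hit
      (Hn t ltac:(lra) nT)).
    unfold arc_integrand, integrand. rewrite E1, E2, En.
    assert (gz : (gamma t - z)%C <> 0%C) by (apply wz, Et; lra).
    rewrite log_directional_derivative by auto.
    assert (v0 : v i t <> 0%C) by (apply (proj2 (proj2 Hr) i Hi); lra).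
    assert (mv := proj1 (Cmod_gt_0 _) v0).
    assert (mC : RtoC (Cmod (v i t)) <> 0%C) by (apply RtoC_neq_0; lra).
    set (X := (/ (gamma t - z) * v i t)%C).
    (* The normalisation of the left normal cancels the arc length factor [Cmod (v i t)], leaving
       the imaginary part of [X]. *)
    assert (ReX : (Re (- left_normal (v i t) * / (gamma t - z)) * Cmod (v i t) =
      / (2 * Ci) * (X - Cconj X))%C).
    { rewrite <- RtoC_mult, <- re_scal_r.
      replace (- left_normal (v i t) * / (gamma t - z) * Cmod (v i t))%C with (- (X * Ci))%C
        by (unfold X, left_normal; field; auto).
      rewrite re_opp, re_mult_Ci, Ropp_involutive, im_alt. field. repeat split; auto using Ci_nz. }
    rewrite <- (Cmult_assoc _ (RtoC _) (RtoC _)), ReX.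
    assert (U := unit t ltac:(lra)).
    (* On the unit circle [f ^ m * Cconj X] is the conjugate of [(/ f) ^ m * X], the integrand of
       [I4]. *)
    rewrite <- (Cconj_unit _ U). rewrite <- Cpow_conj, <- !Cmult_assoc, Cmult_conj, Cconj_conj.
    fold X. ring. }
  split.
  - exists L. exact main.
  - unfold arc_integral. rewrite (is_RInt_unique (V := C_R_CompleteNormedModule) _ _ _ _ main).
    rewrite EL. field. auto.
Qed.
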